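(* Let $G$ be a weakly connected directed graph (finite or infinite) without multiple edges, with edges colored $1$ and $2$. Then $G$ is isomorphic (by an isomorphism preserving directions and colors of edges) to an S-graph $S(A,B)$ (finite or infinite) if and only if one can distinguish some vertices and some $1$-edges of $G$ as central so that Axioms (B0), (B1), (B2), (B3), (B4), (B3$'$), (B4$'$), (BA) hold.
   Context: **RA2-graphs.** Let each of $A,B$ be one of the index sets $\{0,1,\dots,a\}$ ($a\in\mathbb{Z}_{\ge0}$), $\mathbb{Z}_{\ge 0}$, $\mathbb{Z}_{\le 0}$, $\mathbb{Z}$. The right $A$-sail $R$ has vertices $(i,j)\in A^2$ with $j\le i$; the left $A$-sail $L$ has vertices $(i,j)\in B^2$ with $i\le j$; in both, all pairs $((i,j),(i+1,j))$ are edges of color I and all pairs $((i,j),(i,j+1))$ are edges of color II. The RA2-graph $C(A,B)$ is obtained from disjoint copies $R_j$ ($j\in B$) of $R$ and $L_i$ ($i\in A$) of $L$ by identifying, for every $(i,j)\in A\times B$, the vertex $(i,i)$ of $R_j$ with the vertex $(j,j)$ of $L_i$; the resulting vertex is called the principal vertex $(i,j)$. Each maximal path of color I (I-string) and each maximal path of color II (II-string) contains exactly one principal vertex. A vertex of $C(A,B)$ is an $\otimes$-vertex if it is a vertex $(k,l)$ of some $L_i$ with $l-k$ odd; the other vertices are ordinary. **$B$-sails.** For $r,m\in\mathbb{Z}_{\ge0}\cup\{\infty\}$, the left $B$-sail has as vertices the integer points $(p,q)$ with $-r\le p\le q\le m$, $q\ge 2p$, and the half-integer points $(k+\frac12,2k+1)$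 with $k\in\mathbb{Z}_{\ge0}$, $2k+1\le m$. Its edges are all pairs $((p,q),(p+1,q))$ (color 1) and $((p,q),(p,q+1))$ (color 2) of its integer vertices, and the left half-edges $((k,2k+1),(k+\frac12,2k+1))$ (color 1). Its diagonal is the sequence $d_t$, $t\in\mathbb{Z}$, $-r\le t\le m$, where $d_t=(t,t)$ for $t\le 0$ and $d_t=(t/2,t)$ for $t\ge0$. For $n,q\in\mathbb{Z}_{\ge0}\cup\{\infty\}$, the right $B$-sail has as vertices the integer points $(p,s)$ with $-n\le s\le p\le q$, $s\le 2p$, and the points $(-k-\frac12,-2k-1)$ with $k\in\mathbb{Z}_{\ge0}$, $2k+1\le n$. Its edges are all pairs $((p,s),(p+1,s))$ (color 1) and $((p,s),(p,s+1))$ (color 2) of its integer vertices, and the right half-edges $((-k-\frac12,-2k-1),(-k,-2k-1))$ (color 1). Its diagonal is $d_t$, $-n\le t\le q$, with $d_t=(t/2,t)$ for $t\le0$ and $d_t=(t,t)$ for $t\ge0$. **S-graphs.** The S-graph $S(A,B)$ is obtained from $C=C(A,B)$ as follows. For each II-string $P$ with principal vertex $(i,j)$ take a left $B$-sail with $r=|\{k\in A:k<i\}|$, $m=|\{k\in B:k>j\}|$ and identify the vertices of $P$, in their order, with the diagonal $(d_t)$, the principal vertex being identified with $d_0$. For each I-string $P$ with principal vertex $(i,j)$ take a right $B$-sail with $q=|\{k\in A:k>i\}|$, $n=|\{k\in B:k<j\}|$ and identify the vertices of $P$, in their order, with its diagonal, the principal vertex being identified with $d_0$. Delete all edges of $C$.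 Each $\otimes$-vertex $w$ is then incident to exactly one left half-edge $(u,w)$ and one right half-edge $(w,z)$; replace these by a single edge $(u,z)$ of color 1 and delete $w$. **Axioms.** $G$ is a weakly connected 2-edge-colored digraph (colors $1,2$) without multiple edges, possibly infinite; an edge of color $i$ is an $i$-edge; some vertices and some 1-edges are distinguished as central. (B0) For $i=1,2$, each vertex has at most one entering $i$-edge and at most one leaving $i$-edge, and the components of the subgraph formed by all vertices and all $i$-edges (called $i$-strings) are finite or infinite directed paths (possibly single vertices). For $i=1,2$ let $\mathbf{i}$ be the partial invertible operator with $\mathbf{i}u=v$ iff $(u,v)$ is an $i$-edge. (B1) Each 1-string has exactly one central element, which is either a vertex or an edge. A vertex is left (right) if it lies before (after) the central element of its 1-string; a 1-edge $(u,v)$ that is not central is left if $u$ is left and right if $v$ is right. (B2) Each 2-string $P$ contains exactly one central vertex $v$; all vertices of $P$ before $v$ are right and all vertices of $P$ after $v$ are left. A 2-edge $(u,v)$ is left if $v$ is left, and right if $u$ is right. A commutative square is a quadruple $u,v,u',v'$ with $v=\mathbf1u$, $u'=\mathbf2u$, $v'=\mathbf1u'=\mathbf2v$, together with its four edges. (B3) (i) If $(u,v)$ is a left 1-edge and there is a 2-edge leaving $u$ or $v$, then these two edges belong to a commutative square. (ii) If $(v,w)$ is a left 2-edge and there is a 1-edge entering $v$ or $w$, then these two edges belong to a commutative square. (B3$'$) (i) If $(u,v)$ is a right 1-edge and there is a 2-edge entering $u$ or $v$, then these two edges belong to a commutative square. (ii) If $(v,w)$ is a right 2-edge and there is a 1-edge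 leaving $v$ or $w$, then these two edges belong to a commutative square. (B4) If $u$ is the beginning vertex of a central edge and there are a 2-edge $(u,w)$, a 1-edge $(w,w')$ and a 2-edge $(w',v)$, then $v$ is the beginning vertex of a central edge. (B4$'$) If $u$ is the end vertex of a central edge and there are a 2-edge $(w,u)$, a 1-edge $(w',w)$ and a 2-edge $(v,w')$, then $v$ is the end vertex of a central edge. Central graph $C(G)$ (for $G$ satisfying the axioms above): its vertices are the central vertices of $G$ and the mid-points of central edges of $G$ (one for each central edge); the mid-points are its $\otimes$-vertices. Cutting $G$ at all central vertices (one copy keeps the entering 1-edge and leaving 2-edge, the other the leaving 1-edge and entering 2-edge) and at mid-points of central edges gives left components (formed by left edges and left half-edges) and right components; the central points in such a component form its linearly ordered diagonal. $C(G)$ has an edge of color II from $u$ to $v$ iff $v$ is next to $u$ in the diagonal of a left component, and an edge of color I from $u$ to $v$ iff $v$ is next to $u$ in the diagonal of a right component. Explicitly, II-edges go: from a central vertex $v$ to $\mathbf1\mathbf2v$ if this is defined and central; from a central vertex $v$ to the mid-point of $(\mathbf2v,\mathbf1\mathbf2v)$ if this is a central edge; from the mid-point of a central edge $(x,x')$ to $\mathbf1\mathbf2x$ if defined (it is then a central vertex). I-edges go: to a central vertex $v$ from $\mathbf1^{-1}\mathbf2^{-1}v$ if this is defined and central; to a central vertex $v$ from the mid-point of $(\mathbf1^{-1}\mathbf2^{-1}v,\mathbf2^{-1}v)$ if this is a central edge; to the mid-point of a central edge $(x,x')$ from $\mathbf1^{-1}\mathbf2^{-1}x'$ if defined (it is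 then a central vertex). (BA) $C(G)$ is an RA2-graph with the same $\otimes$-vertices, i.e. for some $A,B$ there is an isomorphism $C(G)\to C(A,B)$ preserving directions and colors of edges and mapping the set of $\otimes$-vertices of $C(G)$ onto the set of $\otimes$-vertices of $C(A,B)$. *)

(* Defs.v *)
From Stdlib Require Import ZArith List Relations FinFun ClassicalEpsilon.
Set Implicit Arguments.
Local Open Scope Z_scope.

(** * Labelled digraphs *)

(** There is at most one edge with a given label from one vertex to another. *)
Record lgraph (L : Type) : Type := LGraph {
  vtx :> Type;
  edge : L -> vtx -> vtx -> Prop
}.
Arguments LGraph {L vtx} edge.
Arguments edge {L} l _ _ _.

(** Also used for the colors I and II, rendered as [c1] and [c2]. *)
Inductive color : Type := c1 | c2.

Definition digraph : Type := lgraph color.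

Definition no_multiple_edges (G : digraph) : Prop :=
  forall u v : G, ~ (edge G c1 u v /\ edge G c2 u v).

Definition weakly_connected (G : digraph) : Prop :=
  forall u v : G, clos_refl_sym_trans G (fun x y => exists c, edge G c x y) u v.

Definition is_isomorphism {L : Type} (G H : lgraph L) (f : G -> H) : Prop :=
  Bijective f /\ forall l u v, edge G l u v <-> edge H l (f u) (f v).

Definition isomorphic {L : Type} (G H : lgraph L) : Prop :=
  exists f : G -> H, is_isomorphism G H f.

Definition induced {L T : Type} (dom : T -> Prop) (e : L -> T -> T -> Prop) : lgraph L :=
  LGraph (vtx := {x : T | dom x}) (fun l u v => e l (proj1_sig u) (proj1_sig v)).

Definition edgeless (L T : Type) : lgraph L :=
  LGraph (vtx := T) (fun _ _ _ => False).

Definition gsum {L : Type} (G H : lgraph L) : lgraph L :=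
  LGraph (vtx := (G + H)%type) (fun l u v =>
    match u, v with
    | inl x, inl y => edge G l x y
    | inr x, inr y => edge H l x y
    | _, _ => False
    end).

Definition gunion {L I : Type} (F : I -> lgraph L) : lgraph L :=
  LGraph (vtx := {i : I & F i}) (fun l u v =>
    exists i x y, u = existT _ i x /\ v = existT _ i y /\ edge (F i) l x y).

(** Equivalence classes of the equivalence relation generated by [glue]. *)
Definition quotient {T : Type} (glue : relation T) : Type :=
  {P : T -> Prop | exists x, P = clos_refl_sym_trans T glue x}.

Definition cls {T : Type} (glue : relation T) (x : T) : quotient glue :=
  exist _ (clos_refl_sym_trans T glue x) (ex_intro _ x eq_refl).

Definition identify {L : Type} (G : lgraph L) (glue : relation G) : lgraph L :=
  LGraph (vtx := quotient glue) (fun l P Q =>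
    exists x y, P = cls glue x /\ Q = cls glue y /\ edge G l x y).

Fixpoint walk {T : Type} (e : relation T) (n : nat) (u v : T) : Prop :=
  match n with
  | O => u = v
  | S n' => exists w, e u w /\ walk e n' w v
  end.

(** [v] comes [t] steps after [u] (so [-t] steps before [u] if [t <= 0]). *)
Definition position {T : Type} (e : relation T) (u : T) (t : Z) (v : T) : Prop :=
  (0 <= t /\ walk e (Z.to_nat t) u v) \/ (t <= 0 /\ walk e (Z.to_nat (- t)) v u).

(** * RA2-graphs *)

Inductive index_set : Type :=
| Segment (a : nat)
| NonNeg
| NonPos
| AllInt.

Definition mem (A : index_set) (k : Z) : Prop :=
  match A with
  | Segment a => 0 <= k <= Z.of_nat a
  | NonNeg => 0 <= k
  | NonPos => k <= 0
  | AllInt => True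
  end.

Definition idx (A : index_set) : Type := {k : Z | mem A k}.

Inductive grid_edge : color -> Z * Z -> Z * Z -> Prop :=
| grid_edge_I i j : grid_edge c1 (i, j) (i + 1, j)
| grid_edge_II i j : grid_edge c2 (i, j) (i, j + 1).

Definition right_sail (A : index_set) : digraph :=
  induced (fun v => mem A (fst v) /\ mem A (snd v) /\ snd v <= fst v) grid_edge.

Definition left_sail (B : index_set) : digraph :=
  induced (fun v => mem B (fst v) /\ mem B (snd v) /\ fst v <= snd v) grid_edge.

(** The vertex [(i, i)] of a sail. *)
Definition right_sail_diag {A : index_set} (i : idx A) : right_sail A :=
  let (k, H) := i in exist _ (k, k) (conj H (conj H (Z.le_refl k))).

Definition left_sail_diag {B : index_set} (j : idx B) : left_sail B :=
  let (k, H) := j in exist _ (k, k) (conj H (conj H (Z.le_refl k))).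

Definition RA2_pieces (A B : index_set) : digraph :=
  gsum (gunion (fun _ : idx B => right_sail A)) (gunion (fun _ : idx A => left_sail B)).

(** The vertex [v] of the copy [R_j], resp. [L_i]. *)
Definition in_R {A B : index_set} (j : idx B) (v : right_sail A) : RA2_pieces A B :=
  inl (existT _ j v).

Definition in_L {A B : index_set} (i : idx A) (v : left_sail B) : RA2_pieces A B :=
  inr (existT _ i v).

Inductive RA2_glue (A B : index_set) : RA2_pieces A B -> RA2_pieces A B -> Prop :=
| RA2_glue_diag (i : idx A) (j : idx B) :
    RA2_glue (in_R j (right_sail_diag i)) (in_L i (left_sail_diag j)).

Definition RA2 (A B : index_set) : digraph :=
  identify (RA2_pieces A B) (@RA2_glue A B).

Definition principal {A B : index_set} (ij : idx A * idx B) : RA2 A B :=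
  cls (@RA2_glue A B) (in_R (snd ij) (right_sail_diag (fst ij))).

Definition RA2_otimes {A B : index_set} (w : RA2 A B) : Prop :=
  exists (i : idx A) (v : left_sail B),
    Z.Odd (snd (proj1_sig v) - fst (proj1_sig v)) /\ w = cls (@RA2_glue A B) (in_L i v).

(** * B-sails *)

(** Elements of [Z_{>=0} + {infinity}], with [None] for infinity. *)
Definition enat : Type := option nat.

Definition Zle_enat (t : Z) (n : enat) : Prop :=
  match n with
  | Some n' => t <= Z.of_nat n'
  | None => True
  end.

Definition has_card (P : Z -> Prop) (n : enat) : Prop :=
  let enumerates l := NoDup l /\ forall x, In x l <-> P x in
  match n with
  | Some n' => exists l, enumerates l /\ length l = n'
  | None => ~ exists l, enumerates l
  end.

Definition card (P : Z -> Prop) : enat := epsilon (inhabits None) (has_card P).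

(** Half-edges all have color 1. *)
Inductive edge_kind : Type := Full (c : color) | LeftHalf | RightHalf.

(** In B-sails the first coordinate is doubled: the point [(x, y)] is
    represented by [(2 * x, y)], so that half-integer points have an odd first
    component. *)
Inductive left_Bsail_vertex (r m : enat) : Z * Z -> Prop :=
| left_Bsail_int p q :
    Zle_enat (- p) r -> p <= q -> Zle_enat q m -> 2 * p <= q ->
    left_Bsail_vertex r m (2 * p, q)
| left_Bsail_half k :
    0 <= k -> Zle_enat (2 * k + 1) m ->
    left_Bsail_vertex r m (2 * k + 1, 2 * k + 1).

Inductive left_Bsail_edge : edge_kind -> Z * Z -> Z * Z -> Prop :=
| left_Bsail_edge1 p q : left_Bsail_edge (Full c1) (2 * p, q) (2 * (p + 1), q)
| left_Bsail_edge2 p q : left_Bsail_edge (Full c2) (2 * p, q) (2 * p, q + 1)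
| left_Bsail_half_edge k : 0 <= k ->
    left_Bsail_edge LeftHalf (2 * k, 2 * k + 1) (2 * k + 1, 2 * k + 1).

Definition left_Bsail (r m : enat) : lgraph edge_kind :=
  induced (left_Bsail_vertex r m) left_Bsail_edge.

Definition left_Bsail_diag (t : Z) : Z * Z := (if t <=? 0 then 2 * t else t, t).

Inductive right_Bsail_vertex (n q : enat) : Z * Z -> Prop :=
| right_Bsail_int p s :
    Zle_enat (- s) n -> s <= p -> Zle_enat p q -> s <= 2 * p ->
    right_Bsail_vertex n q (2 * p, s)
| right_Bsail_half k :
    0 <= k -> Zle_enat (2 * k + 1) n ->
    right_Bsail_vertex n q (- 2 * k - 1, - 2 * k - 1).

Inductive right_Bsail_edge : edge_kind -> Z * Z -> Z * Z -> Prop :=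
| right_Bsail_edge1 p s : right_Bsail_edge (Full c1) (2 * p, s) (2 * (p + 1), s)
| right_Bsail_edge2 p s : right_Bsail_edge (Full c2) (2 * p, s) (2 * p, s + 1)
| right_Bsail_half_edge k : 0 <= k ->
    right_Bsail_edge RightHalf (- 2 * k - 1, - 2 * k - 1) (- 2 * k, - 2 * k - 1).

Definition right_Bsail (n q : enat) : lgraph edge_kind :=
  induced (right_Bsail_vertex n q) right_Bsail_edge.

Definition right_Bsail_diag (t : Z) : Z * Z := (if t <=? 0 then t else 2 * t, t).

(** * S-graphs *)

Definition below (A : index_set) (i : Z) : enat := card (fun k => mem A k /\ k < i).
Definition above (A : index_set) (i : Z) : enat := card (fun k => mem A k /\ k > i).

(** Strings of [RA2 A B] are indexed by their principal vertices. *)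
Definition left_Bsail_at {A B : index_set} (ij : idx A * idx B) : lgraph edge_kind :=
  left_Bsail (below A (proj1_sig (fst ij))) (above B (proj1_sig (snd ij))).

Definition right_Bsail_at {A B : index_set} (ij : idx A * idx B) : lgraph edge_kind :=
  right_Bsail (below B (proj1_sig (snd ij))) (above A (proj1_sig (fst ij))).

Definition S_pieces (A B : index_set) : lgraph edge_kind :=
  gsum (edgeless edge_kind (RA2 A B))
    (gsum (gunion (@left_Bsail_at A B)) (gunion (@right_Bsail_at A B))).

Inductive S_glue (A B : index_set) : S_pieces A B -> S_pieces A B -> Prop :=
| S_glue_II ij t (w : RA2 A B) (d : left_Bsail_at ij) :
    position (edge (RA2 A B) c2) (principal ij) t w ->
    proj1_sig d = left_Bsail_diag t ->
    S_glue (inl w) (inr (inl (existT _ ij d)))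
| S_glue_I ij t (w : RA2 A B) (d : right_Bsail_at ij) :
    position (edge (RA2 A B) c1) (principal ij) t w ->
    proj1_sig d = right_Bsail_diag t ->
    S_glue (inl w) (inr (inr (existT _ ij d))).

(** The graph with half-edges, before the deletion of the otimes-vertices. *)
Definition S_with_halves (A B : index_set) : lgraph edge_kind :=
  identify (S_pieces A B) (@S_glue A B).

Definition S_otimes {A B : index_set} (w : S_with_halves A B) : Prop :=
  exists w0 : RA2 A B, RA2_otimes w0 /\ w = cls (@S_glue A B) (inl w0).

Definition S_edge (A B : index_set) (c : color) (u z : S_with_halves A B) : Prop :=
  edge (S_with_halves A B) (Full c) u z \/
  (c = c1 /\ exists w, S_otimes w /\
     edge (S_with_halves A B) LeftHalf u w /\
     edge (S_with_halves A B) RightHalf w z).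

Definition S_graph (A B : index_set) : digraph :=
  induced (fun w : S_with_halves A B => ~ S_otimes w) (@S_edge A B).

(** * Axioms *)

Definition string_of (G : digraph) (c : color) (v : G) : G -> Prop :=
  clos_refl_sym_trans G (edge G c) v.

(** [P] is the vertex set of a finite or infinite directed path, whose vertices
    are listed by an interval [I] of the integers. *)
Definition is_directed_path {T : Type} (e : relation T) (P : T -> Prop) : Prop :=
  exists (I : Z -> Prop) (p : Z -> T),
    (forall s k t, I s -> I t -> s <= k <= t -> I k) /\
    (forall s t, I s -> I t -> p s = p t -> s = t) /\
    (forall x, P x <-> exists t, I t /\ p t = x) /\
    (forall s t, I s -> I t -> (e (p s) (p t) <-> t = s + 1)).

Record central_marking (G : digraph) : Type := CentralMarking {
  cvert : G -> Prop;
  cedge : G -> G -> Prop;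
  cedge_edge : forall u v, cedge u v -> edge G c1 u v
}.

Definition axiom_B0 (G : digraph) : Prop :=
  forall c : color,
    (forall u u' v, edge G c u v -> edge G c u' v -> u = u') /\
    (forall u v v', edge G c u v -> edge G c u v' -> v = v') /\
    (forall v, is_directed_path (edge G c) (string_of G c v)).

Definition axiom_B1 (G : digraph) (M : central_marking G) : Prop :=
  forall x : G, exists! y : G + G * G,
    match y with
    | inl v => string_of G c1 x v /\ cvert M v
    | inr (u, v) => string_of G c1 x u /\ cedge M u v
    end.

Definition left_vertex {G : digraph} (M : central_marking G) (v : G) : Prop :=
  (exists z, cvert M z /\ clos_trans G (edge G c1) v z) \/
  (exists z z', cedge M z z' /\ clos_refl_trans G (edge G c1) v z).

Definition right_vertex {G : digraph} (M : central_marking G) (v : G) : Prop :=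
  (exists z, cvert M z /\ clos_trans G (edge G c1) z v) \/
  (exists z z', cedge M z z' /\ clos_refl_trans G (edge G c1) z' v).

Definition left_edge {G : digraph} (M : central_marking G) (c : color) (u v : G) : Prop :=
  match c with
  | c1 => edge G c1 u v /\ ~ cedge M u v /\ left_vertex M u
  | c2 => edge G c2 u v /\ left_vertex M v
  end.

Definition right_edge {G : digraph} (M : central_marking G) (c : color) (u v : G) : Prop :=
  match c with
  | c1 => edge G c1 u v /\ ~ cedge M u v /\ right_vertex M v
  | c2 => edge G c2 u v /\ right_vertex M u
  end.

Definition axiom_B2 (G : digraph) (M : central_marking G) : Prop :=
  forall x : G,
    (exists! v, string_of G c2 x v /\ cvert M v) /\
    (forall v, string_of G c2 x v -> cvert M v ->
       (forall u, clos_trans G (edge G c2) u v -> right_vertex M u) /\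
       (forall u, clos_trans G (edge G c2) v u -> left_vertex M u)).

Definition commutative_square {G : digraph} (u v u' v' : G) : Prop :=
  edge G c1 u v /\ edge G c2 u u' /\ edge G c1 u' v' /\ edge G c2 v v'.

(** The 1-edge [e] and the 2-edge [f] belong to a commutative square. *)
Definition in_common_square {G : digraph} (e f : G * G) : Prop :=
  exists u v u' v' : G, commutative_square u v u' v' /\
    (e = (u, v) \/ e = (u', v')) /\ (f = (u, u') \/ f = (v, v')).

Definition axiom_B3 (G : digraph) (M : central_marking G) : Prop :=
  (forall u v x y : G, left_edge M c1 u v -> edge G c2 x y -> x = u \/ x = v ->
     in_common_square (u, v) (x, y)) /\
  (forall v w x y : G, left_edge M c2 v w -> edge G c1 x y -> y = v \/ y = w ->
     in_common_square (x, y) (v, w)).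

Definition axiom_B3' (G : digraph) (M : central_marking G) : Prop :=
  (forall u v x y : G, right_edge M c1 u v -> edge G c2 x y -> y = u \/ y = v ->
     in_common_square (u, v) (x, y)) /\
  (forall v w x y : G, right_edge M c2 v w -> edge G c1 x y -> x = v \/ x = w ->
     in_common_square (x, y) (v, w)).

Definition axiom_B4 (G : digraph) (M : central_marking G) : Prop :=
  forall u w w' v : G, (exists u', cedge M u u') ->
    edge G c2 u w -> edge G c1 w w' -> edge G c2 w' v ->
    exists v', cedge M v v'.

Definition axiom_B4' (G : digraph) (M : central_marking G) : Prop :=
  forall u w w' v : G, (exists u', cedge M u' u) ->
    edge G c2 w u -> edge G c1 w' w -> edge G c2 v w' ->
    exists v', cedge M v' v.

(** The mid-point of a central edge is represented by that edge. *)
Definition central_point {G : digraph} (M : central_marking G) : Type :=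
  ({v : G | cvert M v} + {e : G * G | cedge M (fst e) (snd e)})%type.

Definition central_graph {G : digraph} (M : central_marking G) : digraph :=
  LGraph (vtx := central_point M) (fun c a b =>
    match c, a, b with
    | c2, inl (exist _ v _), inl (exist _ v' _) =>
        exists w, edge G c2 v w /\ edge G c1 w v'
    | c2, inl (exist _ v _), inr (exist _ (x, x') _) => edge G c2 v x
    | c2, inr (exist _ (x, x') _), inl (exist _ v _) =>
        exists w, edge G c2 x w /\ edge G c1 w v
    | c1, inl (exist _ v' _), inl (exist _ v _) =>
        exists w, edge G c2 w v /\ edge G c1 v' w
    | c1, inr (exist _ (x, x') _), inl (exist _ v _) => edge G c2 x' v
    | c1, inl (exist _ v _), inr (exist _ (x, x') _) =>
        exists w, edge G c2 w x' /\ edge G c1 v w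
    | _, inr _, inr _ => False
    end).

Definition central_otimes {G : digraph} {M : central_marking G} (a : central_graph M) : Prop :=
  match a with
  | inl _ => False
  | inr _ => True
  end.

Definition axiom_BA (G : digraph) (M : central_marking G) : Prop :=
  exists (A B : index_set) (f : central_graph M -> RA2 A B),
    is_isomorphism (central_graph M) (RA2 A B) f /\
    forall a, central_otimes a <-> RA2_otimes (f a).

(* Main.v *)
Require Import Defs.
From Stdlib Require Import ZArith List Relations ClassicalEpsilon Lia.
From Stdlib Require FinFun.
From Stdlib Require Import ProofIrrelevance PropExtensionality FunctionalExtensionality.

(** Let [alpha v] be the central vertex of the 2-string of [v] and [beta v] the
    central vertex or edge of its 1-string, both seen as points of the central
    graph [C]. In an S-graph, and in any graph satisfying the axioms, a vertex is
    determined by this pair; the pairs that occur are those with [alpha v]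
    ordinary and [alpha v] before [beta v] on a II-string (left and central
    vertices) or [beta v] before [alpha v] on a I-string (right and central
    vertices). A 2-edge moves [beta v] to the next point of the string, a 1-edge
    moves [alpha v] to the next ordinary point. So the graph is a function of [C]
    with its otimes-vertices. Reversing all edges exchanges left with right and I
    with II, which reduces most arguments to the left side. *)

(** The comparison only sees [C] as two systems of acyclic strings, so what is needed of RA2-graphs
    is collected in [central_like]; the index sets return only to match the sizes of B-sails with
    the lengths of strings. The two sides are kept apart by [c_meet]: a II-path and an I-path
    leading back can only join a point to itself, so left and right B-sails share just the pairs
    with equal components. The otimes-vertices cause all irregularities: [alpha] jumps over them,
    and a 1-string with an otimes-vertex as [beta] crosses by its central edge from a II-string to
    an I-string. In deriving coordinates from the axioms, the obstacle is that the edges of [C] are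
    defined next to central points only, whereas a 2-edge has to advance [beta] by one edge of [C]
    at every left vertex. Squares carry the 2-edge along the 1-strings to the center, and there (B4)
    rules out two consecutive mid-points. Once [G] and an S-graph have coordinates over the same
    [C], they are isomorphic, and no sails have to be built inside [G]. *)

Set Implicit Arguments.
Local Open Scope Z_scope.

Local Notation star := (clos_refl_trans _).
Local Notation plus := (clos_trans _).
Local Notation "e ^t" := (transp _ e) (at level 1, format "e ^t").

(** * Functional acyclic relations *)

Section Relations.
Context {T : Type}.
Implicit Types (e : relation T) (x y z : T).

Lemma star_transp e x y : star e^t x y <-> star e y x.
Proof.
  split; induction 1; try (now constructor); eapply rt_trans; eassumption.
Qed.

Lemma plus_transp e x y : plus e^t x y <-> plus e y x.
Proof.
  split; induction 1; try (now constructor); eapply t_trans; eassumption.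
Qed.

Lemma plus_star e x y : plus e x y -> star e x y.
Proof. induction 1; [now apply rt_step | eapply rt_trans; eassumption]. Qed.

Lemma star_cases e x y : star e x y -> x = y \/ plus e x y.
Proof.
  induction 1 as [x y H | x | x y z _ [-> | H] _ [-> | H']]; auto using t_step.
  right; eapply t_trans; eassumption.
Qed.

Lemma plus_star_trans e x y z : plus e x y -> star e y z -> plus e x z.
Proof. intros H [<- | H']%star_cases; [assumption | eapply t_trans; eassumption]. Qed.

Lemma star_plus_trans e x y z : star e x y -> plus e y z -> plus e x z.
Proof. intros [<- | H]%star_cases H'; [assumption | eapply t_trans; eassumption]. Qed.

Lemma plus_head e x y : plus e x y -> exists z, e x z /\ star e z y.
Proof.
  intros H%clos_trans_t1n; destruct H as [y H | w y H H'].
  - exists y; auto using rt_refl.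
  - exists w; auto using plus_star, clos_t1n_trans.
Qed.

Lemma plus_last e x y : plus e x y -> exists z, star e x z /\ e z y.
Proof.
  intros H%clos_trans_tn1; destruct H as [y H | w y H H'].
  - exists x; auto using rt_refl.
  - exists w; auto using plus_star, clos_tn1_trans.
Qed.

Lemma star_crst e x y : star e x y -> clos_refl_sym_trans T e x y.
Proof. apply clos_rt_clos_rst. Qed.

(** Applied to [e^t], this bounds the number of entering edges by one. *)
Definition functional e : Prop := forall x y y', e x y -> e x y' -> y = y'.

Lemma star_comparable e x y z : functional e ->
  star e x y -> star e x z -> star e y z \/ star e z y.
Proof.
  intros F H%clos_rt_rt1n; revert z; induction H as [x | x w y H H0 IH]; auto.
  intros z [<- | (w' & H1 & H2)%plus_head]%star_cases.
  - right; eapply rt_trans; [eapply rt_step, H | now apply clos_rt1n_rt].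
  - apply IH; now rewrite (F _ _ _ H H1).
Qed.

(** With at most one edge in and one edge out at each vertex, undirected connections cannot branch,
    so every zigzag straightens to a directed path. *)
Lemma crst_comparable e x y : functional e -> functional e^t ->
  clos_refl_sym_trans T e x y -> star e x y \/ star e y x.
Proof.
  intros F F'; induction 1 as [x y H | x | x y _ IH | x y z _ IH _ IH'];
    auto using rt_step, rt_refl; [tauto |].
  destruct IH as [IH | IH], IH' as [IH' | IH'].
  - left; eapply rt_trans; eassumption.
  - rewrite <- star_transp in IH, IH'.
    destruct (star_comparable F' IH IH'); rewrite star_transp in *; auto.
  - apply (star_comparable F IH IH').
  - right; eapply rt_trans; eassumption.
Qed.

Lemma walk_app e n m x z :
  walk e (n + m) x z <-> exists y, walk e n x y /\ walk e m y z.
Proof.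
  revert x; induction n as [|n IH]; intros x; simpl.
  - firstorder congruence.
  - setoid_rewrite IH; firstorder.
Qed.

Lemma walk_star e n x y : walk e n x y -> star e x y.
Proof.
  revert x; induction n as [|n IH]; intros x; simpl; [intros <-; apply rt_refl |].
  intros (w & H & H'); eapply rt_trans; [apply rt_step |]; eauto.
Qed.

Lemma star_walk e x y : star e x y -> exists n, walk e n x y.
Proof.
  intros H%clos_rt_rt1n; induction H as [x | x w y H _ (n & IH)].
  - now exists O.
  - exists (S n), w; auto.
Qed.

Lemma walk_fun e {n x y y'} : functional e -> walk e n x y -> walk e n x y' -> y = y'.
Proof.
  intros F; revert x; induction n as [|n IH]; intros x; simpl; [congruence |].
  intros (w & H1 & H2) (w' & H1' & H2').
  rewrite (F _ _ _ H1 H1') in H2; eauto.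
Qed.

Lemma walk_1 e x y : walk e 1 x y <-> e x y.
Proof. simpl; firstorder congruence. Qed.

Lemma walk_last e n x y : walk e (S n) x y <-> exists w, walk e n x w /\ e w y.
Proof.
  replace (S n) with (n + 1)%nat by lia; rewrite walk_app.
  now setoid_rewrite walk_1.
Qed.

Lemma walk_inj e {n x x' y} : functional e^t -> walk e n x y -> walk e n x' y -> x = x'.
Proof.
  intros F; revert y; induction n as [|n IH]; intros y; [simpl; congruence |].
  rewrite !walk_last; intros (w & H1 & H2) (w' & H1' & H2').
  rewrite (F _ _ _ H2 H2') in H1; eauto.
Qed.

Lemma position_nat e u t v : position e u t v <->
  exists n, t = Z.of_nat n /\ walk e n u v \/ t = - Z.of_nat n /\ walk e n v u.
Proof.
  unfold position; split.
  - intros [[H W] | [H W]]; [exists (Z.to_nat t) | exists (Z.to_nat (- t))];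
      [left | right]; (split; [lia | assumption]).
  - intros (n & [[-> W] | [-> W]]); [left | right]; (split; [lia |]).
    + now rewrite Nat2Z.id.
    + now rewrite Z.opp_involutive, Nat2Z.id.
Qed.

(** * Numbering of a string by signed distance from a base vertex *)

Section Paths.
Variable e : relation T.
Hypothesis e_fun : functional e.
Hypothesis e_inj : functional e^t.
Hypothesis e_acyclic : forall x, ~ plus e x x.

Lemma position_fun u t x y : position e u t x -> position e u t y -> x = y.
Proof.
  rewrite !position_nat; intros (n & H) (m & H').
  destruct H as [[-> W] | [-> W]], H' as [[E W'] | [E W']].
  all: assert (n = m) as <- by lia.
  - exact (walk_fun e_fun W W').
  - assert (n = O) as -> by lia; simpl in *; congruence.
  - assert (n = O) as -> by lia; simpl in *; congruence.
  - exact (walk_inj e_inj W W').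
Qed.

Lemma position_succ u t x y : position e u t x -> e x y -> position e u (t + 1) y.
Proof.
  rewrite !position_nat; intros (n & [[-> W] | [-> W]]) H.
  - exists (S n); left; split; [lia |]. rewrite walk_last; eauto.
  - destruct n as [|n].
    + simpl in W; subst x. exists 1%nat; left; split; [lia |]. now rewrite walk_1.
    + destruct W as (w & H1 & W). rewrite (e_fun H H1). exists n; right; split; [lia | auto].
Qed.

Lemma position_step u t x y : position e u t x -> position e u (t + 1) y -> e x y.
Proof.
  rewrite !position_nat; intros (n & H) (m & H').
  destruct H as [[-> W] | [-> W]], H' as [[E W'] | [E W']].
  - assert (m = S n) as -> by lia. rewrite walk_last in W'.
    destruct W' as (w & W' & H). now rewrite (walk_fun e_fun W W').
  - lia.
  - assert ((n = 1 /\ m = 0) \/ (n = 0 /\ m = 1))%nat as [[-> ->] | [-> ->]] by lia.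
    + rewrite walk_1 in W. simpl in W'; now subst y.
    + rewrite walk_1 in W'. simpl in W; now subst x.
  - assert (n = S m) as -> by lia. destruct W as (w & H & W).
    now rewrite (walk_inj e_inj W' W).
Qed.

Lemma position_lt u s t x y : position e u s x -> position e u t y -> s < t -> plus e x y.
Proof.
  (* The gap is written as [1 + n], so that the induction on [n] starts with a single edge. *)
  intros Hs Ht L. replace t with (s + 1 + Z.of_nat (Z.to_nat (t - s - 1))) in Ht by lia.
  revert y Ht; induction (Z.to_nat (t - s - 1)) as [|n IH]; intros y Ht.
  - apply t_step. eapply position_step; [eassumption |]. now rewrite Z.add_0_r in Ht.
  - assert (exists w, position e u (s + 1 + Z.of_nat n) w) as (w & Hw).
    { clear IH. revert Hs Ht. rewrite !position_nat. intros (k & Hk) (m & Hm).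
      destruct Hm as [[E W] | [E W]].
      - destruct m as [|m].
        + simpl in W. subst y. destruct Hk as [[-> _] | [-> Wk]]; [lia |].
          destruct k as [|k]; [lia |]. apply walk_last in Wk as (w & Wk & H).
          exists w. apply position_nat; exists 1%nat; right; split; [lia |]. now apply walk_1.
        + apply walk_last in W as (w & W & H). exists w.
          apply position_nat. exists m; left; split; [lia | auto].
      - destruct Hk as [[-> _] | [-> Wk]]; [lia |].
        replace k with (k - S m + S m)%nat in Wk by lia.
        apply walk_app in Wk as (w & W1 & W2). exists w.
        apply position_nat; exists (S m); right; split; [lia | auto]. }
    eapply t_trans; [apply IH, Hw | apply t_step].
    eapply position_step; [eassumption |].
    replace (s + 1 + Z.of_nat n + 1) with (s + 1 + Z.of_nat (S n)) by lia; assumption.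
Qed.

(** For [k >= 0] the walk from [u] to [y] is cut, for [k < 0] the walk from [x] to [u]. *)
Lemma position_convex u s k t x y : position e u s x -> position e u t y -> s <= k <= t ->
  exists w, position e u k w.
Proof.
  intros Hs Ht L. destruct (Z_le_gt_dec 0 k).
  - revert Ht; rewrite position_nat; intros (n & [[-> W] | [-> W]]).
    + replace n with (Z.to_nat k + (n - Z.to_nat k))%nat in W by lia.
      apply walk_app in W as (w & W & _). exists w. left. auto.
    + exists u. assert (k = 0) as -> by lia. left; simpl; split; [lia | auto].
  - revert Hs; rewrite position_nat; intros (n & [[-> W] | [-> W]]); [lia |].
    replace n with ((n - Z.to_nat (- k)) + Z.to_nat (- k))%nat in W by lia.
    apply walk_app in W as (w & _ & W). exists w. right. split; [lia | auto].
Qed.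

Lemma crst_position u x : clos_refl_sym_trans T e u x <-> exists t, position e u t x.
Proof.
  split.
  - intros [H | H]%crst_comparable; auto; apply star_walk in H as (n & H).
    + exists (Z.of_nat n). apply position_nat; exists n; auto.
    + exists (- Z.of_nat n). apply position_nat; exists n; auto.
  - intros (t & [[_ H] | [_ H]]); apply walk_star, star_crst in H; auto using rst_sym.
Qed.

(** Vertices are numbered by their position relative to [u]: the degree conditions leave at most one
    vertex for each position, and acyclicity at most one position for each vertex. *)
Lemma component_is_directed_path u : is_directed_path e (clos_refl_sym_trans T e u).
Proof.
  (* The enumeration has to be total; at positions that are not attained its value is arbitrary. *)
  set (p t := epsilon (inhabits u) (position e u t)).
  assert (Hp : forall t, (exists x, position e u t x) -> position e u t (p t))
    by (intros t; apply epsilon_spec).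
  assert (inj : forall s t x, position e u s x -> position e u t x -> s = t).
  { intros s t x Hs Ht. destruct (Z.lt_trichotomy s t) as [L | [L | L]]; auto;
      destruct (e_acyclic (x := x)).
    - exact (position_lt Hs Ht L).
    - exact (position_lt Ht Hs L). }
  exists (fun t => exists x, position e u t x), p. repeat split.
  - intros s k t (x & Hs) (y & Ht) L. exact (position_convex Hs Ht L).
  - intros s t Hs Ht E. apply Hp in Hs, Ht. rewrite E in Hs. eauto.
  - intros (t & H)%crst_position. exists t; split; [eauto |].
    eapply position_fun; [apply Hp |]; eauto.
  - intros (t & H & <-). apply crst_position. eauto.
  - intros E. apply Hp in H, H0. exact (inj _ _ _ H0 (position_succ H E)).
  - intros ->. apply Hp in H, H0. exact (position_step H H0).
Qed.
End Paths.

(** Each edge raises the index in the listing of the path by one, so a cycle would give one vertex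
    two different indices. *)
Lemma directed_path_acyclic e : functional e ->
  (forall v, is_directed_path e (clos_refl_sym_trans T e v)) -> forall x, ~ plus e x x.
Proof.
  intros F D x H. destruct (D x) as (I & p & _ & inj & cover & step).
  assert (K : forall y, plus e x y -> forall s, I s -> p s = x ->
                exists t, I t /\ p t = y /\ s < t).
  { intros y Hy%clos_trans_tn1 s Is <-; induction Hy as [y Hy | y z Hz Hy IH].
    - destruct (proj1 (cover y)) as (t & It & <-); [now apply rst_step |].
      exists t; repeat split; auto. apply step in Hy; auto; lia.
    - destruct IH as (t & It & <- & L).
      destruct (proj1 (cover z)) as (t' & It' & <-).
      { eapply rst_trans; [apply star_crst, plus_star, clos_tn1_trans, Hy |].
        now apply rst_step. }
      exists t'; repeat split; auto. apply step in Hz; auto; lia. }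
  destruct (proj1 (cover x)) as (s & Is & Hs); [apply rst_refl |].
  destruct (K x H s Is Hs) as (t & It & Ht & L).
  rewrite <- Hs in Ht. apply inj in Ht; auto; lia.
Qed.

End Relations.

(** * Graphs coordinatized by a central graph *)

(** The order-theoretic content of being an RA2-graph with otimes-vertices [O]. *)
Record central_like {C : Type} (eI eII : relation C) (O : C -> Prop) : Prop := {
  cI_fun : functional eI;
  cI_inj : functional eI^t;
  cII_fun : functional eII;
  cII_inj : functional eII^t;
  cI_acyclic : forall a, ~ plus eI a a;
  cII_acyclic : forall a, ~ plus eII a a;
  c_meet : forall a b, star eII a b -> star eI b a -> a = b;
  cI_sep : forall a b, eI a b -> O a -> O b -> False;
  cII_sep : forall a b, eII a b -> O a -> O b -> False;
  cI_otimes : forall a, O a -> exists b, eI a b;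
  cII_otimes : forall b, O b -> exists a, eII a b;
  cI_alt : forall a b c, eI a b -> eI b c -> O c -> O a;
  cII_alt : forall a b c, eII a b -> eII b c -> O a -> O c
}.

Lemma central_like_dual C (eI eII : relation C) O :
  central_like eI eII O -> central_like eII^t eI^t O.
Proof.
  intros []; split; auto.
  - intros a; rewrite plus_transp; auto.
  - intros a; rewrite plus_transp; auto.
  - intros a b; rewrite !star_transp; auto.
  - unfold transp; eauto.
  - unfold transp; eauto.
  - unfold transp; eauto.
  - unfold transp; eauto.
Qed.

(** The successor of [a] among the ordinary vertices is [b]; that [a] and [b] are
    themselves ordinary is not part of the definition. *)
Definition next_ordinary {C : Type} (e : relation C) (O : C -> Prop) (a b : C) : Prop :=
  e a b \/ exists w, O w /\ e a w /\ e w b.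

(** A vertex of an S-graph is encoded by the pair [(a, b)] of the central vertex
    [a] of its 2-string and the central vertex or edge [b] of its 1-string: the
    left vertices are those with [a] before [b] on a II-string, the right ones
    those with [b] before [a] on a I-string. *)
Record represents {V C : Type} (e1 e2 : relation V) (eI eII : relation C)
    (O : C -> Prop) (al be : V -> C) : Prop := {
  rep_inj : forall u v, al u = al v -> be u = be v -> u = v;
  rep_ordinary : forall v, ~ O (al v);
  rep_dom : forall v, star eII (al v) (be v) \/ star eI (be v) (al v);
  rep_surj : forall a b, ~ O a -> star eII a b \/ star eI b a ->
    exists v, al v = a /\ be v = b;
  rep_e1 : forall u v, e1 u v <-> be u = be v /\
    (next_ordinary eII O (al u) (al v) /\ star eII (al v) (be v) \/
     star eI (be u) (al u) /\ next_ordinary eI O (al u) (al v) \/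
     O (be u) /\ eII (al u) (be u) /\ eI (be v) (al v));
  rep_e2 : forall u v, e2 u v <-> al u = al v /\
    (star eII (al u) (be u) /\ eII (be u) (be v) \/
     star eI (be v) (al v) /\ eI (be u) (be v))
}.

Lemma next_ordinary_transp C (e : relation C) O a b :
  next_ordinary e^t O a b <-> next_ordinary e O b a.
Proof. unfold next_ordinary, transp; split; intros [H | (w & H)]; eauto; right; exists w; tauto. Qed.

Lemma represents_dual V C (e1 e2 : relation V) (eI eII : relation C) O al be :
  represents e1 e2 eI eII O al be -> represents e1^t e2^t eII^t eI^t O al be.
Proof.
  intros []; split; auto.
  - intros v; rewrite !star_transp; destruct (rep_dom0 v); auto.
  - intros a b; rewrite !star_transp; intuition.
  - intros u v; unfold transp at 1; rewrite rep_e3, !star_transp, !next_ordinary_transp.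
    unfold transp; split; intros [-> H]; (split; [reflexivity |]); tauto.
  - intros u v; unfold transp at 1; rewrite rep_e4, !star_transp.
    unfold transp; split; intros [-> H]; (split; [reflexivity |]); tauto.
Qed.


Lemma next_ordinary_plus C (e : relation C) O a b : next_ordinary e O a b -> plus e a b.
Proof. intros [H | (w & _ & H & H')]; [| eapply t_trans]; apply t_step; eassumption. Qed.

(** The first step is forced. If one path stops there and the other goes on, the same point is both
    ordinary and an otimes-vertex. *)
Lemma next_ordinary_fun C (e : relation C) O a b b' : functional e -> ~ O b -> ~ O b' ->
  next_ordinary e O a b -> next_ordinary e O a b' -> b = b'.
Proof.
  intros F N N' [H | (w & W & H & K)] [H' | (w' & W' & H' & K')];
    pose proof (F _ _ _ H H') as E; subst; try tauto; eauto.
Qed.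

(** * The left side of a represented graph *)

Section Coordinates.
Context {V C : Type} {e1 e2 : relation V} {eI eII : relation C} {O : C -> Prop}.
Context {al be : V -> C}.
Hypothesis HC : central_like eI eII O.
Hypothesis HR : represents e1 e2 eI eII O al be.

(** With its companion below, this excludes being strictly on one side and weakly on the other. *)
Lemma plus_star_meet a b : plus eII a b -> star eI b a -> False.
Proof.
  intros H H'. assert (a = b) as -> by (eapply c_meet; eauto using plus_star).
  eapply cII_acyclic; eauto.
Qed.

Lemma star_plus_meet a b : star eII a b -> plus eI b a -> False.
Proof.
  intros H H'. assert (a = b) as -> by (eapply c_meet; eauto using plus_star).
  eapply cI_acyclic; eauto.
Qed.

(** When the point right after [a] is an otimes-vertex [b], the next ordinary point lies beyond [b].
    Hence the beginning of a central edge has no other 1-edge leaving it to the left side. *)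
Lemma next_ordinary_before {a a' b} : ~ O a' -> O b -> eII a b ->
  next_ordinary eII O a a' -> star eII a' b -> False.
Proof.
  intros N B H [H' | (w & W & H' & K)] L.
  - rewrite (cII_fun HC _ _ _ H H') in B; tauto.
  - rewrite (cII_fun HC _ _ _ H H') in L. apply (cII_acyclic HC (a := w)).
    eapply plus_star_trans; [apply t_step |]; eassumption.
Qed.

(** Two edges of the same kind have equal ends because the strings of [C] do not branch; two edges
    of different kinds would put [u] on both sides. Uniqueness of entering edges is this lemma for
    the reversed graph. *)
Lemma rep_e1_fun : functional e1.
Proof.
  intros u v v' [E H]%(rep_e1 HR) [E' H']%(rep_e1 HR).
  pose proof (rep_ordinary HR v) as N. pose proof (rep_ordinary HR v') as N'.
  apply (rep_inj HR); [| congruence]. rewrite <- E in H; rewrite <- E' in H'.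
  destruct H as [[H K] | [[K H] | (B & K & H)]], H' as [[H' K'] | [[K' H'] | (B' & K' & H')]].
  - eapply next_ordinary_fun; eauto. apply HC.
  - destruct (@plus_star_meet (al u) (be u));
      eauto using plus_star_trans, next_ordinary_plus.
  - destruct (@next_ordinary_before (al u) (al v) (be u)); auto.
  - destruct (@plus_star_meet (al u) (be u));
      eauto using plus_star_trans, next_ordinary_plus.
  - eapply next_ordinary_fun; eauto. apply HC.
  - destruct (@plus_star_meet (al u) (be u)); auto using t_step.
  - destruct (@next_ordinary_before (al u) (al v') (be u)); auto.
  - destruct (@plus_star_meet (al u) (be u)); auto using t_step.
  - eapply cI_fun; eauto.
Qed.

Lemma rep_e2_fun : functional e2.
Proof.
  intros u v v' [E H]%(rep_e2 HR) [E' H']%(rep_e2 HR).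
  apply (rep_inj HR); [congruence |]. rewrite <- E in H; rewrite <- E' in H'.
  destruct H as [[K H] | [K H]], H' as [[K' H'] | [K' H']].
  - eapply cII_fun; eauto.
  - destruct (@star_plus_meet (al u) (be u)); eauto using plus_star_trans, t_step.
  - destruct (@star_plus_meet (al u) (be u)); eauto using plus_star_trans, t_step.
  - eapply cI_fun; eauto.
Qed.

(** In the reversed graph, with [eI^t] in place of [eII], these notions mean right. *)
Definition weakly_left (v : V) : Prop := star eII (al v) (be v).
Definition strictly_left (v : V) : Prop := plus eII (al v) (be v).

Lemma strictly_weakly_left v : strictly_left v -> weakly_left v.
Proof. apply plus_star. Qed.

Lemma e1_weakly_left {u v} : e1 u v -> weakly_left v ->
  next_ordinary eII O (al u) (al v) /\ strictly_left u.
Proof.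
  unfold weakly_left, strictly_left; intros [E H]%(rep_e1 HR) L.
  destruct H as [[H _] | [[K H] | (B & K & H)]].
  - split; auto. rewrite E. eauto using plus_star_trans, next_ordinary_plus.
  - destruct (@star_plus_meet (al v) (be v)); auto.
    rewrite <- E. eauto using star_plus_trans, next_ordinary_plus.
  - destruct (@star_plus_meet (al v) (be v)); auto using t_step.
Qed.

Lemma plus_e1_weakly_left u v : plus e1 u v -> weakly_left v ->
  plus eII (al u) (al v) /\ strictly_left u.
Proof.
  intros H%clos_trans_t1n; induction H as [u v H | u w v H _ IH]; intros L.
  - apply e1_weakly_left in H as [H H']; [split |]; eauto using next_ordinary_plus.
  - apply IH in L as [L L']. apply e1_weakly_left in H as [H H'];
      [| now apply strictly_weakly_left].
    split; auto. eapply t_trans; [eapply next_ordinary_plus |]; eassumption.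
Qed.

Lemma e2_weakly_left {u v} : e2 u v -> weakly_left u ->
  eII (be u) (be v) /\ strictly_left v.
Proof.
  unfold weakly_left, strictly_left; intros [E [[H H'] | [H H']]]%(rep_e2 HR) L.
  - rewrite <- E. split; auto. eapply star_plus_trans; eauto using t_step.
  - destruct (@star_plus_meet (al u) (be u)); auto.
    rewrite E. eauto using plus_star_trans, t_step.
Qed.

Lemma plus_e2_weakly_left u v : plus e2 u v -> weakly_left u ->
  plus eII (be u) (be v) /\ strictly_left v.
Proof.
  intros H%clos_trans_tn1; induction H as [v H | w v H _ IH]; intros L.
  - apply e2_weakly_left in H as [H H']; [split |]; auto using t_step.
  - apply IH in L as [L L']. apply e2_weakly_left in H as [H H'];
      [| now apply strictly_weakly_left].
    split; auto. eapply t_trans; eauto using t_step.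
Qed.

(** On the left side 1-paths advance [al] and 2-paths advance [be], both along the acyclic [eII]. *)
Lemma weakly_left_acyclic v : weakly_left v -> ~ plus e1 v v /\ ~ plus e2 v v.
Proof.
  intros L; split; intros H.
  - apply plus_e1_weakly_left in H as [H _]; auto. eapply cII_acyclic; eauto.
  - apply plus_e2_weakly_left in H as [H _]; auto. eapply cII_acyclic; eauto.
Qed.

Definition central_edge (u v : V) : Prop :=
  O (be u) /\ be u = be v /\ eII (al u) (be u) /\ eI (be v) (al v).

Lemma central_edge_e1 u v : central_edge u v -> e1 u v.
Proof. intros (B & E & H & H'). apply (rep_e1 HR). split; auto. Qed.

(** Convertible to [left_vertex] for the marking defined later, but phrased with bare relations so
    that it can be reversed. *)
Definition reaches_center (v : V) : Prop :=
  (exists z, al z = be z /\ plus e1 v z) \/ (exists z z', central_edge z z' /\ star e1 v z).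

Lemma e1_reaches_center u v : e1 u v -> al v = be v \/ reaches_center v -> reaches_center u.
Proof.
  intros H [E | [(z & E & K) | (z & z' & E & K)]]; [left; exists v | left; exists z |
    right; exists z, z']; (split; [assumption |]); eauto using t_trans, t_step.
  eapply rt_trans; eauto using rt_step.
Qed.

(** With [be v] fixed, [al] runs along the II-string towards [be v]. If [be v] is ordinary, a
    central vertex is reached; if not, the run stops one point earlier, at the beginning of a
    central edge. *)
Lemma strictly_left_reaches_center v : strictly_left v -> reaches_center v.
Proof.
  (* Only an ordinary [a] is the first coordinate of a vertex. At an otimes-vertex the claim is
     therefore postponed to the next point, unless the path ends there. *)
  assert (G : forall a b, star eII a b ->
    (~ O a -> forall v, al v = a -> be v = b -> al v = be v \/ reaches_center v) /\
    (O a -> a = b \/ exists a', eII a a' /\ star eII a' b /\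
       forall v, al v = a' -> be v = b -> al v = be v \/ reaches_center v)).
  { clear v; intros a b H%clos_rt_rt1n; induction H as [a | a a1 b H H1 [IH IH']].
    - split; auto. intros _ v -> ->; auto.
    - apply clos_rt1n_rt in H1. split.
      + intros N v <- <-. right.
        assert (step : forall w, next_ordinary eII O (al v) (al w) ->
          star eII (al w) (be w) -> be w = be v -> e1 v w)
          by (intros w K L E; apply (rep_e1 HR); split; auto).
        destruct (excluded_middle_informative (O a1)) as [W | W].
        * destruct (IH' W) as [-> | (a' & K & L & R)].
          (* The path ends at an otimes-vertex right after [al v], so [v] begins a central edge; its
             end has as first coordinate the successor on the I-string. *)
          -- destruct (cI_otimes HC _ W) as (a' & K).
             destruct (rep_surj HR (a := a') (b := be v)) as (v' & <- & E').
             { intros W'. eapply cI_sep; eauto. }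
             { right. now apply rt_step. }
             right. exists v, v'. split; [| apply rt_refl].
             repeat split; auto. now rewrite E'.
          (* Here the 1-edge makes [al] jump over the otimes-vertex [a1]. *)
          -- destruct (rep_surj HR (a := a') (b := be v)) as (v' & <- & E'); auto.
             { intros W'. eapply cII_sep; eauto. }
             eapply e1_reaches_center; [| now apply R].
             apply step; auto. { right; eauto. } now rewrite E'.
        * destruct (rep_surj HR (a := a1) (b := be v)) as (v' & <- & E'); auto.
          eapply e1_reaches_center; [| now apply IH].
          apply step; auto. { now left. } now rewrite E'.
      + intros W. right. exists a1; repeat split; auto. intros v <- <-.
        apply IH; auto. intros W'. eapply cII_sep; eauto. }
  intros H. destruct (G (al v) (be v)) as [K _]; [now apply plus_star |].
  destruct (K (rep_ordinary HR v) v eq_refl eq_refl); auto.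
  destruct (cII_acyclic HC (a := al v)); now rewrite H0 at 2.
Qed.

Lemma reaches_center_strictly_left v : reaches_center v -> strictly_left v.
Proof.
  intros [(z & E & H) | (z & z' & (B & E & K & _) & [<- | H]%star_cases)].
  - apply plus_e1_weakly_left in H as [_ H]; auto. red; rewrite E; apply rt_refl.
  - now apply t_step.
  - apply plus_e1_weakly_left in H as [_ H]; auto. now apply rt_step.
Qed.

(** Every point between [al v] and [be v] on the II-string is the second coordinate of a vertex with
    first coordinate [al v]; these vertices form the initial part of the 2-string. *)
Lemma weakly_left_from_center v : weakly_left v ->
  exists z, al z = al v /\ be z = al v /\ star e2 z v.
Proof.
  intros L.
  assert (G : forall a b, clos_refl_trans_n1 C eII a b -> ~ O a -> forall v, al v = a -> be v = b ->
    exists z, al z = a /\ be z = a /\ star e2 z v).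
  { clear v L; intros a b' K N; induction K as [| b1 b' K1 K IH]; intros v <- E.
    - exists v; repeat split; auto. apply rt_refl.
    - apply clos_rtn1_rt in K. destruct (rep_surj HR (a := al v) (b := b1)) as (u & Eu & Eu'); auto.
      destruct (IH u Eu Eu') as (z & Z & Z' & R).
      exists z; repeat split; auto. eapply rt_trans; [exact R | apply rt_step].
      apply (rep_e2 HR). split; auto. left. rewrite Eu, Eu', E; auto. }
  apply (G (al v) (be v)); auto; [now apply clos_rt_rtn1 | apply (rep_ordinary HR)].
Qed.

Lemma left_e1_cases {u v} : e1 u v -> strictly_left u -> ~ central_edge u v ->
  be u = be v /\ next_ordinary eII O (al u) (al v) /\ weakly_left v.
Proof.
  intros [E H]%(rep_e1 HR) L N. split; auto.
  destruct H as [[H K] | [[K H] | (B & K & H)]]; auto.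
  - destruct (@plus_star_meet (al u) (be u)); auto.
  - destruct N; repeat split; auto.
Qed.

(** In coordinates a square is a rectangle: the missing corner takes [al] from one known vertex and
    [be] from another, here [(al v, be u')]. It exists as soon as its first coordinate still
    precedes the second. The next three lemmas follow the same pattern. *)
Lemma left_square_source {u v u'} : e1 u v -> strictly_left u -> ~ central_edge u v ->
  e2 u u' -> exists v', e1 u' v' /\ e2 v v'.
Proof.
  intros H L N K. destruct (left_e1_cases H L N) as (E & Hn & Lv).
  destruct (e2_weakly_left K (strictly_weakly_left L)) as [Kb L'].
  assert (Ka : al u = al u') by now apply (rep_e2 HR) in K.
  destruct (rep_surj HR (a := al v) (b := be u')) as (v' & Ev & Ev').
  { apply (rep_ordinary HR). }
  { left. eapply rt_trans; [exact Lv | rewrite <- E; now apply rt_step]. }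
  exists v'. split.
  - apply (rep_e1 HR). split; auto. left. rewrite <- Ka, Ev, Ev'. split; auto.
    eapply rt_trans; [exact Lv | rewrite <- E; now apply rt_step].
  - apply (rep_e2 HR). split; auto. left. rewrite Ev', <- E; auto. split; auto.
    rewrite E; exact Lv.
Qed.

Lemma left_square_target {u v v'} : e1 u v -> strictly_left u -> ~ central_edge u v ->
  e2 v v' -> exists u', e1 u' v' /\ e2 u u'.
Proof.
  intros H L N K. destruct (left_e1_cases H L N) as (E & Hn & Lv).
  destruct (e2_weakly_left K Lv) as [Kb L'].
  assert (Ka : al v = al v') by now apply (rep_e2 HR) in K.
  assert (Lu : star eII (al u) (be v')).
  { eapply rt_trans; [apply plus_star, L | rewrite E; now apply rt_step]. }
  destruct (rep_surj HR (a := al u) (b := be v')) as (u' & Eu & Eu'); auto.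
  { apply (rep_ordinary HR). }
  exists u'. split.
  - apply (rep_e1 HR). split; auto. left. rewrite Eu, <- Ka. split; auto.
    rewrite Ka; now apply strictly_weakly_left.
  - apply (rep_e2 HR). split; auto. left. rewrite Eu', E. split; auto.
    rewrite <- E; now apply plus_star.
Qed.

Lemma left_e2_cases {v w} : e2 v w -> strictly_left w ->
  al v = al w /\ weakly_left v /\ eII (be v) (be w).
Proof.
  intros [E [[H K] | [H K]]]%(rep_e2 HR) L; auto.
  destruct (@plus_star_meet (al w) (be w)); auto.
Qed.

Lemma left_square_enter_first {x v w} : e2 v w -> strictly_left w -> e1 x v ->
  exists y, e1 y w /\ e2 x y.
Proof.
  intros H L K. destruct (left_e2_cases H L) as (E & Lv & Hb).
  destruct (e1_weakly_left K Lv) as [Kn Lx].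
  assert (Kb : be x = be v) by now apply (rep_e1 HR) in K.
  assert (Lx' : star eII (al x) (be w)).
  { eapply rt_trans; [apply plus_star, Lx | rewrite Kb; now apply rt_step]. }
  destruct (rep_surj HR (a := al x) (b := be w)) as (y & Ey & Ey'); auto.
  { apply (rep_ordinary HR). }
  exists y. split.
  - apply (rep_e1 HR). split; auto. left. rewrite Ey, <- E. split; auto.
    rewrite E; now apply strictly_weakly_left.
  - apply (rep_e2 HR). split; auto. left. rewrite Ey', Kb. split; auto.
    rewrite <- Kb; now apply plus_star.
Qed.

Lemma left_square_enter_second {y v w} : e2 v w -> strictly_left w -> e1 y w ->
  exists x, e1 x v /\ e2 x y.
Proof.
  intros H L K. destruct (left_e2_cases H L) as (E & Lv & Hb).
  destruct (e1_weakly_left K (strictly_weakly_left L)) as [Kn Ly].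
  assert (Kb : be y = be w) by now apply (rep_e1 HR) in K.
  assert (Lx : star eII (al y) (be v)).
  { eapply rt_trans; [apply plus_star, (next_ordinary_plus Kn) | now rewrite <- E]. }
  destruct (rep_surj HR (a := al y) (b := be v)) as (x & Ex & Ex'); auto.
  { apply (rep_ordinary HR). }
  exists x. split.
  - apply (rep_e1 HR). split; auto. left. rewrite Ex, E. split; auto.
    now rewrite <- E.
  - apply (rep_e2 HR). split; auto. left. rewrite Ex, Ex', Kb. auto.
Qed.

(** Along the path [be] advances twice from an otimes-vertex, hence to an otimes-vertex by
    [cII_alt], while [al] jumps over the first of them and ends right before the second. *)
Lemma central_edge_alternation {u u' w w' v} : central_edge u u' ->
  e2 u w -> e1 w w' -> e2 w' v -> exists v', central_edge v v'.
Proof.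
  intros (B & E & H & _) K1 K2 K3.
  assert (Lu : weakly_left u) by now apply rt_step.
  destruct (e2_weakly_left K1 Lu) as [K Lw].
  assert (Ea : al u = al w) by now apply (rep_e2 HR) in K1.
  assert (Nw : ~ O (be w)) by (intros B'; eapply cII_sep; eauto).
  destruct (left_e1_cases K2 Lw) as (E' & Hn & Lw'); [now intros (B' & _) |].
  (* The point after [al u] is the otimes-vertex [be u], so the next ordinary one is the point after
     that, [be w]. *)
  assert (Ec : al w' = be w).
  { rewrite <- Ea in Hn. destruct Hn as [Hn | (c & Oc & Hn & Hn')].
    - destruct (rep_ordinary HR w'). now rewrite <- (cII_fun HC _ _ _ H Hn).
    - rewrite <- (cII_fun HC _ _ _ H Hn) in Hn'. eapply cII_fun; eauto. }
  destruct (e2_weakly_left K3 Lw') as [K' _].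
  assert (Ea' : al w' = al v) by now apply (rep_e2 HR) in K3.
  rewrite <- E' in K'.
  pose proof (cII_alt HC _ _ _ K K' B) as Bv.
  destruct (cI_otimes HC _ Bv) as (d & Hd).
  destruct (rep_surj HR (a := d) (b := be v)) as (v' & Ev & Ev').
  { intros B'. eapply cI_sep; eauto. }
  { right; now apply rt_step. }
  exists v'. repeat split; auto.
  - now rewrite <- Ea', Ec.
  - now rewrite Ev, Ev'.
Qed.

End Coordinates.

Lemma bijective_of_injective_surjective (X Y : Type) (f : X -> Y) :
  (forall x y, f x = f y -> x = y) -> (forall y, exists x, f x = y) -> FinFun.Bijective f.
Proof.
  intros inj surj.
  exists (fun y => proj1_sig (constructive_indefinite_description _ (surj y))).
  split; intros z; destruct (constructive_indefinite_description _ _); simpl; auto.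
Qed.

Lemma sig_eq (X : Type) (P : X -> Prop) (x y : {x | P x}) :
  proj1_sig x = proj1_sig y -> x = y.
Proof. destruct x, y; simpl; intros ->; f_equal; apply proof_irrelevance. Qed.

Section CentralEdges.
Context {V C : Type} {e1 e2 : relation V} {eI eII : relation C} {O : C -> Prop}.
Context {al be : V -> C}.
Hypothesis HC : central_like eI eII O.
Hypothesis HR : represents e1 e2 eI eII O al be.
Notation central_edge := (@central_edge V C eI eII O al be).

Lemma weakly_left_refl v : al v = be v -> star eII (al v) (be v).
Proof. intros ->; apply rt_refl. Qed.

(** The intermediate vertex is the pair [(al v, be v')]. With the two lemmas that follow, this
    matches the explicit description of the II-edges of the central graph. *)
Lemma cII_vertex_vertex {v v'} : al v = be v -> al v' = be v' ->
  (exists w, e2 v w /\ e1 w v') <-> eII (be v) (be v').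
Proof.
  intros E E'; split.
  - intros (w & H & H'). apply (e2_weakly_left HC HR) in H as [H _];
      [| now apply weakly_left_refl].
    apply (rep_e1 HR) in H' as [<- _]; auto.
  - intros H. destruct (rep_surj HR (a := al v) (b := be v')) as (w & Ew & Ew').
    { apply (rep_ordinary HR). }
    { rewrite E; left; now apply rt_step. }
    exists w; split.
    + apply (rep_e2 HR). rewrite Ew, Ew'. split; auto. left; split; auto.
      now apply weakly_left_refl.
    + apply (rep_e1 HR). rewrite Ew, Ew'. split; auto. left; split.
      * left; now rewrite E, E'.
      * now apply weakly_left_refl.
Qed.

Lemma cII_vertex_edge {v x x'} : al v = be v -> central_edge x x' ->
  e2 v x <-> eII (be v) (be x).
Proof.
  intros E (B & _ & K & _); split.
  - intros H. apply (e2_weakly_left HC HR) in H as [H _]; auto.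
    now apply weakly_left_refl.
  - intros H. apply (rep_e2 HR). split.
    + rewrite E. apply (cII_inj HC (be x)); assumption.
    + left; split; auto. now apply weakly_left_refl.
Qed.

Lemma cII_edge_vertex {v x x'} : al v = be v -> central_edge x x' ->
  (exists w, e2 x w /\ e1 w v) <-> eII (be x) (be v).
Proof.
  intros E (B & _ & K & _); split.
  - intros (w & H & H'). apply (e2_weakly_left HC HR) in H as [H _];
      [| now apply rt_step].
    apply (rep_e1 HR) in H' as [<- _]; auto.
  - intros H. destruct (rep_surj HR (a := al x) (b := be v)) as (w & Ew & Ew').
    { apply (rep_ordinary HR). }
    { left; eapply rt_trans; apply rt_step; eassumption. }
    exists w; split.
    + apply (rep_e2 HR). rewrite Ew, Ew'. split; auto. left; split; auto.
      now apply rt_step.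
    + apply (rep_e1 HR). rewrite Ew, Ew'. split; auto. left; split.
      * right; exists (be x). now rewrite E.
      * now apply weakly_left_refl.
Qed.

End CentralEdges.

(** * A represented graph satisfies the axioms, and its central graph is [C] *)

Section RepresentedGraph.
Context {G C : digraph} {O : C -> Prop} {al be : G -> C}.
Hypothesis HC : central_like (edge C c1) (edge C c2) O.
Hypothesis HR : represents (edge G c1) (edge G c2) (edge C c1) (edge C c2) O al be.
Let HC' := central_like_dual HC.
Let HR' := represents_dual HR.

Notation E := (@central_edge G C (edge C c1) (edge C c2) O al be).
Notation E' := (@central_edge G C (edge C c2)^t (edge C c1)^t O al be).
Notation lft := (@strictly_left G C (edge C c2) al be).
Notation rgt := (@strictly_left G C (edge C c1)^t al be).

Definition represented_marking : central_marking G :=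
  {| cvert := fun v => al v = be v; cedge := E; cedge_edge := central_edge_e1 HR |}.
Notation M := represented_marking.

Lemma central_edge_dual u v : E' u v <-> E v u.
Proof.
  unfold central_edge, transp; split; intros (B & K & H & H'); rewrite K in *; auto.
Qed.

Lemma left_vertex_iff v : left_vertex M v <-> lft v.
Proof.
  split.
  - apply (reaches_center_strictly_left HC HR).
  - apply (strictly_left_reaches_center HC HR).
Qed.

Lemma right_vertex_iff v : right_vertex M v <-> rgt v.
Proof.
  transitivity (@reaches_center G C (edge G c1)^t (edge C c2)^t (edge C c1)^t O al be v).
  - split; (intros [(z & K & H) | (z & z' & K & H)]; [left; exists z | right; exists z', z]);
      rewrite ?plus_transp, ?star_transp in *; (split; [| assumption]); auto;
      now apply central_edge_dual.
  - split.
    + apply (reaches_center_strictly_left HC' HR').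
    + apply (strictly_left_reaches_center HC' HR').
Qed.

Lemma vertex_trichotomy v : al v = be v \/ lft v \/ rgt v.
Proof.
  destruct (rep_dom HR v) as [[H | H]%star_cases | H]; auto.
  apply star_transp, star_cases in H; destruct H; auto.
Qed.

Lemma string1_be x y : string_of G c1 x y -> be x = be y.
Proof.
  induction 1 as [x y H | | |]; try congruence. now apply (rep_e1 HR) in H.
Qed.

Lemma string2_al x y : string_of G c2 x y -> al x = al y.
Proof.
  induction 1 as [x y H | | |]; try congruence. now apply (rep_e2 HR) in H.
Qed.

Lemma represented_acyclic c v : ~ plus (edge G c) v v.
Proof.
  assert (@weakly_left G C (edge C c2) al be v \/ @weakly_left G C (edge C c1)^t al be v)
    as [H | H].
  { destruct (vertex_trichotomy v) as [H | [H | H]].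
    - left; now apply weakly_left_refl.
    - left; now apply strictly_weakly_left.
    - right; now apply strictly_weakly_left. }
  - destruct c; apply (weakly_left_acyclic HC HR H).
  - rewrite <- plus_transp. destruct c; apply (weakly_left_acyclic HC' HR' H).
Qed.

Lemma represented_B0 : axiom_B0 G.
Proof.
  intros c.
  assert (F : functional (edge G c)).
  { destruct c; [apply (rep_e1_fun HC HR) | apply (rep_e2_fun HC HR)]. }
  assert (F' : functional (edge G c)^t).
  { destruct c; [apply (rep_e1_fun HC' HR') | apply (rep_e2_fun HC' HR')]. }
  repeat split; auto.
  - intros u u' v H H'. apply (F' v); auto.
  - intros v. apply component_is_directed_path; auto. apply represented_acyclic.
Qed.

(** The value of [be] is constant on a 1-string and decides the kind of its center: a central vertex
    if it is ordinary, a central edge if not. The ends of the edge are fixed by the points before it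
    on the II-string and after it on the I-string. *)
Lemma represented_B1 : axiom_B1 M.
Proof.
  intros x. assert (U : forall y y' : G + G * G,
    match y with
    | inl v => string_of G c1 x v /\ cvert M v
    | inr (u, v) => string_of G c1 x u /\ cedge M u v
    end ->
    match y' with
    | inl v => string_of G c1 x v /\ cvert M v
    | inr (u, v) => string_of G c1 x u /\ cedge M u v
    end -> y = y').
  { assert (N : forall v u u', be u = be v -> al v = be v -> E u u' -> False).
    { intros v u u' Eb Ev (B & _). rewrite Eb, <- Ev in B. now apply (rep_ordinary HR) in B. }
    intros [v | [u v]] [v' | [u' v']] [S K] [S' K']; apply string1_be in S, S';
      rewrite S in S'; simpl in *.
    - f_equal. apply (rep_inj HR); congruence.
    - destruct (N v u' v'); auto.
    - destruct (N v' u v); auto.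
    - destruct K as (B & K & K1 & K2), K' as (B' & K' & K1' & K2').
      rewrite <- K, S' in K2. rewrite <- K' in K2'. rewrite S' in K1.
      f_equal; f_equal; apply (rep_inj HR); try congruence.
      + apply (cII_inj HC (be u')); assumption.
      + apply (cI_fun HC (be u')); assumption. }
  enough (Ex : exists y : G + G * G,
    match y with
    | inl v => string_of G c1 x v /\ cvert M v
    | inr (u, v) => string_of G c1 x u /\ cedge M u v
    end) by (destruct Ex as (y & H); exists y; split; [exact H | intros; apply U; auto]).
  destruct (vertex_trichotomy x) as [H | [H | H]].
  - exists (inl x); split; [apply rst_refl | exact H].
  - apply left_vertex_iff in H as [(z & K & H) | (z & z' & K & H)].
    + exists (inl z); split; auto. apply star_crst, plus_star, H.
    + exists (inr (z, z')); split; auto. apply star_crst, H.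
  - apply right_vertex_iff in H as [(z & K & H) | (z & z' & K & H)].
    + exists (inl z); split; auto. apply rst_sym, star_crst, plus_star, H.
    + exists (inr (z, z')); split; auto. apply rst_sym.
      eapply rst_trans; [apply rst_step, (cedge_edge M _ _ K) | apply star_crst, H].
Qed.

(** As [al] is constant on a 2-string, its only possible central vertex is the pair with both
    coordinates equal to that value; [be] moves away from it on both sides. *)
Lemma represented_B2 : axiom_B2 M.
Proof.
  intros x; split.
  - assert (exists v, string_of G c2 x v /\ al v = be v) as (v & S & K).
    { destruct (rep_dom HR x) as [H | H].
      - apply (weakly_left_from_center HR) in H as (z & H1 & H2 & H).
        exists z; split; [apply rst_sym, star_crst, H | congruence].
      - apply star_transp, (weakly_left_from_center HR') in H as (z & H1 & H2 & H).
        apply star_transp in H.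
        exists z; split; [apply star_crst, H | congruence]. }
    exists v; split; [split; auto |]. intros v' [S' K'].
    apply string2_al in S, S'. simpl in K'. apply (rep_inj HR); congruence.
  - intros v _ K; simpl in K; split; intros u H.
    + apply right_vertex_iff. apply plus_transp in H.
      apply (plus_e2_weakly_left HC' HR' H). now apply weakly_left_refl.
    + apply left_vertex_iff.
      apply (plus_e2_weakly_left HC HR H). now apply weakly_left_refl.
Qed.

Lemma represented_B3 : axiom_B3 M.
Proof.
  split.
  - intros u v x y (H & N & L%left_vertex_iff) K [-> | ->].
    + destruct (left_square_source HC HR H L N K) as (v' & K1 & K2).
      exists u, v, y, v'; unfold commutative_square; auto 10.
    + destruct (left_square_target HC HR H L N K) as (u' & K1 & K2).
      exists u, v, u', y; unfold commutative_square; auto 10.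
  - intros v w x y (H & L%left_vertex_iff) K [-> | ->].
    + destruct (left_square_enter_first HC HR H L K) as (z & K1 & K2).
      exists x, v, z, w; unfold commutative_square; auto 10.
    + destruct (left_square_enter_second HC HR H L K) as (z & K1 & K2).
      exists z, v, x, w; unfold commutative_square; auto 10.
Qed.

Lemma represented_B3' : axiom_B3' M.
Proof.
  split.
  - intros u v x y (H & N & L%right_vertex_iff) K.
    simpl in N; rewrite <- central_edge_dual in N. intros [-> | ->].
    (* Reversed, the 1-edge goes from [v] to [u], so a 2-edge at [u] is one at the target. *)
    + destruct (left_square_target HC' HR' H L N K) as (u' & K1 & K2).
      exists x, u', u, v; unfold commutative_square; auto 10.
    + destruct (left_square_source HC' HR' H L N K) as (v' & K1 & K2).
      exists v', x, u, v; unfold commutative_square; auto 10.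
  - intros v w x y (H & L%right_vertex_iff) K [-> | ->].
    + destruct (left_square_enter_second HC' HR' H L K) as (z & K1 & K2).
      exists v, y, w, z; unfold commutative_square; auto 10.
    + destruct (left_square_enter_first HC' HR' H L K) as (z & K1 & K2).
      exists v, z, w, y; unfold commutative_square; auto 10.
Qed.

Lemma represented_B4 : axiom_B4 M.
Proof. intros u w w' v (u' & H); apply (central_edge_alternation HC HR H). Qed.

Lemma represented_B4' : axiom_B4' M.
Proof.
  intros u w w' v (u' & H%central_edge_dual) H1 H2 H3.
  destruct (central_edge_alternation HC' HR' H H1 H2 H3) as (v' & K).
  exists v'; now apply central_edge_dual.
Qed.

Definition central_point_image (a : central_graph M) : C :=
  match a with
  | inl v => be (proj1_sig v)
  | inr e => be (fst (proj1_sig e))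
  end.

(** An ordinary point [b] comes from the vertex [(b, b)], an otimes-vertex from the edge that
    crosses it, whose ends have as first coordinates the point before [b] on its II-string and the
    point after [b] on its I-string. *)
Lemma central_point_image_isomorphism :
  is_isomorphism (central_graph M) C central_point_image.
Proof.
  split.
  - apply bijective_of_injective_surjective.
    + assert (N : forall v u u', be v = be u -> al v = be v -> E u u' -> False).
      { intros v u u' Eb Ev (B & _). rewrite <- Eb, <- Ev in B. now apply (rep_ordinary HR) in B. }
      intros [[v H] | [[u u'] H]] [[v' H'] | [[w w'] H']]; simpl in *; intros K.
      * f_equal; apply sig_eq; simpl. apply (rep_inj HR); congruence.
      * now destruct (N v w w').
      * now destruct (N v' u u').
      * f_equal; apply sig_eq; simpl.
        destruct H as (B & H & K1 & K2), H' as (B' & H' & K1' & K2').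
        rewrite <- H, K in K2. rewrite <- H' in K2'. rewrite K in K1.
        f_equal; apply (rep_inj HR); try congruence.
        -- apply (cII_inj HC (be w)); assumption.
        -- apply (cI_fun HC (be w)); assumption.
    + intros b. destruct (excluded_middle_informative (O b)) as [B | B].
      * destruct (cI_otimes HC _ B) as (d & Hd), (cII_otimes HC _ B) as (a & Ha).
        destruct (rep_surj HR (a := a) (b := b)) as (u & Ku & Ku').
        { intros A. eapply (cII_sep HC); eauto. }
        { left; now apply rt_step. }
        destruct (rep_surj HR (a := d) (b := b)) as (v & Kv & Kv').
        { intros A. eapply (cI_sep HC); eauto. }
        { right; now apply rt_step. }
        assert (H : E u v) by (repeat split; congruence).
        now exists (inr (exist _ (u, v) H)).
      * destruct (rep_surj HR (a := b) (b := b)) as (v & Kv & Kv'); auto using rt_refl.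
        assert (H : al v = be v) by congruence.
        now exists (inl (exist _ v H)).
  - intros [|] [[v H] | [[u u'] H]] [[v' H'] | [[w w'] H']]; simpl in *.
    + apply (cII_vertex_vertex HC' HR' H' H).
    + apply central_edge_dual in H'. rewrite <- (proj1 (proj2 H')).
      apply (cII_edge_vertex HC' HR' H H').
    + apply central_edge_dual in H. rewrite <- (proj1 (proj2 H)).
      apply (cII_vertex_edge HC' HR' H' H).
    (* The central graph has no edges between mid-points by definition; in [C] this is the
       separation of otimes-vertices. *)
    + split; [easy |]. intros K. eapply (cI_sep HC _ _ K); [apply H | apply H'].
    + apply (cII_vertex_vertex HC HR H H').
    + apply (cII_vertex_edge HC HR H H').
    + apply (cII_edge_vertex HC HR H' H).
    + split; [easy |]. intros K. eapply (cII_sep HC _ _ K); [apply H | apply H'].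
Qed.

Lemma central_point_image_otimes a : central_otimes a <-> O (central_point_image a).
Proof.
  destruct a as [[v H] | [[u v] H]]; simpl; split; try easy.
  - intros B. apply (rep_ordinary HR v). now rewrite H.
  - intros _. apply H.
Qed.

Lemma represented_axioms : exists M : central_marking G,
  axiom_B0 G /\ axiom_B1 M /\ axiom_B2 M /\ axiom_B3 M /\ axiom_B4 M /\
  axiom_B3' M /\ axiom_B4' M /\
  exists f : central_graph M -> C, is_isomorphism (central_graph M) C f /\
    forall a, central_otimes a <-> O (f a).
Proof.
  exists M. repeat (split; [auto using represented_B0, represented_B1, represented_B2,
    represented_B3, represented_B4, represented_B3', represented_B4' |]).
  exists central_point_image; split.
  - apply central_point_image_isomorphism.
  - apply central_point_image_otimes.
Qed.

End RepresentedGraph.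

(** * Coordinates of a marked graph *)

(** This is [left_vertex] over bare relations; with [e1^t] and [E^t] it describes right vertices. *)
Definition before_center {V : Type} (e1 E : relation V) (K : V -> Prop) (v : V) : Prop :=
  (exists z, K z /\ plus e1 v z) \/ (exists z z', E z z' /\ star e1 v z).

(** The consequences of (B0), (B1) and (B2); this record is invariant under the
    reversal of all edges, which exchanges left and right. *)
Record centered {V : Type} (e1 e2 E : relation V) (K : V -> Prop) : Prop := {
  e1_fun : functional e1;
  e1_inj : functional e1^t;
  e2_fun : functional e2;
  e2_inj : functional e2^t;
  e1_acyclic : forall v, ~ plus e1 v v;
  e2_acyclic : forall v, ~ plus e2 v v;
  E_e1 : forall u v, E u v -> e1 u v;
  left_or_right : forall v, K v \/ before_center e1 E K v \/ before_center e1^t E^t K v;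
  K_unique1 : forall u v, K u -> K v -> clos_refl_sym_trans V e1 u v -> u = v;
  K_not_E : forall u v v', K u -> E v v' -> clos_refl_sym_trans V e1 u v -> False;
  E_unique : forall u u' v v', E u u' -> E v v' -> clos_refl_sym_trans V e1 u v -> u = v /\ u' = v';
  K_exists2 : forall v, exists z, K z /\ clos_refl_sym_trans V e2 z v;
  K_unique2 : forall u v, K u -> K v -> clos_refl_sym_trans V e2 u v -> u = v;
  after_K : forall u v, K u -> plus e2 u v -> before_center e1 E K v;
  before_K : forall u v, K v -> plus e2 u v -> before_center e1^t E^t K u
}.

Arguments E_e1 {V e1 e2 E K} _ {u v} _.
Arguments K_unique1 {V e1 e2 E K} _ {u v} _ _ _.
Arguments K_not_E {V e1 e2 E K} _ {u v v'} _ _ _.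
Arguments E_unique {V e1 e2 E K} _ {u u' v v'} _ _ _.
Arguments after_K {V e1 e2 E K} _ {u v} _ _.
Arguments before_K {V e1 e2 E K} _ {u v} _ _.

Lemma crst_transp (T : Type) (e : relation T) x y :
  clos_refl_sym_trans T e^t x y <-> clos_refl_sym_trans T e x y.
Proof.
  split; induction 1; try (apply rst_sym, rst_step; assumption); try apply rst_refl;
    try (apply rst_sym; assumption); eapply rst_trans; eassumption.
Qed.

Lemma centered_dual (V : Type) (e1 e2 E : relation V) K :
  centered e1 e2 E K -> centered e1^t e2^t E^t K.
Proof.
  intros []; split; auto.
  - intros v; rewrite plus_transp; auto.
  - intros v; rewrite plus_transp; auto.
  - unfold transp; auto.
  - intros v; destruct (left_or_right0 v) as [H | [H | H]]; auto.
  - intros u v; rewrite crst_transp; auto.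
  - intros u v v' H H'; rewrite crst_transp; intros S.
    (* In the reversed graph [v] is the end of the central edge, so the connection is prolonged by
       that edge to its beginning. *)
    apply (K_not_E0 u v' v); auto.
    eapply rst_trans; [exact S | apply rst_sym, rst_step, E_e2, H'].
  - intros u u' v v' H H'; rewrite crst_transp; intros S.
    destruct (E_unique0 u' u v' v); auto.
    eapply rst_trans; [apply rst_step, E_e2, H |].
    eapply rst_trans; [exact S | apply rst_sym, rst_step, E_e2, H'].
  - intros v; destruct (K_exists3 v) as (z & H & S); exists z; rewrite crst_transp; auto.
  - intros u v; rewrite crst_transp; auto.
  - intros u v; rewrite plus_transp; apply before_K0.
  - intros u v; rewrite plus_transp; apply after_K0.
Qed.

(** * Left vertices under (B0), (B1) and (B2) *)

Section Centered.
Context {V : Type} {e1 e2 E : relation V} {K : V -> Prop}.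
Hypothesis HV : centered e1 e2 E K.
Notation L := (before_center e1 E K).
Notation R := (before_center e1^t E^t K).

Lemma left_not_central {v} : L v -> K v -> False.
Proof.
  intros [(z & Z & H) | (z & z' & Z & H)] Kv.
  - rewrite (K_unique1 HV Kv Z) in H by now apply star_crst, plus_star.
    now apply (e1_acyclic HV) in H.
  - eapply K_not_E; eauto using star_crst.
Qed.

(** A center after [v] and a center before [v] on the same 1-string have to coincide, which closes a
    cycle through [v]. *)
Lemma left_not_right {v} : L v -> R v -> False.
Proof.
  intros [(z & Z & H) | (z & z' & Z & H)] [(y & Y & H') | (y & y' & Y & H')];
    rewrite ?plus_transp, ?star_transp in H'.
  - rewrite (K_unique1 HV Z Y) in H.
    + apply (e1_acyclic HV (v := v)). eapply t_trans; eassumption.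
    + apply rst_sym, star_crst, plus_star. eapply t_trans; eassumption.
  - eapply (K_not_E HV Z Y). apply rst_sym, star_crst.
    eapply rt_trans; [apply rt_step, (E_e1 HV Y) |].
    eapply rt_trans; [exact H' | apply plus_star, H].
  - eapply (K_not_E HV Y Z). apply star_crst.
    eapply rt_trans; [apply plus_star, H' | exact H].
  - destruct (E_unique HV Z Y) as [<- <-].
    + apply rst_sym, star_crst. eapply rt_trans; [apply rt_step, (E_e1 HV Y) |].
      eapply rt_trans; eassumption.
    + apply (e1_acyclic HV (v := v)).
      eapply star_plus_trans; [exact H |].
      eapply plus_star_trans; [apply t_step, (E_e1 HV Z) | exact H'].
Qed.

Lemma central_edge_left {u v} : E u v -> L u.
Proof using HV. right; exists u, v; auto using rt_refl. Qed.

Lemma left_has_next {u} : L u -> exists v, e1 u v.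
Proof.
  intros [(z & Z & (v & H & _)%plus_head) | (z & z' & Z & H)]; [eauto |].
  apply star_cases in H as [<- | (v & H & _)%plus_head]; [| eauto].
  exists z'; now apply (E_e1 HV).
Qed.

Lemma e1_left {u v} : e1 u v -> L u -> E u v \/ L v \/ K v.
Proof.
  intros S [(z & Z & (w & H & H')%plus_head) | (z & z' & Z & H)].
  - rewrite <- (e1_fun HV _ _ _ S H) in H'. apply star_cases in H' as [<- | H']; auto.
    right; left; left; eauto.
  - apply star_cases in H as [<- | (w & H & H')%plus_head].
    + left. now rewrite (e1_fun HV _ _ _ S (E_e1 HV Z)).
    + right; left; right. rewrite <- (e1_fun HV _ _ _ S H) in H'. eauto.
Qed.

Lemma e1_from_central {u v} : K u -> e1 u v -> R v.
Proof using HV. left; exists u; split; auto. now apply t_step. Qed.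

Lemma e1_right {u v} : R u -> e1 u v -> R v.
Proof using HV.
  intros [(z & Z & H) | (z & z' & Z & H)] S; [left; exists z | right; exists z, z'];
    (split; [assumption |]).
  - eapply t_trans; [apply t_step |]; eassumption.
  - eapply rt_trans; [apply rt_step |]; eassumption.
Qed.

(** On its 2-string [v] is comparable with the central vertex; it cannot be that vertex, and
    vertices before it are right. *)
Lemma left_after_central {v} : L v -> exists z, K z /\ plus e2 z v.
Proof.
  intros H. destruct (K_exists2 HV v) as (z & Z & S). exists z; split; auto.
  apply crst_comparable in S as [S | S]; [| | apply HV | apply HV];
    apply star_cases in S as [<- | S]; auto.
  - destruct (left_not_central H Z).
  - destruct (left_not_central H Z).
  - destruct (left_not_right H (before_K HV Z S)).
Qed.

Lemma left_has_prev {v} : L v -> exists u, e2 u v.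
Proof. intros (z & _ & (u & _ & H)%plus_last)%left_after_central; eauto. Qed.

Lemma e2_into_left {u v} : e2 u v -> L v -> L u \/ K u.
Proof.
  intros S (z & Z & (w & H & H')%plus_last)%left_after_central.
  rewrite <- (e2_inj HV _ _ _ S H') in H. apply star_cases in H as [<- | H]; auto.
  left. eapply after_K; eauto.
Qed.

Lemma e2_from_central {u v} : K u -> e2 u v -> L v.
Proof. intros H S. apply (after_K HV H). now apply t_step. Qed.

Lemma e2_from_left {u v} : L u \/ K u -> e2 u v -> L v.
Proof.
  intros [(z & Z & H)%left_after_central | H] S.
  - apply (after_K HV Z). eapply t_trans; eauto using t_step.
  - eapply e2_from_central; eauto.
Qed.

(** Induction away from the center of a 1-string, whose base cases are central vertices and
    beginnings of central edges. [left_ind2] is the counterpart along 2-strings, starting from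
    central vertices only. *)
Lemma left_ind1 (P : V -> Prop) :
  (forall v, K v -> P v) ->
  (forall u v, E u v -> P u) ->
  (forall u v, e1 u v -> L u -> ~ E u v -> L v \/ K v -> P v -> P u) ->
  forall v, L v \/ K v -> P v.
Proof.
  intros PK PE step v [H | H]; auto.
  assert (exists z, star e1 v z /\ P z /\ (K z \/ exists z', E z z')) as (z & S & Pz & Z).
  { destruct H as [(z & Z & H) | (z & z' & Z & H)]; exists z; repeat split; eauto.
    now apply plus_star. }
  clear H; apply clos_rt_rt1n in S; induction S as [z | u w z S H IH]; auto.
  destruct (excluded_middle_informative (E u w)) as [B | B]; [eapply PE, B |].
  assert (Lu : L u).
  { apply clos_rt1n_rt in H. destruct Z as [Z | (z' & Z)]; [left; exists z | right; exists z, z'];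
      split; auto.
    - eapply plus_star_trans; [apply t_step |]; eassumption.
    - eapply rt_trans; [apply rt_step |]; eassumption. }
  apply (step u w); auto. destruct (e1_left S Lu) as [| []]; tauto.
Qed.

Lemma left_ind2 (P : V -> Prop) :
  (forall v, K v -> P v) ->
  (forall u v, e2 u v -> L u \/ K u -> L v -> P u -> P v) ->
  forall v, L v \/ K v -> P v.
Proof.
  intros PK step v [H | H]; auto.
  destruct (left_after_central H) as (z & Z & S%clos_trans_tn1).
  induction S as [v S | u v S S' IH].
  - apply (step z v); auto.
  - apply clos_tn1_trans, (after_K HV Z) in S'. apply (step u v); auto.
Qed.

End Centered.

(** The completions provided by the squares of (B3), and (B4); for the reversed
    graph these are (B3') and (B4'). *)
Record left_squares {V : Type} (e1 e2 E : relation V) (K : V -> Prop) : Prop := {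
  square_source : forall u v u', e1 u v -> before_center e1 E K u -> ~ E u v -> e2 u u' ->
    exists v', e1 u' v' /\ e2 v v';
  square_target : forall u v v', e1 u v -> before_center e1 E K u -> ~ E u v -> e2 v v' ->
    exists u', e1 u' v' /\ e2 u u';
  square_enter : forall y v w, e2 v w -> before_center e1 E K w -> e1 y w ->
    exists x, e1 x v /\ e2 x y;
  E_alternation : forall u u' w w' v, E u u' -> e2 u w -> e1 w w' -> e2 w' v ->
    exists v', E v v'
}.

(** The points of [C] are the images under [be] of the central vertices and
    edges. *)
Record central_coordinates {V C : Type} (e1 e2 E : relation V) (K : V -> Prop)
    (eII : relation C) (O : C -> Prop) (al be : V -> C) : Prop := {
  be_e1 : forall u v, e1 u v -> be u = be v;
  al_e2 : forall u v, e2 u v -> al u = al v;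
  al_K : forall v, K v -> al v = be v;
  be_surj : forall c, (exists v, K v /\ be v = c) \/ (exists u v, E u v /\ be u = c);
  K_inj : forall u v, K u -> K v -> be u = be v -> u = v;
  E_inj : forall u u' v v', E u u' -> E v v' -> be u = be v -> u = v;
  O_E : forall u v, E u v -> O (be u);
  O_K : forall v, K v -> ~ O (be v);
  eII_KK : forall v v', K v -> K v' ->
    eII (be v) (be v') <-> exists w, e2 v w /\ e1 w v';
  eII_KE : forall v x x', K v -> E x x' -> eII (be v) (be x) <-> e2 v x;
  eII_EK : forall v x x', K v -> E x x' ->
    eII (be x) (be v) <-> exists w, e2 x w /\ e1 w v;
  eII_EE : forall x x' y y', E x x' -> E y y' -> ~ eII (be x) (be y)
}.

Arguments square_source {V e1 e2 E K} _ {u v u'} _ _ _ _.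
Arguments square_target {V e1 e2 E K} _ {u v v'} _ _ _ _.
Arguments square_enter {V e1 e2 E K} _ {y v w} _ _ _.
Arguments E_alternation {V e1 e2 E K} _ {u u' w w' v} _ _ _ _.
Arguments eII_KK {V C e1 e2 E K eII O al be} _ {v v'} _ _.
Arguments eII_KE {V C e1 e2 E K eII O al be} _ {v x x'} _ _.
Arguments eII_EK {V C e1 e2 E K eII O al be} _ {v x x'} _ _.
Arguments eII_EE {V C e1 e2 E K eII O al be} _ {x x' y y'} _ _ _.

(** * Coordinates of the left vertices of a marked graph *)

Section LeftSide.
Context {V C : Type} {e1 e2 E : relation V} {K : V -> Prop}.
Context {eI eII : relation C} {O : C -> Prop} {al be : V -> C}.
Hypothesis HV : centered e1 e2 E K.
Hypothesis HQ : left_squares e1 e2 E K.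
Hypothesis HB : central_coordinates e1 e2 E K eII O al be.
Hypothesis HC : central_like eI eII O.
Let HV' := centered_dual HV.
Notation L := (before_center e1 E K).
Notation R := (before_center e1^t E^t K).

Lemma central_edge_right {u v} : E u v -> R v.
Proof. intros H; exact (central_edge_left HV' H). Qed.

Lemma weakly_left_not_right {v} : L v \/ K v -> R v -> False.
Proof.
  intros [H | H] H'.
  - exact (left_not_right HV H H').
  - exact (left_not_central HV' H' H).
Qed.

(** Otherwise [w] is left, and the square on the 2-edge entering [w] yields a 1-edge from [u] to a
    left or central vertex. But the 1-edge leaving such a [u] leads to a right vertex. *)
Lemma e1_to_center {u v w} : e2 u v -> K u \/ (exists u', E u u') -> e1 v w -> E v w \/ K w.
Proof.
  intros H U S.
  assert (Lv : L v).
  { apply (e2_from_left HV (u := u)); auto. destruct U as [U | (u' & U)]; auto.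
    left; now apply (central_edge_left HV) in U. }
  destruct (e1_left HV S Lv) as [B | [Lw | B]]; auto. exfalso.
  destruct (left_has_prev HV Lw) as (z & Z).
  destruct (square_enter HQ Z Lw S) as (x & X & X').
  rewrite (e2_inj HV _ _ _ X' H) in X.
  apply (@weakly_left_not_right z); [eapply e2_into_left; eauto |].
  destruct U as [U | (u' & U)].
  - eapply (e1_from_central HV); eauto.
  - rewrite (e1_fun HV _ _ _ X (E_e1 HV U)). eapply central_edge_right; eauto.
Qed.

(** Squares move the 2-edge along the 1-strings, where [be] does not change, until it leaves a
    central vertex or the beginning of a central edge. There [e1_to_center] exhibits the II-edge of
    [C]. *)
Lemma e2_eII {u} : L u \/ K u -> forall v, e2 u v -> eII (be u) (be v).
Proof.
  revert u; refine (left_ind1 HV (fun u => forall v, e2 u v -> eII (be u) (be v)) _ _ _).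
  - intros u U v S. destruct (left_has_next HV (e2_from_central HV U S)) as (w & W).
    destruct (e1_to_center S (or_introl U) W) as [B | B].
    + now apply (eII_KE HB U B).
    + rewrite (be_e1 HB _ _ W). apply (eII_KK HB U B); eauto.
  - intros u u' U v S.
    assert (Lv : L v) by (eapply (e2_from_left HV); [left; eapply (central_edge_left HV) |]; eauto).
    destruct (left_has_next HV Lv) as (w & W).
    destruct (e1_to_center S (or_intror (ex_intro _ u' U)) W) as [B | B].
    (* This would make two consecutive points mid-points. The end [w] of the second edge is right
       and so has a leaving 2-edge, to a right or central vertex [z]; by (B4) [z] begins a central
       edge and is left. *)
    + exfalso. apply central_edge_right in B.
      destruct (left_has_prev HV' B) as (z & Z).
      destruct (E_alternation HQ U S W Z) as (z' & Z').
      apply (@weakly_left_not_right z); [left; eapply (central_edge_left HV); eauto |].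
      destruct (e2_into_left HV' Z B) as [H | H]; auto.
      destruct (left_not_central HV (central_edge_left HV Z') H).
    + rewrite (be_e1 HB _ _ W). apply (eII_EK HB B U); eauto.
  - intros u u1 S Lu N _ IH v H.
    destruct (square_source HQ S Lu N H) as (v1 & S' & H').
    rewrite (be_e1 HB _ _ S), (be_e1 HB _ _ S'). auto.
Qed.

(** Only the existence of the 2-edge is at stake, since its end is then fixed by [e2_eII]. At the
    center it is part of the definition of the II-edges; squares bring it back to [u]. *)
Lemma eII_e2 {u} : L u \/ K u -> forall b, eII (be u) b -> exists v, e2 u v /\ be v = b.
Proof.
  intros U b H. enough (exists v, e2 u v) as (v & S).
  { exists v; split; auto. exact (cII_fun HC _ _ _ (e2_eII U S) H). }
  revert u U H; refine (left_ind1 HV (fun u => eII (be u) b -> exists v, e2 u v) _ _ _).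
  - intros u U H. destruct (be_surj HB b) as [(v & B & <-) | (x & x' & B & <-)].
    + apply (eII_KK HB U B) in H as (w & H & _); eauto.
    + apply (eII_KE HB U B) in H; eauto.
  - intros u u' U H. destruct (be_surj HB b) as [(v & B & <-) | (x & x' & B & <-)].
    + apply (eII_EK HB B U) in H as (w & H & _); eauto.
    + destruct (eII_EE HB U B H).
  - intros u u1 S Lu N _ IH H. rewrite (be_e1 HB _ _ S) in H.
    destruct (IH H) as (v1 & S1).
    destruct (square_target HQ S Lu N S1) as (v & _ & H'); eauto.
Qed.

(** The 2-edge entering [u] gives a point before the mid-point; two mid-points are never adjacent,
    so it is a central vertex, and by [eII_KE] it lies on the 2-string of [u]. *)
Lemma central_edge_al {u v} : E u v -> eII (al u) (be u).
Proof.
  intros U. pose proof (central_edge_left HV U) as Lu.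
  destruct (left_has_prev HV Lu) as (z & Z).
  pose proof (e2_eII (e2_into_left HV Z Lu) Z) as H.
  destruct (be_surj HB (be z)) as [(a & A & Eq) | (x & x' & X & Eq)]; rewrite <- Eq in H.
  - apply (eII_KE HB A U) in H as H'. now rewrite <- (al_e2 HB _ _ H'), (al_K HB _ A).
  - destruct (eII_EE HB X U H).
Qed.

(** Squares move the 1-edge back along the 2-strings until it ends at a central vertex. The point
    before that one is then either [al u] itself or a mid-point, and in the second case [al u] comes
    just before the mid-point. *)
Lemma e1_next_ordinary {v} : L v \/ K v -> forall u, e1 u v -> L u -> ~ E u v ->
  next_ordinary eII O (al u) (al v).
Proof.
  revert v; refine (left_ind2 HV (fun v => forall u, e1 u v -> L u -> ~ E u v ->
    next_ordinary eII O (al u) (al v)) _ _).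
  - intros v B u S Lu N. destruct (left_has_prev HV Lu) as (z & Z).
    pose proof (e2_eII (e2_into_left HV Z Lu) Z) as H.
    rewrite (be_e1 HB _ _ S) in H. rewrite (al_K HB _ B), <- (al_e2 HB _ _ Z).
    destruct (be_surj HB (be z)) as [(a & A & Eq) | (x & x' & X & Eq)]; rewrite <- Eq in H.
    + pose proof H as H'. apply (eII_KK HB A B) in H' as (w & W & W').
      rewrite (e1_inj HV _ _ _ W' S) in W. rewrite (e2_inj HV _ _ _ Z W).
      left; now rewrite (al_K HB _ A).
    + pose proof H as H'. apply (eII_EK HB B X) in H' as (w & W & W').
      rewrite (e1_inj HV _ _ _ W' S) in W. rewrite (e2_inj HV _ _ _ Z W).
      right; exists (be x); repeat split; auto.
      * eapply (O_E HB); eauto.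
      * eapply central_edge_al; eauto.
  - intros z v Z Lz Lv IH u S Lu N.
    destruct (square_enter HQ Z Lv S) as (x & X & X').
    rewrite <- (al_e2 HB _ _ Z), <- (al_e2 HB _ _ X'). apply IH; auto.
    (* If [x] were central, or the new 1-edge a central edge, then [z] would be right. *)
    + destruct (e2_into_left HV X' Lu) as [|B]; auto.
      destruct (weakly_left_not_right Lz). eapply (e1_from_central HV); eauto.
    + intros B. destruct (weakly_left_not_right Lz). eapply central_edge_right; eauto.
Qed.

Lemma from_central {v} : L v \/ K v -> exists a, K a /\ be a = al v /\ star e2 a v.
Proof.
  revert v; refine (left_ind2 HV (fun v => exists a, K a /\ be a = al v /\ star e2 a v) _ _).
  - intros v H. exists v; repeat split; auto using rt_refl. symmetry; now apply (al_K HB).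
  - intros u v S _ _ (a & A & Eq & H). exists a; repeat split; auto.
    + now rewrite <- (al_e2 HB _ _ S).
    + eapply rt_trans; eauto using rt_step.
Qed.

Lemma plus_e2_eII {u v} : plus e2 u v -> L u \/ K u -> plus eII (be u) (be v) /\ L v.
Proof.
  intros H%clos_trans_tn1 U; induction H as [v H | w v H _ [IH IH']].
  - exact (conj (t_step _ _ _ _ (e2_eII U H)) (e2_from_left HV U H)).
  - assert (W : L w \/ K w) by now left.
    split; [| exact (e2_from_left HV W H)].
    eapply t_trans; [exact IH | apply t_step, (e2_eII W H)].
Qed.

(** Equal [al] puts both vertices on the 2-string of one central vertex, and [be] strictly advances
    along it. *)
Lemma weakly_left_inj {u v} : L u \/ K u -> L v \/ K v -> al u = al v -> be u = be v -> u = v.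
Proof.
  intros U W Ea Eb. destruct (from_central U) as (a & A & Ka & Sa), (from_central W) as (b & B & Kb & Sb).
  assert (a = b) as <- by (apply (K_inj HB); congruence).
  destruct (star_comparable (e2_fun HV) Sa Sb) as [S | S];
    apply star_cases in S as [S | S]; auto; apply plus_e2_eII in S as [S _]; auto;
    rewrite Eb in S; now apply (cII_acyclic HC) in S.
Qed.

Lemma weakly_left_star {v} : L v \/ K v -> star eII (al v) (be v).
Proof.
  revert v; refine (left_ind2 HV (fun v => star eII (al v) (be v)) _ _).
  - intros v H. rewrite (al_K HB _ H); apply rt_refl.
  - intros u v S U _ H. rewrite <- (al_e2 HB _ _ S).
    eapply rt_trans; [exact H | apply rt_step, e2_eII; auto].
Qed.

Lemma left_plus {v} : L v -> plus eII (al v) (be v).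
Proof.
  intros H. destruct (star_cases (weakly_left_star (or_introl H))) as [Eq |]; auto.
  destruct (from_central (or_introl H)) as (a & A & Ka & _).
  assert (a = v) as <-; [| destruct (left_not_central HV H A)].
  apply weakly_left_inj; auto; [rewrite (al_K HB _ A) |]; congruence.
Qed.

Lemma weakly_left_surj {a b} : ~ O a -> star eII a b ->
  exists v, (L v \/ K v) /\ al v = a /\ be v = b.
Proof.
  intros N H%clos_rt_rtn1; induction H as [| b c H _ (v & B & <- & <-)].
  - destruct (be_surj HB a) as [(v & B & <-) | (x & x' & B & <-)].
    + exists v; repeat split; auto. now apply (al_K HB).
    + destruct N. eapply (O_E HB); eauto.
  - destruct (eII_e2 B H) as (w & S & W). exists w; repeat split; auto.
    + left; eapply (e2_from_left HV); eauto.
    + symmetry; now apply (al_e2 HB).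
Qed.

Lemma weakly_left_ordinary {v} : L v \/ K v -> ~ O (al v).
Proof. intros (a & A & <- & _)%from_central. now apply (O_K HB). Qed.

Lemma e2_of_coordinates {u v} : L u \/ K u -> L v \/ K v -> al u = al v -> eII (be u) (be v) -> e2 u v.
Proof.
  intros U W Ea H. destruct (eII_e2 U H) as (w & S & Eb).
  rewrite (@weakly_left_inj v w); auto.
  - left; exact (e2_from_left HV U S).
  - rewrite <- Ea; now apply (al_e2 HB).
Qed.

(** A left vertex always has a leaving 1-edge. That edge is not central by [next_ordinary_before],
    so its end has the coordinates of [v]. *)
Lemma e1_of_coordinates {u v} : L u -> L v \/ K v -> be u = be v ->
  next_ordinary eII O (al u) (al v) -> e1 u v.
Proof.
  intros U W Eb H. destruct (left_has_next HV U) as (w & S).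
  destruct (excluded_middle_informative (E u w)) as [B | B].
  - exfalso. apply (next_ordinary_before HC (a := al u) (a' := al v) (b := be u)); auto.
    + now apply weakly_left_ordinary.
    + eapply (O_E HB); eauto.
    + eapply central_edge_al; eauto.
    + rewrite Eb; now apply weakly_left_star.
  - assert (W' : L w \/ K w) by (destruct (e1_left HV S U); tauto).
    rewrite (@weakly_left_inj v w); auto.
    + eapply next_ordinary_fun; eauto using weakly_left_ordinary, e1_next_ordinary.
      apply HC.
    + rewrite <- Eb. now apply (be_e1 HB).
Qed.

Lemma central_edge_unique {u x x'} : L u \/ K u -> E x x' -> be u = be x ->
  eII (al u) (be u) -> u = x.
Proof.
  intros U X Eb H. apply weakly_left_inj; auto.
  - left; eapply (central_edge_left HV); eauto.
  - apply (cII_inj HC (be u)); auto. red; rewrite Eb. eapply central_edge_al; eauto.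
Qed.

End LeftSide.

(** * Left and right sides combined *)

Section BothSides.
Context {V C : Type} {e1 e2 E : relation V} {K : V -> Prop}.
Context {eI eII : relation C} {O : C -> Prop} {al be : V -> C}.
Hypothesis HV : centered e1 e2 E K.
Hypothesis HQ : left_squares e1 e2 E K.
Hypothesis HQ' : left_squares e1^t e2^t E^t K.
Hypothesis HB : central_coordinates e1 e2 E K eII O al be.
Hypothesis HB' : central_coordinates e1^t e2^t E^t K eI^t O al be.
Hypothesis HC : central_like eI eII O.
Let HV' := centered_dual HV.
Let HC' := central_like_dual HC.
Notation L := (before_center e1 E K).
Notation R := (before_center e1^t E^t K).

Lemma trichotomy v : (L v \/ K v) \/ R v.
Proof. destruct (left_or_right HV v) as [H | [H | H]]; auto. Qed.

Lemma right_plus v : R v -> plus eI (be v) (al v).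
Proof. intros H. apply plus_transp. exact (left_plus HV' HQ' HB' HC' H). Qed.

Lemma weakly_right_star v : R v \/ K v -> star eI (be v) (al v).
Proof. intros H. apply star_transp. exact (weakly_left_star HV' HQ' HB' H). Qed.

Lemma weakly_left_of_star v : star eII (al v) (be v) -> L v \/ K v.
Proof.
  intros H. destruct (trichotomy v) as [|U]; auto.
  destruct (star_plus_meet HC H (right_plus U)).
Qed.

Lemma weakly_right_of_star v : star eI (be v) (al v) -> R v \/ K v.
Proof.
  intros H. destruct (trichotomy v) as [[U | U] | U]; auto.
  destruct (plus_star_meet HC (left_plus HV HQ HB HC U) H).
Qed.

Lemma left_of_plus v : plus eII (al v) (be v) -> L v.
Proof.
  intros H. destruct (weakly_left_of_star (plus_star H)) as [|U]; auto.
  rewrite (al_K HB _ U) in H. now apply (cII_acyclic HC) in H.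
Qed.

Lemma right_of_plus v : plus eI (be v) (al v) -> R v.
Proof.
  intros H. destruct (weakly_right_of_star (plus_star H)) as [|U]; auto.
  rewrite (al_K HB _ U) in H. now apply (cI_acyclic HC) in H.
Qed.

Lemma marked_represents : represents e1 e2 eI eII O al be.
Proof.
  split.
  (* A left and a right vertex with equal coordinates would give a II-path and a nontrivial I-path
     back. *)
  - assert (N : forall u v, L u -> R v -> al u = al v -> be u = be v -> False).
    { intros u v U W Ea Eb. pose proof (left_plus HV HQ HB HC U) as H.
      rewrite Ea, Eb in H. apply plus_star in H.
      exact (star_plus_meet HC H (right_plus W)). }
    intros u v Ea Eb. destruct (left_or_right HV u) as [U | [U | U]], (left_or_right HV v) as [W | [W | W]].
    all: try (apply (weakly_left_inj HV HQ HB HC); auto; fail).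
    all: try (apply (weakly_left_inj HV' HQ' HB' HC'); auto; fail).
    all: exfalso; eauto.
  - intros v. destruct (trichotomy v) as [U | U].
    + exact (weakly_left_ordinary HV HB U).
    + exact (weakly_left_ordinary HV' HB' (or_introl U)).
  - intros v. destruct (trichotomy v) as [U | U].
    + left; exact (weakly_left_star HV HQ HB U).
    + right; apply weakly_right_star; auto.
  - intros a b N [H | H].
    + destruct (weakly_left_surj HV HQ HB HC N H) as (v & _ & H'); eauto.
    + apply star_transp in H.
      destruct (weakly_left_surj HV' HQ' HB' HC' N H) as (v & _ & H'); eauto.
  - intros u v; split.
    + intros S. split; [exact (be_e1 HB _ _ S) |].
      destruct (excluded_middle_informative (E u v)) as [B | B].
      { right; right; repeat split.
        - eapply (O_E HB); eauto.
        - exact (central_edge_al HV HQ HB B).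
        - exact (central_edge_al HV' HQ' HB' B). }
      destruct (trichotomy u) as [[U | U] | U].
      * left. assert (W : L v \/ K v) by (destruct (e1_left HV S U); tauto).
        split; [exact (e1_next_ordinary HV HQ HB W S U B) |].
        exact (weakly_left_star HV HQ HB W).
      * right; left. pose proof (e1_from_central HV U S) as W.
        split; [apply weakly_right_star; auto |]. apply next_ordinary_transp.
        exact (e1_next_ordinary HV' HQ' HB' (or_intror U) S W B).
      * right; left. pose proof (e1_right HV U S) as W.
        split; [apply weakly_right_star; auto |]. apply next_ordinary_transp.
        exact (e1_next_ordinary HV' HQ' HB' (or_introl U) S W B).
    + intros [Eb [[H W] | [[W H] | (B & H & H')]]].
      * assert (U : L u).
        { apply left_of_plus. rewrite Eb. eapply plus_star_trans; eauto using next_ordinary_plus. }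
        exact (e1_of_coordinates HV HQ HB HC U (weakly_left_of_star W) Eb H).
      * assert (U : R v).
        { apply right_of_plus. rewrite <- Eb. eapply star_plus_trans; eauto using next_ordinary_plus. }
        apply next_ordinary_transp in H.
        exact (e1_of_coordinates HV' HQ' HB' HC' U (weakly_right_of_star W) (eq_sym Eb) H).
      (* The otimes-vertex [be u] is the mid-point of some central edge, and the coordinates
         identify the ends of that edge with [u] and [v]. *)
      * destruct (be_surj HB (be u)) as [(z & Z & Ez) | (x & x' & X & Ex)].
        { rewrite <- Ez in B. destruct (O_K HB _ Z B). }
        assert (U : L u) by now apply left_of_plus, t_step.
        assert (W : R v) by now apply right_of_plus, t_step.
        assert (Ex' : be v = be x') by (rewrite <- (be_e1 HB _ _ (E_e1 HV X)); congruence).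
        rewrite (central_edge_unique HV HQ HB HC (or_introl U) X (eq_sym Ex) H).
        rewrite (central_edge_unique HV' HQ' HB' HC' (or_introl W) X Ex' H').
        exact (E_e1 HV X).
  - intros u v; split.
    + intros S. split; [exact (al_e2 HB _ _ S) |].
      destruct (trichotomy u) as [U | U].
      * left; split; [exact (weakly_left_star HV HQ HB U) | exact (e2_eII HV HQ HB U S)].
      * right. pose proof (e2_into_left HV' S U) as W.
        split; [now apply weakly_right_star |].
        exact (e2_eII HV' HQ' HB' W S).
    + intros [Ea [[H H'] | [H H']]].
      * apply (e2_of_coordinates HV HQ HB HC); auto.
        -- now apply weakly_left_of_star.
        -- apply weakly_left_of_star. rewrite <- Ea. eapply rt_trans; eauto using rt_step.
      * apply (e2_of_coordinates HV' HQ' HB' HC'); auto.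
        -- now apply weakly_right_of_star.
        -- apply weakly_right_of_star. rewrite Ea. eapply rt_trans; eauto using rt_step.
Qed.

End BothSides.

(** A commutative square may degenerate to a 1-edge [(u, v)] and a 2-edge
    [(v, u)]; following the 1-string to its center, these would give a loop of
    the central graph or violate (B4). *)
Lemma no_degenerate_square (V : Type) (e1 e2 E : relation V) K : centered e1 e2 E K ->
  (forall u v u', e1 u v -> before_center e1 E K u -> ~ E u v -> e2 u u' ->
    exists v', e1 u' v' /\ e2 v v') ->
  (forall u u' w w' v, E u u' -> e2 u w -> e1 w w' -> e2 w' v -> exists v', E v v') ->
  (forall v w, K v -> e2 v w -> e1 w v -> False) ->
  forall u v, e1 u v -> before_center e1 E K u -> ~ E u v -> e2 v u -> False.
Proof.
  intros HV source alt no_loop u v S U N.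
  assert (W : before_center e1 E K v \/ K v) by (destruct (e1_left HV S U); tauto).
  revert u S U N. refine (left_ind1 HV (fun v => forall u, e1 u v ->
    before_center e1 E K u -> ~ E u v -> e2 v u -> False) _ _ _ W).
  - clear v W; intros v W u S U N T. eauto.
  - clear v W; intros v w W u S U N T.
    (* (B4) is applied to the path [v], [u], [v], [u] that runs through the 2-edge twice: it makes
       the 1-edge leaving [u] central. *)
    destruct (alt _ _ _ _ _ W T S T) as (u' & U').
    rewrite (e1_fun HV _ _ _ S (E_e1 HV U')) in N. tauto.
  - clear v W; intros v w W V' N' _ IH u S U N T.
    (* The square on [(v, w)] returns to [v], so [(v, w)] is degenerate as well and nearer to the
       center. *)
    destruct (source _ _ _ W V' N' T) as (v' & S' & T').
    rewrite (e1_fun HV _ _ _ S' S) in T'. exact (IH v W V' N' T').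
Qed.

(** * From the axioms to coordinates *)

Section MarkedGraph.
Context {G : digraph} (M : central_marking G).
Hypothesis simple : no_multiple_edges G.
Hypothesis B0 : axiom_B0 G.
Hypothesis B1 : axiom_B1 M.
Hypothesis B2 : axiom_B2 M.

Notation e1 := (edge G c1).
Notation e2 := (edge G c2).
Notation E := (cedge M).
Notation K := (cvert M).

Lemma right_vertex_after_center v : right_vertex M v <-> before_center e1^t E^t K v.
Proof.
  split; (intros [(z & Z & H) | (z & z' & Z & H)]; [left; exists z | right; exists z', z]);
    rewrite ?plus_transp, ?star_transp in *; auto.
Qed.

Lemma marked_acyclic c v : ~ plus (edge G c) v v.
Proof.
  apply directed_path_acyclic.
  - intros x y y'; apply (B0 c).
  - apply (B0 c).
Qed.

Lemma marked_centered : centered e1 e2 E K.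
Proof.
  split.
  - intros x y y'; apply (B0 c1).
  - intros x y y' H H'; exact (proj1 (B0 c1) _ _ _ H H').
  - intros x y y'; apply (B0 c2).
  - intros x y y' H H'; exact (proj1 (B0 c2) _ _ _ H H').
  - apply marked_acyclic.
  - apply marked_acyclic.
  - apply cedge_edge.
  - intros v. destruct (B1 v) as ([z | [z z']] & [S Z] & _);
      (apply crst_comparable in S as [S | S]; [| | intros x y y'; apply (B0 c1) |
         intros x y y' H H'; exact (proj1 (B0 c1) _ _ _ H H')]).
    + apply star_cases in S as [-> | S]; auto. right; left; left; eauto.
    + apply star_cases in S as [-> | S]; auto. right; right; left.
      exists z; rewrite plus_transp; auto.
    + right; left; right; eauto.
    + right. apply star_cases in S as [-> | (w & H & S)%plus_head].
      * left; right; exists v, z'; auto using rt_refl.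
      * right; right. exists z', z. split; [exact Z | apply star_transp].
        now rewrite (proj1 (proj2 (B0 c1)) _ _ _ (cedge_edge M _ _ Z) H).
  - intros u v U W S. destruct (B1 u) as (y & _ & Un).
    pose proof (Un (inl u) (conj (rst_refl _ _ _) U)) as H.
    rewrite (Un (inl v) (conj S W)) in H. congruence.
  - intros u v v' U W S. destruct (B1 u) as (y & _ & Un).
    pose proof (Un (inl u) (conj (rst_refl _ _ _) U)) as H.
    rewrite (Un (inr (v, v')) (conj S W)) in H. congruence.
  - intros u u' v v' U W S. destruct (B1 u) as (y & _ & Un).
    pose proof (Un (inr (u, u')) (conj (rst_refl _ _ _) U)) as H.
    rewrite (Un (inr (v, v')) (conj S W)) in H. split; congruence.
  - intros v. destruct (B2 v) as [(z & [S Z] & _) _].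
    exists z; split; [exact Z | apply rst_sym, S].
  - intros u v U W S. destruct (B2 u) as [(z & _ & Un) _].
    rewrite <- (Un u), <- (Un v); auto; split; auto. apply rst_refl.
  - intros u v U S. apply (proj2 (B2 u) u); auto. apply rst_refl.
  - intros u v U S. apply right_vertex_after_center.
    apply (proj2 (B2 v) v); auto. apply rst_refl.
Qed.

Lemma marked_loop1 v : e1 v v -> False.
Proof. intros H. apply (@marked_acyclic c1 v), t_step, H. Qed.

Lemma marked_loop2 v : e2 v v -> False.
Proof. intros H. apply (@marked_acyclic c2 v), t_step, H. Qed.

Lemma simple_edge u v : e1 u v -> e2 u v -> False.
Proof. intros H H'; exact (simple _ _ (conj H H')). Qed.

(** Any other placement of the two edges in a square identifies vertices and produces a loop or a
    double edge. *)
Lemma common_square_source u v y : in_common_square (u, v) (u, y) ->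
  exists v', e1 y v' /\ e2 v v'.
Proof.
  intros (a & b & a' & b' & (H1 & H2 & H3 & H4) & [Eq | Eq] & [Eq' | Eq']);
    injection Eq as -> ->; injection Eq'; intros; subst; eauto; exfalso;
    eauto using marked_loop1, marked_loop2, simple_edge.
Qed.

Lemma common_square_enter y v w : in_common_square (y, w) (v, w) ->
  exists x, e1 x v /\ e2 x y.
Proof.
  intros (a & b & a' & b' & (H1 & H2 & H3 & H4) & [Eq | Eq] & [Eq' | Eq']);
    injection Eq as -> ->; injection Eq'; intros; subst; eauto; exfalso;
    eauto using marked_loop1, marked_loop2, simple_edge.
Qed.

(** The degenerate alternative arises when [(u, v)] is the second 1-edge and [(v, y)] the first
    2-edge of the square; it contains no loop and no double edge, so [no_degenerate_square] has to
    exclude it. *)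
Lemma common_square_target u v y : in_common_square (u, v) (v, y) ->
  (exists u', e1 u' y /\ e2 u u') \/ y = u.
Proof.
  intros (a & b & a' & b' & (H1 & H2 & H3 & H4) & [Eq | Eq] & [Eq' | Eq']);
    injection Eq as -> ->; injection Eq'; intros; subst; eauto; exfalso;
    eauto using marked_loop1, marked_loop2, simple_edge.
Qed.

Lemma common_square_target' u v y : in_common_square (u, v) (y, u) ->
  (exists u', e1 y u' /\ e2 u' v) \/ y = v.
Proof.
  intros (a & b & a' & b' & (H1 & H2 & H3 & H4) & [Eq | Eq] & [Eq' | Eq']);
    injection Eq as -> ->; injection Eq'; intros; subst; eauto; exfalso;
    eauto using marked_loop1, marked_loop2, simple_edge.
Qed.

Let HV := marked_centered.

Lemma marked_left_squares : axiom_B3 M -> axiom_B4 M ->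
  (forall v w, K v -> e2 v w -> e1 w v -> False) -> left_squares e1 e2 E K.
Proof.
  intros [B3i B3ii] B4 no_loop.
  assert (source : forall u v u', e1 u v -> before_center e1 E K u -> ~ E u v -> e2 u u' ->
    exists v', e1 u' v' /\ e2 v v').
  { intros u v u' S U N T. apply (@common_square_source u), B3i; auto.
    exact (conj S (conj N U)). }
  assert (alt : forall u u' w w' v, E u u' -> e2 u w -> e1 w w' -> e2 w' v -> exists v', E v v').
  { intros u u' w w' v U; apply B4; eauto. }
  split; auto.
  - intros u v v' S U N T.
    destruct (@common_square_target u v v') as [H | ->]; auto.
    + apply B3i; auto. exact (conj S (conj N U)).
    + destruct (no_degenerate_square HV source alt no_loop _ S U N T).
  - intros y v w S W T. apply (@common_square_enter y v w), B3ii; auto.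
    exact (conj S W).
Qed.

(** Reversal turns a square around, so [common_square_source] and [common_square_enter] trade
    places. *)
Lemma marked_right_squares : axiom_B3' M -> axiom_B4' M ->
  (forall v w, K v -> e2 w v -> e1 v w -> False) -> left_squares e1^t e2^t E^t K.
Proof.
  intros [B3i B3ii] B4 no_loop.
  assert (source : forall u v u', e1^t u v -> before_center e1^t E^t K u -> ~ E^t u v ->
    e2^t u u' -> exists v', e1^t u' v' /\ e2^t v v').
  { intros u v u' S U N T. apply (@common_square_enter v u' u), B3i; auto.
    apply right_vertex_after_center in U. exact (conj S (conj N U)). }
  assert (alt : forall u u' w w' v, E^t u u' -> e2^t u w -> e1^t w w' -> e2^t w' v ->
    exists v', E^t v v').
  { intros u u' w w' v U; apply B4; eauto. }
  split; auto.
  - intros u v v' S U N T.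
    destruct (@common_square_target' v u v') as [H | ->]; auto.
    + apply B3i; auto. apply right_vertex_after_center in U. exact (conj S (conj N U)).
    + destruct (no_degenerate_square (centered_dual HV) source alt no_loop _ S U N T).
  - intros y v w S W T. apply (@common_square_source w y v), B3ii; auto.
    apply right_vertex_after_center in W. exact (conj S W).
Qed.

Notation C := (central_graph M).

Definition on_string1 (x : G) (c : C) : Prop :=
  match c with
  | inl v => string_of G c1 x (proj1_sig v)
  | inr e => string_of G c1 x (fst (proj1_sig e))
  end.

Definition on_string2 (x : G) (c : C) : Prop :=
  match c with
  | inl v => string_of G c2 x (proj1_sig v)
  | inr _ => False
  end.

Lemma on_string1_unique x c c' : on_string1 x c -> on_string1 x c' -> c = c'.
Proof.
  intros S S'. destruct c as [[v H] | [[u v] H]], c' as [[v' H'] | [[u' v'] H']];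
    simpl in *; pose proof (rst_trans _ _ _ _ _ (rst_sym _ _ _ _ S) S') as T.
  - f_equal; apply sig_eq; simpl. exact (K_unique1 HV H H' T).
  - destruct (K_not_E HV H H' T).
  - destruct (K_not_E HV H' H (rst_sym _ _ _ _ T)).
  - f_equal; apply sig_eq; simpl. destruct (E_unique HV H H' T) as [-> ->]; auto.
Qed.

Lemma on_string2_unique x c c' : on_string2 x c -> on_string2 x c' -> c = c'.
Proof.
  intros S S'. destruct c as [[v H] | [[u v] H]], c' as [[v' H'] | [[u' v'] H']];
    simpl in *; try easy.
  pose proof (rst_trans _ _ _ _ _ (rst_sym _ _ _ _ S) S') as T.
  f_equal; apply sig_eq; simpl. exact (K_unique2 HV H H' T).
Qed.

Lemma on_string1_exists x : exists c, on_string1 x c.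
Proof.
  destruct (B1 x) as ([z | [z z']] & [S Z] & _).
  - exists (inl (exist _ z Z)); exact S.
  - exists (inr (exist _ (z, z') Z)); exact S.
Qed.

Lemma on_string2_exists x : exists c, on_string2 x c.
Proof. destruct (B2 x) as [(z & [S Z] & _) _]. exists (inl (exist _ z Z)); exact S. Qed.

(** The maps [beta] ([center1]) and [alpha] ([center2]) of the overview. *)
Definition center1 (x : G) : C :=
  proj1_sig (constructive_indefinite_description _ (on_string1_exists x)).

Definition center2 (x : G) : C :=
  proj1_sig (constructive_indefinite_description _ (on_string2_exists x)).

Lemma center1_eq x c : on_string1 x c -> center1 x = c.
Proof. apply on_string1_unique, (proj2_sig (constructive_indefinite_description _ _)). Qed.

Lemma center2_eq x c : on_string2 x c -> center2 x = c.
Proof. apply on_string2_unique, (proj2_sig (constructive_indefinite_description _ _)). Qed.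

Lemma center1_K {v} (H : K v) : center1 v = inl (exist _ v H).
Proof. apply center1_eq, rst_refl. Qed.

Lemma center2_K {v} (H : K v) : center2 v = inl (exist _ v H).
Proof. apply center2_eq, rst_refl. Qed.

Lemma center1_E {u v} (H : E u v) : center1 u = inr (exist _ (u, v) H).
Proof. apply center1_eq, rst_refl. Qed.

Lemma center1_E' {u v} (H : E u v) : center1 v = inr (exist _ (u, v) H).
Proof. apply center1_eq, rst_sym, rst_step, (cedge_edge M _ _ H). Qed.

Lemma center1_e1 u v : e1 u v -> center1 u = center1 v.
Proof.
  intros H. apply center1_eq. unfold center1.
  destruct (constructive_indefinite_description _ _) as [[[z Z] | [[z z'] Z]] S]; simpl in *;
    eapply rst_trans; eauto; now apply rst_step.
Qed.

Lemma center2_e2 u v : e2 u v -> center2 u = center2 v.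
Proof.
  intros H. apply center2_eq. unfold center2.
  destruct (constructive_indefinite_description _ _) as [[[z Z] | [[z z'] Z]] S]; simpl in *;
    [| easy]. eapply rst_trans; eauto; now apply rst_step.
Qed.

(** The clauses on [eII] are the definition of the II-edges of the central graph, read off at the
    vertex or edge that represents each point. *)
Lemma marked_left_coordinates :
  central_coordinates e1 e2 E K (edge C c2) central_otimes center2 center1.
Proof.
  split.
  - apply center1_e1.
  - apply center2_e2.
  - intros v H; now rewrite (center1_K H), (center2_K H).
  - intros [[v H] | [[u v] H]]; [left; exists v | right; exists u, v]; split; auto.
    + apply center1_K.
    + apply center1_E.
  - intros u v U W. rewrite (center1_K U), (center1_K W). congruence.
  - intros u u' v v' U W. rewrite (center1_E U), (center1_E W). congruence.
  - intros u v U. now rewrite (center1_E U).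
  - intros v W. rewrite (center1_K W). auto.
  - intros v v' W W'. now rewrite (center1_K W), (center1_K W').
  - intros v x x' W X. now rewrite (center1_K W), (center1_E X).
  - intros v x x' W X. now rewrite (center1_K W), (center1_E X).
  - intros x x' y y' X Y. rewrite (center1_E X), (center1_E Y). auto.
Qed.

Lemma marked_right_coordinates :
  central_coordinates e1^t e2^t E^t K (edge C c1)^t central_otimes center2 center1.
Proof.
  unfold transp; split.
  - intros u v H; symmetry; now apply center1_e1.
  - intros u v H; symmetry; now apply center2_e2.
  - intros v H; now rewrite (center1_K H), (center2_K H).
  - intros [[v H] | [[u v] H]]; [left; exists v | right; exists v, u]; split; auto.
    + apply center1_K.
    + apply center1_E'.
  - intros u v U W. rewrite (center1_K U), (center1_K W). congruence.
  - intros u u' v v' U W. rewrite (center1_E' U), (center1_E' W). congruence.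
  - intros u v U. now rewrite (center1_E' U).
  - intros v W. rewrite (center1_K W). auto.
  - intros v v' W W'. now rewrite (center1_K W), (center1_K W').
  - intros v x x' W X. now rewrite (center1_K W), (center1_E' X).
  - intros v x x' W X. now rewrite (center1_K W), (center1_E' X).
  - intros x x' y y' X Y. rewrite (center1_E' X), (center1_E' Y). auto.
Qed.

Lemma marked_graph_represents : axiom_B3 M -> axiom_B4 M -> axiom_B3' M -> axiom_B4' M ->
  central_like (edge C c1) (edge C c2) central_otimes ->
  represents e1 e2 (edge C c1) (edge C c2) central_otimes center2 center1.
Proof.
  intros B3 B4 B3' B4' HC.
  apply (marked_represents (E := E) (K := K)); auto.
  (* A 2-edge from [v] to [w] and a 1-edge back would be a II-edge of the central graph from [v] to
     itself. *)
  - apply marked_left_squares; auto. intros v w W H H'.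
    apply (cII_acyclic HC (a := inl (exist _ v W))), t_step; simpl; eauto.
  - apply marked_right_squares; auto. intros v w W H H'.
    apply (cI_acyclic HC (a := inl (exist _ v W))), t_step; simpl; eauto.
  - apply marked_left_coordinates.
  - apply marked_right_coordinates.
Qed.

End MarkedGraph.

Lemma star_map X Y (f : X -> Y) (e : relation X) (e' : relation Y) x y :
  (forall u v, e u v -> e' (f u) (f v)) -> star e x y -> star e' (f x) (f y).
Proof.
  intros H; induction 1; [apply rt_step; auto | apply rt_refl | eapply rt_trans; eauto].
Qed.

Lemma plus_map X Y (f : X -> Y) (e : relation X) (e' : relation Y) x y :
  (forall u v, e u v -> e' (f u) (f v)) -> plus e x y -> plus e' (f x) (f y).
Proof.
  intros H; induction 1; [apply t_step; auto | eapply t_trans; eauto].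
Qed.

Lemma central_like_isomorphism (C D : digraph) (f : C -> D) (O : C -> Prop) (O' : D -> Prop) :
  is_isomorphism C D f -> (forall a, O a <-> O' (f a)) ->
  central_like (edge D c1) (edge D c2) O' -> central_like (edge C c1) (edge C c2) O.
Proof.
  intros [(g & gf & fg) He] HO HD.
  assert (inj : forall a b, f a = f b -> a = b) by (intros a b E; rewrite <- (gf a), E; apply gf).
  assert (Hs : forall c a b, star (edge C c) a b -> star (edge D c) (f a) (f b))
    by (intros c a b; apply star_map; intros; now apply He).
  assert (Hp : forall c a b, plus (edge C c) a b -> plus (edge D c) (f a) (f b))
    by (intros c a b; apply plus_map; intros; now apply He).
  split.
  - intros x y y' H%He H'%He. apply inj, (cI_fun HD _ _ _ H H').
  - intros x y y' H%He H'%He. apply inj, (cI_inj HD _ _ _ H H').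
  - intros x y y' H%He H'%He. apply inj, (cII_fun HD _ _ _ H H').
  - intros x y y' H%He H'%He. apply inj, (cII_inj HD _ _ _ H H').
  - intros a H. apply Hp, (cI_acyclic HD) in H; auto.
  - intros a H. apply Hp, (cII_acyclic HD) in H; auto.
  - intros a b H H'. apply inj, (c_meet HD); auto.
  - intros a b H%He; rewrite !HO. apply (cI_sep HD _ _ H).
  - intros a b H%He; rewrite !HO. apply (cII_sep HD _ _ H).
  - intros a (b & H)%HO%(cI_otimes HD). exists (g b). apply He. now rewrite fg.
  - intros a (b & H)%HO%(cII_otimes HD). exists (g b). apply He. now rewrite fg.
  - intros a b c H%He H'%He; rewrite !HO. apply (cI_alt HD _ _ _ H H').
  - intros a b c H%He H'%He; rewrite !HO. apply (cII_alt HD _ _ _ H H').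
Qed.

(** * Coordinates in RA2-graphs *)

Section Quotient.
Context {T X : Type} (glue : relation T).

Lemma cls_eq x y : cls glue x = cls glue y <-> clos_refl_sym_trans T glue x y.
Proof.
  split.
  - intros H. apply (f_equal (@proj1_sig _ _)) in H; simpl in H. rewrite H. apply rst_refl.
  - intros H. apply sig_eq; simpl. extensionality z. apply propositional_extensionality.
    split; intros H'; (eapply rst_trans; [| exact H']); auto using rst_sym.
Qed.

Lemma cls_surj (w : quotient glue) : exists x, cls glue x = w.
Proof. destruct w as [P (x & H)]. exists x. now apply sig_eq. Qed.

(** The value at a chosen representative; the choice does not matter once [f] respects [glue]. *)
Definition qlift (f : T -> X) (w : quotient glue) : X :=
  f (proj1_sig (constructive_indefinite_description _ (cls_surj w))).

Lemma qlift_cls f x : (forall y z, glue y z -> f y = f z) -> qlift f (cls glue x) = f x.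
Proof.
  intros H. unfold qlift. destruct (constructive_indefinite_description _ _) as [y S]; simpl.
  apply cls_eq in S. induction S; auto; congruence.
Qed.

End Quotient.

Lemma mem_convex A a b c : mem A a -> mem A c -> a <= b <= c -> mem A b.
Proof. destruct A; simpl; lia. Qed.

Lemma mem_0 A : mem A 0.
Proof. destruct A; simpl; lia. Qed.

(** A vertex of [RA2 A B] is encoded by the principal vertices [(I1, J1)] of its
    I-string and [(I2, J2)] of its II-string. *)
Record coords : Type := Coords { I1 : Z; J1 : Z; I2 : Z; J2 : Z }.

Record valid (A B : index_set) (c : coords) : Prop := {
  valid_I1 : mem A (I1 c);
  valid_I2 : mem A (I2 c);
  valid_J1 : mem B (J1 c);
  valid_J2 : mem B (J2 c);
  valid_sail : I1 c <= I2 c /\ J1 c = J2 c \/ I1 c = I2 c /\ J2 c <= J1 c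
}.

(** The position relative to the principal vertex on the I-string; on the
    II-string it is [- shift c]. *)
Definition shift (c : coords) : Z := I2 c - I1 c + J2 c - J1 c.

Definition sgn (c : color) : Z := match c with c1 => 1 | c2 => - 1 end.

Definition same_string (c : color) (a b : coords) : Prop :=
  match c with
  | c1 => I1 a = I1 b /\ J1 a = J1 b
  | c2 => I2 a = I2 b /\ J2 a = J2 b
  end.

(** * Strings and positions in an RA2-graph *)

Section RA2Coordinates.
Context {A B : index_set}.

(** In a sail, edges of color I keep the second coordinate and edges of color II the first; the
    diagonal vertex with that coordinate is the principal vertex of the string. *)
Definition piece_coords (x : RA2_pieces A B) : coords :=
  match x with
  | inl (existT _ j v) =>
      Coords (snd (proj1_sig v)) (proj1_sig j) (fst (proj1_sig v)) (proj1_sig j)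
  | inr (existT _ i v) =>
      Coords (proj1_sig i) (snd (proj1_sig v)) (proj1_sig i) (fst (proj1_sig v))
  end.

Lemma piece_coords_glue x y : RA2_glue x y -> piece_coords x = piece_coords y.
Proof. now intros [[i Hi] [j Hj]]. Qed.

Lemma piece_coords_valid x : valid A B (piece_coords x).
Proof.
  destruct x as [[[j Hj] [[x y] (H1 & H2 & H3)]] | [[i Hi] [[k l] (H1 & H2 & H3)]]];
    simpl in *; split; simpl; auto.
Qed.

Lemma piece_coords_surj c : valid A B c -> exists x, piece_coords x = c.
Proof.
  destruct c as [i1 j1 i2 j2]; intros [H1 H2 H3 H4 [[H5 H6] | [H5 H6]]]; simpl in *; subst.
  - unshelve eexists (inl (existT _ (exist _ j2 H4) (exist _ (i2, i1) _))); simpl; auto.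
  - unshelve eexists (inr (existT _ (exist _ i2 H2) (exist _ (j2, j1) _))); simpl; auto.
Qed.

Lemma piece_coords_inj x y : piece_coords x = piece_coords y ->
  clos_refl_sym_trans _ (@RA2_glue A B) x y.
Proof.
  (* Vertices of different kinds of sails agree in all coordinates only if both are diagonal, and
     then they are glued. *)
  assert (N : forall (i : idx A) (j : idx B) v w,
    piece_coords (inl (existT _ j v)) = piece_coords (inr (existT _ i w)) ->
    RA2_glue (inl (existT _ j v)) (inr (existT _ i w))).
  { intros [i Hi] [j Hj] [[x' y'] Hv] [[k l] Hw]; simpl; intros [= -> -> -> <-].
    rewrite (@sig_eq _ _ (exist _ (i, i) Hv) (@right_sail_diag A (exist _ i Hi)) eq_refl).
    rewrite (@sig_eq _ _ (exist _ (l, l) Hw) (@left_sail_diag B (exist _ l Hj)) eq_refl).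
    apply RA2_glue_diag. }
  destruct x as [[j v] | [i v]], y as [[j' w] | [i' w]]; intros H.
  - injection H as H1 H2 H3 _. assert (j = j') as -> by now apply sig_eq.
    assert (v = w) as ->; [| apply rst_refl].
    apply sig_eq. destruct v as [[] ?], w as [[] ?]; simpl in *; congruence.
  - now apply rst_step, N.
  - now apply rst_sym, rst_step, N.
  - injection H as H1 H2 _ H3. assert (i = i') as -> by now apply sig_eq.
    assert (v = w) as ->; [| apply rst_refl].
    apply sig_eq. destruct v as [[] ?], w as [[] ?]; simpl in *; congruence.
Qed.

Lemma piece_coords_edge c x y : edge (RA2_pieces A B) c x y ->
  same_string c (piece_coords x) (piece_coords y) /\
  shift (piece_coords y) = shift (piece_coords x) + sgn c.
Proof.
  destruct x as [[j v] | [i v]], y as [[j' w] | [i' w]]; simpl; try easy;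
    intros (k & v' & w' & H & H' & K);
    injection H as <- <-; injection H' as <- <-;
    destruct v as [[] ?], w as [[] ?]; simpl in K; inversion K; subst;
    unfold shift; simpl; lia.
Qed.

Lemma piece_coords_edge_inv c a b : valid A B a -> valid A B b -> same_string c a b ->
  shift b = shift a + sgn c ->
  exists x y, piece_coords x = a /\ piece_coords y = b /\ edge (RA2_pieces A B) c x y.
Proof.
  destruct a as [i1 j1 i2 j2], b as [i1' j1' i2' j2'].
  intros [H1 H2 H3 H4 H5] [H1' H2' H3' H4' H5']; unfold shift; simpl in *; intros S E.
  (* A single step cannot pass from the interior of one sail into the interior of another, so both
     ends lie in a common sail. *)
  assert ((i1 <= i2 /\ i1' <= i2' /\ j1 = j2 /\ j1' = j1 /\ j2' = j1) \/
          (j2 <= j1 /\ j2' <= j1' /\ i1 = i2 /\ i1' = i1 /\ i2' = i1)) as [D | D]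
    by (destruct c; simpl in *; lia).
  - destruct D as (L & L' & -> & -> & ->).
    exists (inl (existT _ (exist _ j2 H4) (exist _ (i2, i1) (conj H2 (conj H1 L))))).
    exists (inl (existT _ (exist _ j2 H4) (exist _ (i2', i1') (conj H2' (conj H1' L'))))).
    repeat split. simpl. do 3 eexists; repeat split. simpl.
    destruct c; simpl in *.
    + replace i1' with i1 by lia. replace i2' with (i2 + 1) by lia. constructor.
    + replace i2' with i2 by lia. replace i1' with (i1 + 1) by lia. constructor.
  - destruct D as (L & L' & -> & -> & ->).
    exists (inr (existT _ (exist _ i2 H2) (exist _ (j2, j1) (conj H4 (conj H3 L))))).
    exists (inr (existT _ (exist _ i2 H2) (exist _ (j2', j1') (conj H4' (conj H3' L'))))).
    repeat split. simpl. do 3 eexists; repeat split. simpl.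
    destruct c; simpl in *.
    + replace j1' with j1 by lia. replace j2' with (j2 + 1) by lia. constructor.
    + replace j2' with j2 by lia. replace j1' with (j1 + 1) by lia. constructor.
Qed.

Definition RA2_coords : RA2 A B -> coords := qlift piece_coords.
Notation kap := RA2_coords.

Lemma RA2_coords_cls x : kap (cls _ x) = piece_coords x.
Proof. apply qlift_cls, piece_coords_glue. Qed.

Lemma RA2_coords_inj w w' : kap w = kap w' -> w = w'.
Proof.
  destruct (cls_surj w) as (x & <-), (cls_surj w') as (y & <-).
  rewrite !RA2_coords_cls; intros H. now apply cls_eq, piece_coords_inj.
Qed.

Lemma RA2_coords_valid w : valid A B (kap w).
Proof.
  destruct (cls_surj w) as (x & <-). rewrite RA2_coords_cls. apply piece_coords_valid.
Qed.

Lemma RA2_coords_surj c : valid A B c -> exists w, kap w = c.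
Proof.
  intros (x & H)%piece_coords_surj. exists (cls _ x). now rewrite RA2_coords_cls.
Qed.

Lemma RA2_edge c w w' : edge (RA2 A B) c w w' <->
  same_string c (kap w) (kap w') /\ shift (kap w') = shift (kap w) + sgn c.
Proof.
  split.
  - intros (x & y & -> & -> & H). rewrite !RA2_coords_cls. now apply piece_coords_edge.
  - intros [S E].
    destruct (piece_coords_edge_inv c (RA2_coords_valid w) (RA2_coords_valid w') S E)
      as (x & y & H1 & H2 & H).
    exists x, y; repeat split; auto; apply RA2_coords_inj; now rewrite RA2_coords_cls.
Qed.

Lemma RA2_coords_principal ij :
  kap (principal ij) = Coords (proj1_sig (fst ij)) (proj1_sig (snd ij))
                              (proj1_sig (fst ij)) (proj1_sig (snd ij)).
Proof.
  destruct ij as [[i Hi] [j Hj]]. unfold principal. now rewrite RA2_coords_cls.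
Qed.

Lemma RA2_otimes_coords w : RA2_otimes w <-> Z.Odd (J1 (kap w) - J2 (kap w)).
Proof.
  split.
  - intros (i & v & H & ->). rewrite RA2_coords_cls. exact H.
  - destruct (cls_surj w) as ([[j v] | [i v]] & <-); rewrite RA2_coords_cls; simpl.
    + intros (k & H); lia.
    + intros H. exists i, v; auto.
Qed.

(** String and shift determine a vertex, and each vertex between two vertices of a string exists
    because index sets are convex. *)
Lemma RA2_walk c n w w' : walk (edge (RA2 A B) c) n w w' <->
  same_string c (kap w) (kap w') /\ shift (kap w') = shift (kap w) + sgn c * Z.of_nat n.
Proof.
  split.
  - revert w; induction n as [|n IH]; intros w; simpl.
    + intros ->; split; [destruct c; simpl; auto | lia].
    + intros (v & [S E]%RA2_edge & [S' E']%IH). split; [| rewrite E', E; destruct c; cbn [sgn]; lia].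
      destruct c; cbn [sgn same_string] in *; lia.
  - revert w; induction n as [|n IH]; intros w [S E].
    + apply RA2_coords_inj. destruct (RA2_coords_valid w), (RA2_coords_valid w').
      unfold shift in E. destruct (kap w) as [i1 j1 i2 j2], (kap w') as [i1' j1' i2' j2'].
      destruct c; simpl in *; f_equal; lia.
    + assert (exists v, edge (RA2 A B) c w v) as (v & H).
      { pose proof (RA2_coords_valid w) as [H1 H2 H3 H4 H5].
        pose proof (RA2_coords_valid w') as [H1' H2' H3' H4' H5'].
        setoid_rewrite RA2_edge. unfold shift in *.
        destruct (kap w) as [i1 j1 i2 j2], (kap w') as [i1' j1' i2' j2']; simpl in *.
        destruct c; simpl in *.
        (* Before its principal vertex an I-string runs in a left sail and raises [J2]; from there
           on it runs in a right sail and raises [I2]. *)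
        - destruct (Z_lt_dec j2 j1).
          + destruct (RA2_coords_surj (c := Coords i1 j1 i2 (j2 + 1))) as (v & Hv).
            { split; simpl; auto; [| lia]. apply (mem_convex B (a := j2) (c := j1)); auto; lia. }
            exists v; rewrite Hv; simpl; lia.
          + destruct (RA2_coords_surj (c := Coords i1 j1 (i2 + 1) j2)) as (v & Hv).
            { split; simpl; auto; [| lia]. apply (mem_convex A (a := i2) (c := i2')); auto; lia. }
            exists v; rewrite Hv; simpl; lia.
        - destruct (Z_lt_dec i1 i2).
          + destruct (RA2_coords_surj (c := Coords (i1 + 1) j1 i2 j2)) as (v & Hv).
            { split; simpl; auto; [| lia]. apply (mem_convex A (a := i1) (c := i2)); auto; lia. }
            exists v; rewrite Hv; simpl; lia.
          + destruct (RA2_coords_surj (c := Coords i1 (j1 + 1) i2 j2)) as (v & Hv).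
            { split; simpl; auto; [| lia]. apply (mem_convex B (a := j1) (c := j1')); auto; lia. }
            exists v; rewrite Hv; simpl; lia. }
      exists v; split; auto. apply IH. apply RA2_edge in H as [S' E'].
      split; destruct c; cbn [sgn same_string] in *; lia.
Qed.

Lemma RA2_star c w w' : star (edge (RA2 A B) c) w w' <->
  same_string c (kap w) (kap w') /\ sgn c * shift (kap w) <= sgn c * shift (kap w').
Proof.
  split.
  - intros (n & [S E]%RA2_walk)%star_walk; split; auto. destruct c; cbn [sgn same_string] in *; lia.
  - intros [S E]. apply (@walk_star _ _ (Z.to_nat (sgn c * (shift (kap w') - shift (kap w))))).
    apply RA2_walk; split; auto. destruct c; cbn [sgn same_string] in *; lia.
Qed.

Lemma RA2_plus_shift c w w' : plus (edge (RA2 A B) c) w w' ->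
  sgn c * shift (kap w) < sgn c * shift (kap w').
Proof.
  induction 1 as [w w' [_ H]%RA2_edge | ]; [| lia]. destruct c; cbn [sgn same_string] in *; lia.
Qed.

Lemma coords_eq c a b : valid A B a -> valid A B b -> same_string c a b ->
  shift a = shift b -> a = b.
Proof.
  intros [] []; destruct a, b; unfold shift; destruct c; simpl in *; intros; f_equal; lia.
Qed.

Lemma RA2_fun c : functional (edge (RA2 A B) c).
Proof.
  intros x y y' [S E]%RA2_edge [S' E']%RA2_edge. apply RA2_coords_inj.
  apply (@coords_eq c); auto using RA2_coords_valid; [destruct c; simpl in *; lia | lia].
Qed.

Lemma RA2_inj c : functional (edge (RA2 A B) c)^t.
Proof.
  intros x y y' [S E]%RA2_edge [S' E']%RA2_edge. apply RA2_coords_inj.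
  apply (@coords_eq c); auto using RA2_coords_valid; [destruct c; simpl in *; lia | lia].
Qed.

(** The vertex number [t] of the [c]-string with principal vertex [(i, j)]. *)
Definition string_pt (c : color) (i j t : Z) : coords :=
  match c with
  | c1 => if 0 <=? t then Coords i j (i + t) j else Coords i j i (j + t)
  | c2 => if t <=? 0 then Coords (i + t) j i j else Coords i (j + t) i j
  end.

Definition at_pos (c : color) (i j t : Z) (w : RA2 A B) : Prop := kap w = string_pt c i j t.

Ltac pt_cases :=
  unfold string_pt in *; repeat match goal with
  | H : context [?x <=? ?y] |- _ => destruct (Z.leb_spec x y)
  | |- context [?x <=? ?y] => destruct (Z.leb_spec x y)
  end; cbn [I1 J1 I2 J2 sgn same_string] in *.

Lemma string_pt_shift c i j t : shift (string_pt c i j t) = sgn c * t.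
Proof. destruct c; pt_cases; unfold shift; cbn [I1 J1 I2 J2]; lia. Qed.

Lemma string_pt_same c i j t t' : same_string c (string_pt c i j t) (string_pt c i j t').
Proof. destruct c; pt_cases; auto. Qed.

Lemma string_pt_inj c i j t i' j' t' : string_pt c i j t = string_pt c i' j' t' ->
  i = i' /\ j = j' /\ t = t'.
Proof. destruct c; pt_cases; intros [=]; lia. Qed.

(** The sign of [sgn c * t] tells the sail: positive for the part of the string in a right sail,
    negative for the part in a left sail. *)
Definition pt_in_range (c : color) (i j t : Z) : Prop :=
  mem A i /\ mem B j /\ (0 < sgn c * t -> mem A (i + t)) /\ (sgn c * t < 0 -> mem B (j + t)).

Lemma string_pt_valid c i j t : valid A B (string_pt c i j t) <-> pt_in_range c i j t.
Proof.
  unfold pt_in_range. destruct (Z.eq_dec t 0) as [-> | N].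
  - rewrite !Z.add_0_r, Z.mul_0_r. split.
    + intros [H1 H2 H3 H4 _]; destruct c; simpl in *; rewrite ?Z.add_0_r in *; auto.
    + intros (H1 & H2 & _); destruct c; simpl; rewrite ?Z.add_0_r; split; simpl; auto; lia.
  - split.
    + intros [H1 H2 H3 H4 _]. destruct c; pt_cases; repeat split; auto; lia.
    + intros (H1 & H2 & H3 & H4). destruct c; pt_cases; split; cbn [I1 J1 I2 J2]; auto;
        (apply H3 + apply H4 + idtac); lia.
Qed.

Lemma at_pos_any c w : exists i j t, at_pos c i j t w.
Proof.
  pose proof (RA2_coords_valid w) as [_ _ _ _ H]. unfold at_pos.
  destruct (kap w) as [i1 j1 i2 j2]; simpl in *. destruct c.
  - exists i1, j1, (i2 - i1 + j2 - j1). pt_cases; f_equal; lia.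
  - exists i2, j2, (i1 - i2 + j1 - j2). pt_cases; f_equal; lia.
Qed.

Lemma at_pos_range c i j t w : at_pos c i j t w -> pt_in_range c i j t.
Proof. intros H. apply string_pt_valid. rewrite <- H. apply RA2_coords_valid. Qed.

Lemma at_pos_exists c i j t : pt_in_range c i j t -> exists w, at_pos c i j t w.
Proof. intros H%string_pt_valid%RA2_coords_surj. exact H. Qed.

Lemma at_pos_inj c i j t i' j' t' w : at_pos c i j t w -> at_pos c i' j' t' w ->
  i = i' /\ j = j' /\ t = t'.
Proof. unfold at_pos; intros ->; apply string_pt_inj. Qed.

Lemma at_pos_fun c i j t w w' : at_pos c i j t w -> at_pos c i j t w' -> w = w'.
Proof. intros H H'. apply RA2_coords_inj. now rewrite H, H'. Qed.

Lemma at_pos_edge c i j t t' w w' : at_pos c i j t w -> at_pos c i j t' w' ->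
  edge (RA2 A B) c w w' <-> t' = t + 1.
Proof.
  intros H H'. rewrite RA2_edge, H, H', !string_pt_shift. split.
  - intros [_ E]; destruct c; cbn [sgn] in *; lia.
  - intros ->; split; [apply string_pt_same | destruct c; cbn [sgn]; lia].
Qed.

Lemma at_pos_star c i j t t' w w' : at_pos c i j t w -> at_pos c i j t' w' ->
  star (edge (RA2 A B) c) w w' <-> t <= t'.
Proof.
  intros H H'. rewrite RA2_star, H, H', !string_pt_shift. split.
  - intros [_ E]; destruct c; cbn [sgn] in *; lia.
  - intros L; split; [apply string_pt_same | destruct c; cbn [sgn]; lia].
Qed.

Lemma at_pos_same c i j t w w' : at_pos c i j t w -> same_string c (kap w) (kap w') ->
  exists t', at_pos c i j t' w'.
Proof.
  intros H S. destruct (at_pos_any c w') as (i' & j' & t' & H').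
  unfold at_pos in *. rewrite H, H' in S. exists t'. rewrite H'.
  destruct c; pt_cases; f_equal; lia.
Qed.

Lemma at_pos_next c i j t w w' : at_pos c i j t w -> edge (RA2 A B) c w w' ->
  at_pos c i j (t + 1) w'.
Proof.
  intros H H'. destruct (at_pos_same w' H (proj1 (proj1 (RA2_edge _ _ _) H'))) as (t' & K).
  rewrite (at_pos_edge H K) in H'. now subst.
Qed.

Lemma at_pos_star_from c i j t w w' : at_pos c i j t w -> star (edge (RA2 A B) c) w w' ->
  exists t', t <= t' /\ at_pos c i j t' w'.
Proof.
  intros H H'. destruct (at_pos_same w' H (proj1 (proj1 (RA2_star _ _ _) H'))) as (t' & K).
  rewrite (at_pos_star H K) in H'. eauto.
Qed.

Lemma at_pos_otimes c i j t w : at_pos c i j t w ->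
  RA2_otimes w <-> sgn c * t < 0 /\ Z.Odd t.
Proof.
  intros H. rewrite RA2_otimes_coords, H. unfold Z.Odd. destruct c; pt_cases; split.
  all: first [intros (L & m & E) | intros (m & E); split; [lia |]]; try lia.
  all: (exists (- m - 1) + exists m); lia.
Qed.

Lemma at_pos_both w w' : same_string c1 (kap w) (kap w') -> same_string c2 (kap w) (kap w') -> w = w'.
Proof.
  intros S S'. apply RA2_coords_inj. destruct (kap w), (kap w'); simpl in *; f_equal; lia.
Qed.

Lemma same_string_sym c a b : same_string c a b -> same_string c b a.
Proof. destruct c; simpl; intros []; auto. Qed.

Lemma at_pos_principal c (ij : idx A * idx B) :
  at_pos c (proj1_sig (fst ij)) (proj1_sig (snd ij)) 0 (principal ij).
Proof. unfold at_pos. rewrite RA2_coords_principal. destruct c; simpl; now rewrite Z.add_0_r. Qed.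

Lemma position_at_pos c (ij : idx A * idx B) t w :
  position (edge (RA2 A B) c) (principal ij) t w <->
  at_pos c (proj1_sig (fst ij)) (proj1_sig (snd ij)) t w.
Proof.
  pose proof (at_pos_principal c ij) as P. unfold position. rewrite !RA2_walk. split.
  - intros H. assert (S : same_string c (kap (principal ij)) (kap w))
      by (destruct H as [[_ [S _]] | [_ [S _]]]; auto using same_string_sym).
    destruct (at_pos_same w P S) as (t' & Q). rewrite P, Q, !string_pt_shift in H.
    enough (t = t') by now subst. destruct c; cbn [sgn] in H; lia.
  - intros Q. rewrite P, Q, !string_pt_shift.
    destruct (Z_le_gt_dec 0 t); [left | right];
      (split; [lia | split; [apply string_pt_same | destruct c; cbn [sgn]; lia]]).
Qed.

(** The otimes-vertices of a string are its odd positions on one side of the principal vertex,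
    before it for color I and after it for color II; this gives separation, alternation and the
    required neighbours. [c_meet] holds since the two strings of a vertex determine it. *)
Lemma RA2_central_like :
  central_like (edge (RA2 A B) c1) (edge (RA2 A B) c2) RA2_otimes.
Proof.
  split; try apply RA2_fun; try apply RA2_inj.
  - intros a H%RA2_plus_shift. lia.
  - intros a H%RA2_plus_shift. lia.
  - intros a b [S _]%RA2_star [S' _]%RA2_star. apply at_pos_both; auto using same_string_sym.
  - intros a b H Oa Ob. destruct (at_pos_any c1 a) as (i & j & t & P).
    pose proof (at_pos_next P H) as Q. apply (at_pos_otimes P) in Oa.
    apply (at_pos_otimes Q) in Ob. destruct Oa as [_ (m & ?)], Ob as [_ (n & ?)]. lia.
  - intros a b H Oa Ob. destruct (at_pos_any c2 a) as (i & j & t & P).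
    pose proof (at_pos_next P H) as Q. apply (at_pos_otimes P) in Oa.
    apply (at_pos_otimes Q) in Ob. destruct Oa as [_ (m & ?)], Ob as [_ (n & ?)]. lia.
  - intros a Oa. destruct (at_pos_any c1 a) as (i & j & t & P).
    apply (at_pos_otimes P) in Oa. destruct Oa as [L _].
    destruct (at_pos_range P) as (H1 & H2 & _ & H4). cbn [sgn] in *.
    destruct (@at_pos_exists c1 i j (t + 1)) as (b & Q).
    { repeat split; auto; cbn [sgn]; intros; [lia |].
      eapply mem_convex; [apply H4 | exact H2 |]; lia. }
    exists b. now apply (at_pos_edge P Q).
  - intros b Ob. destruct (at_pos_any c2 b) as (i & j & t & P).
    apply (at_pos_otimes P) in Ob. destruct Ob as [L _].
    destruct (at_pos_range P) as (H1 & H2 & _ & H4). cbn [sgn] in *.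
    destruct (@at_pos_exists c2 i j (t - 1)) as (a & Q).
    { repeat split; auto; cbn [sgn]; intros; [lia |].
      eapply mem_convex; [exact H2 | apply H4 |]; lia. }
    exists a. apply (at_pos_edge Q P). lia.
  - intros a b d H H' Od. destruct (at_pos_any c1 a) as (i & j & t & P).
    pose proof (at_pos_next P H) as Q. pose proof (at_pos_next Q H') as R.
    apply (at_pos_otimes R) in Od. apply (at_pos_otimes P). cbn [sgn] in *.
    destruct Od as [L (m & E)]. split; [lia | exists (m - 1); lia].
  - intros a b d H H' Oa. destruct (at_pos_any c2 a) as (i & j & t & P).
    pose proof (at_pos_next P H) as Q. pose proof (at_pos_next Q H') as R.
    apply (at_pos_otimes P) in Oa. apply (at_pos_otimes R). cbn [sgn] in *.
    destruct Oa as [L (m & E)]. split; [lia | exists (m + 1); lia].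
Qed.

End RA2Coordinates.

(** * S-graphs *)

Definition enumerates (P : Z -> Prop) (l : list Z) : Prop := NoDup l /\ forall x, In x l <-> P x.

Lemma card_spec P : (exists n, has_card P n) -> has_card P (card P).
Proof. apply epsilon_spec. Qed.

Lemma card_interval P lo hi : (forall k, P k <-> lo <= k < hi) ->
  card P = Some (Z.to_nat (hi - lo)).
Proof.
  intros HP. set (l := map (fun n => lo + Z.of_nat n) (seq 0 (Z.to_nat (hi - lo)))).
  assert (Hl : enumerates P l).
  { split.
    - apply FinFun.Injective_map_NoDup; [intros x y; lia | apply seq_NoDup].
    - intros x. unfold l. rewrite in_map_iff, HP. setoid_rewrite in_seq. split.
      + intros (n & <- & L); lia.
      + intros L. exists (Z.to_nat (x - lo)); lia. }
  assert (len : length l = Z.to_nat (hi - lo)) by (unfold l; now rewrite length_map, length_seq).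
  (* As [card] is a choice, its value is compared with the length of the explicit list [l]. *)
  assert (H : has_card P (card P)) by (apply card_spec; exists (Some (length l)), l; auto).
  destruct (card P) as [n|]; [| destruct H; exists l; exact Hl].
  destruct H as (l' & [D I] & <-). destruct Hl as [D' I']. rewrite <- len. f_equal.
  apply Nat.le_antisymm; apply NoDup_incl_length; auto; intros x; rewrite I, I'; auto.
Qed.

Arguments card_interval {P} lo hi _.

Lemma card_infinite P : (forall l, (forall x, In x l -> P x) -> exists k, P k /\ ~ In k l) ->
  card P = None.
Proof.
  intros HP. assert (N : ~ exists l, enumerates P l).
  { intros (l & _ & H). destruct (HP l) as (k & K & K'); [apply H | apply K', H, K]. }
  assert (H : has_card P (card P)) by (apply card_spec; exists None; exact N).
  destruct (card P) as [n|]; auto. destruct H as (l & H & _). destruct N; exists l; exact H.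
Qed.

Lemma list_bounded (l : list Z) : exists m, forall x, In x l -> - m < x < m.
Proof.
  induction l as [|a l (m & IH)]; [exists 0; easy |].
  exists (Z.max m (Z.abs a + 1)). intros x [<- | H]; [lia |]. specialize (IH x H); lia.
Qed.

(** An index set is an interval, so at least [t] of its elements lie below [i] exactly when [i - t]
    is one of them. This turns sizes of B-sails into positions on strings. *)
Lemma Zle_below A i t : mem A i -> Zle_enat t (below A i) <-> (0 < t -> mem A (i - t)).
Proof.
  intros Hi. unfold below.
  assert (inf : (forall k, k <= i -> mem A k) -> card (fun k => mem A k /\ k < i) = None).
  { intros H. apply card_infinite. intros l _. destruct (list_bounded l) as (m & Hm).
    exists (Z.min (i - 1) (- m)). split; [split; [apply H |]; lia |].
    intros K%Hm; lia. }
  destruct A as [a | | |]; simpl in *.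
  - rewrite (card_interval (0) (i)) by (intros; lia). cbn [Zle_enat]. lia.
  - rewrite (card_interval (0) (i)) by (intros; lia). cbn [Zle_enat]. lia.
  - rewrite inf; simpl; intros; lia.
  - rewrite inf; simpl; tauto.
Qed.

Lemma Zle_above A i t : mem A i -> Zle_enat t (above A i) <-> (0 < t -> mem A (i + t)).
Proof.
  intros Hi. unfold above.
  assert (inf : (forall k, i <= k -> mem A k) -> card (fun k => mem A k /\ k > i) = None).
  { intros H. apply card_infinite. intros l _. destruct (list_bounded l) as (m & Hm).
    exists (Z.max (i + 1) m). split; [split; [apply H |]; lia |].
    intros K%Hm; lia. }
  destruct A as [a | | |]; simpl in *.
  - rewrite (card_interval (i + 1) (Z.of_nat a + 1)) by (intros; lia). cbn [Zle_enat]. lia.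
  - rewrite inf; simpl; intros; lia.
  - rewrite (card_interval (i + 1) (1)) by (intros; lia). cbn [Zle_enat]. lia.
  - rewrite inf; simpl; tauto.
Qed.

(** The position of the diagonal vertex that begins the 2-string through a vertex
    of a left B-sail with first (doubled) coordinate [x]. *)
Definition left_column (x : Z) : Z := if x <=? 0 then x / 2 else x.

Definition right_column (x : Z) : Z := if x <=? 0 then x else x / 2.

Lemma left_column_even p : left_column (2 * p) = if p <=? 0 then p else 2 * p.
Proof.
  unfold left_column. destruct (Z.leb_spec (2 * p) 0), (Z.leb_spec p 0); try lia.
  rewrite Z.mul_comm. now apply Z.div_mul.
Qed.

Lemma right_column_even p : right_column (2 * p) = if p <=? 0 then 2 * p else p.
Proof.
  unfold right_column. destruct (Z.leb_spec (2 * p) 0), (Z.leb_spec p 0); try lia.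
  rewrite Z.mul_comm. now apply Z.div_mul.
Qed.

Lemma left_Bsail_vertex_inv r m x q : left_Bsail_vertex r m (x, q) ->
  (exists p, x = 2 * p /\ Zle_enat (- p) r /\ p <= q /\ Zle_enat q m /\ 2 * p <= q) \/
  (exists k, x = 2 * k + 1 /\ q = 2 * k + 1 /\ 0 <= k /\ Zle_enat (2 * k + 1) m).
Proof.
  intros H. remember (x, q) as v eqn:E.
  destruct H as [p s | k]; injection E as <- <-; [left; exists p | right; exists k]; auto.
Qed.

Lemma right_Bsail_vertex_inv n q x s : right_Bsail_vertex n q (x, s) ->
  (exists p, x = 2 * p /\ Zle_enat (- s) n /\ s <= p /\ Zle_enat p q /\ s <= 2 * p) \/
  (exists k, x = - 2 * k - 1 /\ s = - 2 * k - 1 /\ 0 <= k /\ Zle_enat (2 * k + 1) n).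
Proof.
  intros H. remember (x, s) as v eqn:E.
  destruct H as [p t | k]; injection E as <- <-; [left; exists p | right; exists k]; auto.
Qed.

(** * The gluing of the B-sails in coordinates *)

Section SGraph.
Context {A B : index_set}.
Notation C := (RA2 A B).

(** [s] is the vertex [v] of the left, resp. right, B-sail attached to the string
    with principal vertex [(i, j)]. *)
Definition left_at (i j : Z) (v : Z * Z) (s : S_pieces A B) : Prop :=
  exists ij d, s = inr (inl (existT _ ij d)) /\
    proj1_sig (fst ij) = i /\ proj1_sig (snd ij) = j /\ proj1_sig d = v.

Definition right_at (i j : Z) (v : Z * Z) (s : S_pieces A B) : Prop :=
  exists ij d, s = inr (inr (existT _ ij d)) /\
    proj1_sig (fst ij) = i /\ proj1_sig (snd ij) = j /\ proj1_sig d = v.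

Lemma left_at_intro i j v : mem A i -> mem B j -> left_Bsail_vertex (below A i) (above B j) v ->
  exists s, left_at i j v s.
Proof.
  intros Hi Hj H.
  exists (inr (inl (existT (@left_Bsail_at A B) (exist _ i Hi, exist _ j Hj) (exist _ v H)))).
  do 2 eexists; repeat split.
Qed.

Lemma right_at_intro i j v : mem A i -> mem B j -> right_Bsail_vertex (below B j) (above A i) v ->
  exists s, right_at i j v s.
Proof.
  intros Hi Hj H.
  exists (inr (inr (existT (@right_Bsail_at A B) (exist _ i Hi, exist _ j Hj) (exist _ v H)))).
  do 2 eexists; repeat split.
Qed.

Lemma idx_pair_eq (ij ij' : idx A * idx B) : proj1_sig (fst ij) = proj1_sig (fst ij') ->
  proj1_sig (snd ij) = proj1_sig (snd ij') -> ij = ij'.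
Proof. destruct ij, ij'; simpl; intros E%sig_eq E'%sig_eq; congruence. Qed.

Lemma left_at_fun i j v s s' : left_at i j v s -> left_at i j v s' -> s = s'.
Proof.
  intros (ij & d & -> & H1 & H2 & H3) (ij' & d' & -> & H1' & H2' & H3').
  assert (ij = ij') as -> by (apply idx_pair_eq; congruence).
  do 3 f_equal. apply sig_eq; congruence.
Qed.

Lemma right_at_fun i j v s s' : right_at i j v s -> right_at i j v s' -> s = s'.
Proof.
  intros (ij & d & -> & H1 & H2 & H3) (ij' & d' & -> & H1' & H2' & H3').
  assert (ij = ij') as -> by (apply idx_pair_eq; congruence).
  do 3 f_equal. apply sig_eq; congruence.
Qed.

Lemma S_pieces_cases s : (exists w, s = inl w) \/
  (exists i j v, left_at i j v s) \/ (exists i j v, right_at i j v s).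
Proof.
  destruct s as [w | [[ij d] | [ij d]]]; eauto; right; [left | right];
    do 3 eexists; do 2 eexists; repeat split.
Qed.

Lemma S_pieces_edge k s s' : edge (S_pieces A B) k s s' <->
  (exists i j v v', left_at i j v s /\ left_at i j v' s' /\ left_Bsail_edge k v v') \/
  (exists i j v v', right_at i j v s /\ right_at i j v' s' /\ right_Bsail_edge k v v').
Proof.
  split.
  - destruct s as [w | [[ij d] | [ij d]]], s' as [w' | [[ij' d'] | [ij' d']]]; simpl; try easy;
      intros (kl & e & e' & H & H' & K);
      injection H as -> H; injection H' as -> H';
      apply inj_pair2 in H, H'; subst;
      [left | right]; do 4 eexists; (split; [| split; [| exact K]]);
      do 2 eexists; repeat split.
  - intros [(i & j & v & v' & (ij & d & -> & H1 & H2 & H3) & (ij' & d' & -> & H1' & H2' & H3') & K) |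
            (i & j & v & v' & (ij & d & -> & H1 & H2 & H3) & (ij' & d' & -> & H1' & H2' & H3') & K)];
      assert (ij = ij') as -> by (apply idx_pair_eq; congruence); simpl;
      do 3 eexists; repeat split; simpl; congruence.
Qed.

Lemma left_at_mem i j v s : left_at i j v s ->
  mem A i /\ mem B j /\ left_Bsail_vertex (below A i) (above B j) v.
Proof.
  intros ([[i' Hi] [j' Hj]] & [v' Hv] & _ & H1 & H2 & H3); simpl in *; subst; auto.
Qed.

Lemma right_at_mem i j v s : right_at i j v s ->
  mem A i /\ mem B j /\ right_Bsail_vertex (below B j) (above A i) v.
Proof.
  intros ([[i' Hi] [j' Hj]] & [v' Hv] & _ & H1 & H2 & H3); simpl in *; subst; auto.
Qed.

(** The principal vertex [(0, 0)] only shows that the type is inhabited; the value is meaningful for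
    positions in range. *)
Definition RA2_at (c : color) (i j t : Z) : C :=
  epsilon (inhabits (principal (exist _ 0 (mem_0 A), exist _ 0 (mem_0 B)))) (at_pos c i j t).

(** The pair of [alpha] and [beta]: the diagonal points in which the column and the row of a vertex
    of a B-sail meet the diagonal. A half-integer point lies on the diagonal and gets two equal
    components. *)
Definition S_pair (s : S_pieces A B) : C * C :=
  match s with
  | inl w => (w, w)
  | inr (inl (existT _ ij d)) =>
      let i := proj1_sig (fst ij) in let j := proj1_sig (snd ij) in
      (RA2_at c2 i j (left_column (fst (proj1_sig d))), RA2_at c2 i j (snd (proj1_sig d)))
  | inr (inr (existT _ ij d)) =>
      let i := proj1_sig (fst ij) in let j := proj1_sig (snd ij) in
      (RA2_at c1 i j (right_column (fst (proj1_sig d))), RA2_at c1 i j (snd (proj1_sig d)))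
  end.

Lemma RA2_at_spec c i j t : pt_in_range (A := A) (B := B) c i j t -> at_pos c i j t (RA2_at c i j t).
Proof. intros H%at_pos_exists. exact (epsilon_spec _ _ H). Qed.

Lemma S_pair_left i j x q s : left_at i j (x, q) s ->
  at_pos c2 i j (left_column x) (fst (S_pair s)) /\ at_pos c2 i j q (snd (S_pair s)).
Proof.
  intros H. destruct (left_at_mem H) as (Hi & Hj & V).
  destruct H as (ij & d & -> & H1 & H2 & H3). unfold S_pair. rewrite H3, H1, H2; simpl.
  enough (pt_in_range (A := A) (B := B) c2 i j (left_column x) /\
          pt_in_range (A := A) (B := B) c2 i j q)
    by (split; apply RA2_at_spec; tauto).
  clear H1 H2 H3; unfold pt_in_range. cbn [sgn].
  destruct (left_Bsail_vertex_inv V) as [(p & -> & V1 & V2 & V3 & V4) | (k & -> & -> & V1 & V2)].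
  - rewrite Zle_below in V1 by auto. rewrite Zle_above in V3 by auto.
    rewrite Z.sub_opp_r in V1.
    rewrite left_column_even. destruct (Z.leb_spec p 0).
    + repeat split; auto; intros; try lia; try (apply V1; lia); try (apply V3; lia).
      eapply mem_convex; [apply V1 | exact Hi |]; lia.
    + repeat split; auto; intros; try lia; try (apply V1; lia); try (apply V3; lia).
      eapply mem_convex; [exact Hj | apply V3 |]; lia.
  - rewrite Zle_above in V2 by auto. unfold left_column.
    destruct (Z.leb_spec (2 * k + 1) 0); [lia |].
    repeat split; auto; intros; try lia; apply V2; lia.
Qed.

Lemma S_pair_right i j x s0 s : right_at i j (x, s0) s ->
  at_pos c1 i j (right_column x) (fst (S_pair s)) /\ at_pos c1 i j s0 (snd (S_pair s)).
Proof.
  intros H. destruct (right_at_mem H) as (Hi & Hj & V).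
  destruct H as (ij & d & -> & H1 & H2 & H3). unfold S_pair. rewrite H3, H1, H2; simpl.
  enough (pt_in_range (A := A) (B := B) c1 i j (right_column x) /\
          pt_in_range (A := A) (B := B) c1 i j s0)
    by (split; apply RA2_at_spec; tauto).
  clear H1 H2 H3; unfold pt_in_range. cbn [sgn].
  destruct (right_Bsail_vertex_inv V) as [(p & -> & V1 & V2 & V3 & V4) | (k & -> & -> & V1 & V2)].
  - rewrite Zle_below in V1 by auto. rewrite Zle_above in V3 by auto.
    rewrite Z.sub_opp_r in V1.
    rewrite right_column_even. destruct (Z.leb_spec p 0).
    + repeat split; auto; intros; try lia; try (apply V1; lia); try (apply V3; lia).
      eapply mem_convex; [apply V1 | exact Hj |]; lia.
    + repeat split; auto; intros; try lia; try (apply V1; lia); try (apply V3; lia).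
      eapply mem_convex; [exact Hi | apply V3 |]; lia.
  - rewrite Zle_below in V2 by auto. unfold right_column.
    destruct (Z.leb_spec (- 2 * k - 1) 0); [| lia].
    replace (j + (- 2 * k - 1)) with (j - (2 * k + 1)) by lia.
    repeat split; auto; intros; try lia; apply V2; lia.
Qed.

Lemma left_column_diag t : left_column (fst (left_Bsail_diag t)) = t.
Proof.
  unfold left_Bsail_diag; cbn [fst]. destruct (Z.leb_spec t 0).
  - rewrite left_column_even. destruct (Z.leb_spec t 0); lia.
  - unfold left_column. destruct (Z.leb_spec t 0); lia.
Qed.

Lemma right_column_diag t : right_column (fst (right_Bsail_diag t)) = t.
Proof.
  unfold right_Bsail_diag; cbn [fst]. destruct (Z.leb_spec t 0).
  - unfold right_column. destruct (Z.leb_spec t 0); lia.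
  - rewrite right_column_even. destruct (Z.leb_spec t 0); lia.
Qed.

(** The diagonal vertex number [t] has both its column and its row at position [t], so both
    components are the point it is glued to. *)
Lemma S_pair_glue s s' : S_glue s s' -> S_pair s = S_pair s'.
Proof.
  intros [ij t w d P E | ij t w d P E]; apply position_at_pos in P.
  - destruct (@S_pair_left (proj1_sig (fst ij)) (proj1_sig (snd ij)) (fst (left_Bsail_diag t)) t
      (inr (inl (existT _ ij d)))) as [H H'].
    { do 2 eexists; repeat split. exact E. }
    rewrite left_column_diag in H. apply injective_projections; [exact (at_pos_fun P H) | exact (at_pos_fun P H')].
  - destruct (@S_pair_right (proj1_sig (fst ij)) (proj1_sig (snd ij)) (fst (right_Bsail_diag t)) t
      (inr (inr (existT _ ij d)))) as [H H'].
    { do 2 eexists; repeat split. exact E. }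
    rewrite right_column_diag in H. apply injective_projections; [exact (at_pos_fun P H) | exact (at_pos_fun P H')].
Qed.

(** Nonpositive first coordinates are even, so halving them loses nothing, and positive ones are
    kept. *)
Lemma left_column_inj r m x q x' q' : left_Bsail_vertex r m (x, q) ->
  left_Bsail_vertex r m (x', q') -> left_column x = left_column x' -> x = x'.
Proof.
  intros V V' E.
  assert (U : forall x q, left_Bsail_vertex r m (x, q) -> 0 < x \/ exists p, x = 2 * p).
  { intros y u [(p & -> & _) | (k & -> & _ & ? & _)]%left_Bsail_vertex_inv; [right; eauto | left; lia]. }
  apply U in V, V'. unfold left_column in E.
  destruct (Z.leb_spec x 0), (Z.leb_spec x' 0); auto;
    destruct V as [|(p & ->)], V' as [|(p' & ->)]; try lia;
    repeat rewrite ?(Z.mul_comm 2), ?Z.div_mul in E by lia; lia.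
Qed.

Lemma right_column_inj r m x q x' q' : right_Bsail_vertex r m (x, q) ->
  right_Bsail_vertex r m (x', q') -> right_column x = right_column x' -> x = x'.
Proof.
  intros V V' E.
  assert (U : forall x q, right_Bsail_vertex r m (x, q) -> x < 0 \/ exists p, x = 2 * p).
  { intros y u [(p & -> & _) | (k & -> & _ & ? & _)]%right_Bsail_vertex_inv; [right; eauto | left; lia]. }
  apply U in V, V'. unfold right_column in E.
  destruct (Z.leb_spec x 0), (Z.leb_spec x' 0); auto;
    destruct V as [|(p & ->)], V' as [|(p' & ->)]; try lia;
    repeat rewrite ?(Z.mul_comm 2), ?Z.div_mul in E by lia; lia.
Qed.

Lemma S_piece_diagonal s w : S_pair s = (w, w) -> clos_refl_sym_trans _ (@S_glue A B) (inl w) s.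
Proof.
  intros E. destruct (S_pieces_cases s) as [(w' & ->) | [(i & j & [x q] & H) | (i & j & [x q] & H)]].
  - injection E as ->. apply rst_refl.
  - destruct (S_pair_left H) as [H1 H2]. rewrite E in H1, H2; simpl in *.
    destruct (at_pos_inj H1 H2) as (_ & _ & Eq).
    assert (x = fst (left_Bsail_diag q)) as ->.
    { destruct (left_at_mem H) as (_ & _ & V). unfold left_Bsail_diag; cbn [fst].
      destruct (left_Bsail_vertex_inv V) as [(p & -> & _ & V2 & _ & V4) | (k & -> & -> & V1 & _)];
        [| destruct (Z.leb_spec (2 * k + 1) 0); lia].
      rewrite left_column_even in Eq. destruct (Z.leb_spec p 0), (Z.leb_spec q 0); lia. }
    destruct H as (ij & d & -> & <- & <- & H3). apply rst_step.
    apply S_glue_II with (t := q); [now apply position_at_pos | exact H3].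
  - destruct (S_pair_right H) as [H1 H2]. rewrite E in H1, H2; simpl in *.
    destruct (at_pos_inj H1 H2) as (_ & _ & Eq).
    assert (x = fst (right_Bsail_diag q)) as ->.
    { destruct (right_at_mem H) as (_ & _ & V). unfold right_Bsail_diag; cbn [fst].
      destruct (right_Bsail_vertex_inv V) as [(p & -> & _ & V2 & _ & V4) | (k & -> & -> & V1 & _)];
        [| destruct (Z.leb_spec (- 2 * k - 1) 0); lia].
      rewrite right_column_even in Eq. destruct (Z.leb_spec p 0), (Z.leb_spec q 0); lia. }
    destruct H as (ij & d & -> & <- & <- & H3). apply rst_step.
    apply S_glue_I with (t := q); [now apply position_at_pos | exact H3].
Qed.

Lemma at_pos_same_string c i j t t' (w w' : C) : at_pos c i j t w -> at_pos c i j t' w' ->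
  same_string c (RA2_coords w) (RA2_coords w').
Proof. intros -> ->. apply string_pt_same. Qed.

Lemma S_pair_inj s s' : S_pair s = S_pair s' -> clos_refl_sym_trans _ (@S_glue A B) s s'.
Proof.
  destruct (S_pair s) as [a b] eqn:E; intros E'; symmetry in E'.
  destruct (excluded_middle_informative (a = b)) as [<- | N].
  { apply S_piece_diagonal in E, E'. eapply rst_trans; [apply rst_sym |]; eassumption. }
  (* A pair realized in a left and in a right B-sail has its components on a common II-string and on
     a common I-string, hence equal. *)
  assert (cross : forall i j v i' j' v' s s', left_at i j v s -> right_at i' j' v' s' ->
    S_pair s = (a, b) -> S_pair s' = (a, b) -> False).
  { clear s s' E E'. intros i j [x q] i' j' [x' q'] s s' H H' E E'. apply N.
    destruct (S_pair_left H) as [H1 H2], (S_pair_right H') as [H1' H2'].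
    rewrite E in H1, H2. rewrite E' in H1', H2'.
    apply at_pos_both; eapply at_pos_same_string; eauto. }
  destruct (S_pieces_cases s) as [(w & ->) | [(i & j & [x q] & H) | (i & j & [x q] & H)]],
    (S_pieces_cases s') as [(w' & ->) | [(i' & j' & [x' q'] & H') | (i' & j' & [x' q'] & H')]];
    try (simpl in E; congruence); try (simpl in E'; congruence);
    try (exfalso; eauto; fail).
  - destruct (S_pair_left H) as [H1 H2], (S_pair_left H') as [H1' H2'].
    rewrite E in H1, H2. rewrite E' in H1', H2'.
    destruct (at_pos_inj H1 H1') as (<- & <- & K), (at_pos_inj H2 H2') as (_ & _ & <-).
    assert (x = x') as <- by (eapply left_column_inj; eauto; eapply left_at_mem; eauto).
    rewrite (left_at_fun H H'). apply rst_refl.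
  - destruct (S_pair_right H) as [H1 H2], (S_pair_right H') as [H1' H2'].
    rewrite E in H1, H2. rewrite E' in H1', H2'.
    destruct (at_pos_inj H1 H1') as (<- & <- & K), (at_pos_inj H2 H2') as (_ & _ & <-).
    assert (x = x') as <- by (eapply right_column_inj; eauto; eapply right_at_mem; eauto).
    rewrite (right_at_fun H H'). apply rst_refl.
Qed.

End SGraph.

(** * S-graphs are represented over their RA2-graphs *)

Section SGraphRepresents.
Context {A B : index_set}.
Notation C := (RA2 A B).
Notation eI := (edge C c1).
Notation eII := (edge C c2).
Notation O := (@RA2_otimes A B).

Definition S_image (w : S_with_halves A B) : C * C := qlift S_pair w.

Lemma S_image_cls s : S_image (cls _ s) = S_pair s.
Proof. apply qlift_cls, S_pair_glue. Qed.

Lemma S_image_inj w w' : S_image w = S_image w' -> w = w'.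
Proof.
  destruct (cls_surj w) as (s & <-), (cls_surj w') as (s' & <-).
  rewrite !S_image_cls. intros H. now apply cls_eq, S_pair_inj.
Qed.

Lemma S_otimes_image w : S_otimes w <-> exists o, O o /\ S_image w = (o, o).
Proof.
  split; intros (o & H & E); exists o; split; auto.
  - rewrite E. apply S_image_cls.
  - apply S_image_inj. rewrite E. symmetry; apply S_image_cls.
Qed.

(** Integer columns sit at nonpositive or at even positions, which are ordinary; only half-integer
    points, which are diagonal, have an otimes-vertex as first component. *)
Lemma left_at_image i j v s : left_at i j v s ->
  star eII (fst (S_pair s)) (snd (S_pair s)) /\
  (O (fst (S_pair s)) -> fst (S_pair s) = snd (S_pair s)).
Proof.
  destruct v as [x q]; intros H. destruct (S_pair_left H) as [H1 H2].
  destruct (left_at_mem H) as (_ & _ & V).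
  apply left_Bsail_vertex_inv in V as [(p & -> & _ & V2 & _ & V4) | (k & -> & -> & V1 & _)].
  - rewrite (at_pos_star H1 H2), (at_pos_otimes H1), left_column_even; cbn [sgn].
    split; [destruct (Z.leb_spec p 0); lia |].
    intros [L (m & E)]; destruct (Z.leb_spec p 0); lia.
  - unfold left_column in H1. destruct (Z.leb_spec (2 * k + 1) 0); [lia |].
    rewrite (at_pos_fun H1 H2). split; auto. apply rt_refl.
Qed.

Lemma right_at_image i j v s : right_at i j v s ->
  star eI (snd (S_pair s)) (fst (S_pair s)) /\
  (O (fst (S_pair s)) -> fst (S_pair s) = snd (S_pair s)).
Proof.
  destruct v as [x q]; intros H. destruct (S_pair_right H) as [H1 H2].
  destruct (right_at_mem H) as (_ & _ & V).
  apply right_Bsail_vertex_inv in V as [(p & -> & _ & V2 & _ & V4) | (k & -> & -> & V1 & _)].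
  - rewrite (at_pos_star H2 H1), (at_pos_otimes H1), right_column_even; cbn [sgn].
    split; [destruct (Z.leb_spec p 0); lia |].
    intros [L (m & E)]; destruct (Z.leb_spec p 0); lia.
  - unfold right_column in H1. destruct (Z.leb_spec (- 2 * k - 1) 0); [| lia].
    rewrite (at_pos_fun H1 H2). split; auto. apply rt_refl.
Qed.

Lemma left_piece {i j p q a b} : at_pos c2 i j (left_column (2 * p)) a -> at_pos c2 i j q b ->
  p <= q -> 2 * p <= q -> exists s, left_at (A := A) (B := B) i j (2 * p, q) s /\ S_pair s = (a, b).
Proof.
  intros H1 H2 L L'. destruct (at_pos_range H1) as (Hi & Hj & K & _).
  destruct (at_pos_range H2) as (_ & _ & _ & K'). cbn [sgn] in *.
  destruct (@left_at_intro A B i j (2 * p, q)) as (s & H); auto.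
  { constructor; auto.
    - apply Zle_below; auto. intros N. rewrite left_column_even in K.
      destruct (Z.leb_spec p 0); [| lia]. rewrite Z.sub_opp_r. apply K; lia.
    - apply Zle_above; auto. intros N. apply K'; lia. }
  exists s; split; auto. destruct (S_pair_left H) as [H1' H2'].
  apply injective_projections; eapply at_pos_fun; eauto.
Qed.

Lemma right_piece {i j p q a b} : at_pos c1 i j (right_column (2 * p)) a -> at_pos c1 i j q b ->
  q <= p -> q <= 2 * p -> exists s, right_at (A := A) (B := B) i j (2 * p, q) s /\ S_pair s = (a, b).
Proof.
  intros H1 H2 L L'. destruct (at_pos_range H1) as (Hi & Hj & K & _).
  destruct (at_pos_range H2) as (_ & _ & _ & K'). cbn [sgn] in *.
  destruct (@right_at_intro A B i j (2 * p, q)) as (s & H); auto.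
  { constructor; auto.
    - apply Zle_below; auto. intros N. rewrite Z.sub_opp_r. apply K'; lia.
    - apply Zle_above; auto. intros N. rewrite right_column_even in K.
      destruct (Z.leb_spec p 0); [lia |]. apply K; lia. }
  exists s; split; auto. destruct (S_pair_right H) as [H1' H2'].
  apply injective_projections; eapply at_pos_fun; eauto.
Qed.

Lemma ordinary_left_column i j t a : at_pos c2 i j t a -> ~ O a ->
  exists p, left_column (2 * p) = t /\ (t <= 0 /\ p = t \/ 0 < t /\ t = 2 * p).
Proof.
  intros H N. rewrite (at_pos_otimes H) in N; cbn [sgn] in N.
  destruct (Z_le_gt_dec t 0).
  - exists t. rewrite left_column_even. destruct (Z.leb_spec t 0); lia.
  - destruct (Z.Even_or_Odd t) as [(p & ->) | D]; [| destruct N; split; auto; lia].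
    exists p. rewrite left_column_even. destruct (Z.leb_spec p 0); lia.
Qed.

Lemma ordinary_right_column i j t a : at_pos c1 i j t a -> ~ O a ->
  exists p, right_column (2 * p) = t /\ (0 <= t /\ p = t \/ t < 0 /\ t = 2 * p).
Proof.
  intros H N. rewrite (at_pos_otimes H) in N; cbn [sgn] in N.
  destruct (Z_le_gt_dec 0 t).
  - exists t. rewrite right_column_even. destruct (Z.leb_spec t 0); lia.
  - destruct (Z.Even_or_Odd t) as [(p & ->) | D]; [| destruct N; split; auto; lia].
    exists p. rewrite right_column_even. destruct (Z.leb_spec p 0); lia.
Qed.

Lemma left_pair_exists a b : ~ O a -> star eII a b -> exists s, S_pair s = (a, b).
Proof.
  intros N H. destruct (at_pos_any c2 a) as (i & j & t & P).
  destruct (at_pos_star_from P H) as (q & L & Q).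
  destruct (ordinary_left_column P N) as (p & <- & D).
  destruct (left_piece (p := p) P Q) as (s & _ & E); [lia | lia |]. eauto.
Qed.

Lemma right_pair_exists a b : ~ O a -> star eI b a -> exists s, S_pair s = (a, b).
Proof.
  intros N H. destruct (at_pos_any c1 b) as (i & j & q & Q).
  destruct (at_pos_star_from Q H) as (t & L & P).
  destruct (ordinary_right_column P N) as (p & <- & D).
  destruct (right_piece (p := p) P Q) as (s & _ & E); [lia | lia |]. eauto.
Qed.

(** From column [p] to column [p + 1] the position on the diagonal grows by one if [p < 0] and by
    two otherwise; the position skipped is odd and positive, hence an otimes-vertex. *)
Lemma left_edge1_image {i j p q s s'} : left_at i j (2 * p, q) s -> left_at i j (2 * (p + 1), q) s' ->
  snd (S_pair s) = snd (S_pair s') /\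
  next_ordinary eII O (fst (S_pair s)) (fst (S_pair s')) /\
  star eII (fst (S_pair s')) (snd (S_pair s')).
Proof.
  intros H H'. destruct (S_pair_left H) as [H1 H2], (S_pair_left H') as [H1' H2'].
  destruct (at_pos_range H1') as (Hi & Hj & _ & K); cbn [sgn] in K.
  rewrite left_column_even in H1, H1', K.
  repeat split; [exact (at_pos_fun H2 H2') | | apply (left_at_image H')].
  destruct (Z.leb_spec p 0), (Z.leb_spec (p + 1) 0); try lia.
  - left. now apply (at_pos_edge H1 H1').
  (* At [p = 0] both formulas for the column give 0, and the skipped position is 1. *)
  - assert (p = 0) as -> by lia. right. destruct (@at_pos_exists A B c2 i j 1) as (w & W).
    { repeat split; auto; cbn [sgn]; intros; [lia |].
      eapply mem_convex; [exact Hj | apply K |]; lia. }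
    exists w. rewrite (at_pos_otimes W), (at_pos_edge H1 W), (at_pos_edge W H1').
    cbn [sgn]; repeat split; try lia. exists 0; lia.
  - right. destruct (@at_pos_exists A B c2 i j (2 * p + 1)) as (w & W).
    { repeat split; auto; cbn [sgn]; intros; [lia |].
      eapply mem_convex; [exact Hj | apply K |]; lia. }
    exists w. rewrite (at_pos_otimes W), (at_pos_edge H1 W), (at_pos_edge W H1').
    cbn [sgn]; repeat split; try lia. exists p; lia.
Qed.

Lemma right_edge1_image {i j p q s s'} : right_at i j (2 * p, q) s -> right_at i j (2 * (p + 1), q) s' ->
  snd (S_pair s) = snd (S_pair s') /\
  star eI (snd (S_pair s)) (fst (S_pair s)) /\
  next_ordinary eI O (fst (S_pair s)) (fst (S_pair s')).
Proof.
  intros H H'. destruct (S_pair_right H) as [H1 H2], (S_pair_right H') as [H1' H2'].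
  destruct (at_pos_range H1) as (Hi & Hj & _ & K); cbn [sgn] in K.
  rewrite right_column_even in H1, H1', K.
  repeat split; [exact (at_pos_fun H2 H2') | apply (right_at_image H) |].
  destruct (Z.leb_spec p 0), (Z.leb_spec (p + 1) 0); try lia.
  - right. destruct (@at_pos_exists A B c1 i j (2 * p + 1)) as (w & W).
    { repeat split; auto; cbn [sgn]; intros; [lia |].
      eapply mem_convex; [apply K | exact Hj |]; lia. }
    exists w. rewrite (at_pos_otimes W), (at_pos_edge H1 W), (at_pos_edge W H1').
    cbn [sgn]; repeat split; try lia. exists p; lia.
  - left. apply (at_pos_edge H1 H1'). lia.
  - left. now apply (at_pos_edge H1 H1').
Qed.

Lemma S_edge1_image s s' : edge (S_pieces A B) (Full c1) s s' ->
  snd (S_pair s) = snd (S_pair s') /\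
  (next_ordinary eII O (fst (S_pair s)) (fst (S_pair s')) /\
   star eII (fst (S_pair s')) (snd (S_pair s')) \/
   star eI (snd (S_pair s)) (fst (S_pair s)) /\
   next_ordinary eI O (fst (S_pair s)) (fst (S_pair s'))).
Proof.
  intros [(i & j & v & v' & H & H' & K) | (i & j & v & v' & H & H' & K)]%S_pieces_edge;
    remember (Full c1) as k eqn:Ek; destruct K; try discriminate.
  - destruct (left_edge1_image H H'); auto.
  - destruct (right_edge1_image H H'); auto.
Qed.

Lemma S_edge2_image s s' : edge (S_pieces A B) (Full c2) s s' ->
  fst (S_pair s) = fst (S_pair s') /\
  (star eII (fst (S_pair s)) (snd (S_pair s)) /\ eII (snd (S_pair s)) (snd (S_pair s')) \/
   star eI (snd (S_pair s')) (fst (S_pair s')) /\ eI (snd (S_pair s)) (snd (S_pair s'))).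
Proof.
  intros [(i & j & v & v' & H & H' & K) | (i & j & v & v' & H & H' & K)]%S_pieces_edge;
    remember (Full c2) as k eqn:Ek; destruct K; try discriminate.
  - destruct (S_pair_left H) as [H1 H2], (S_pair_left H') as [H1' H2'].
    split; [exact (at_pos_fun H1 H1') | left]. split; [apply (left_at_image H) |].
    now apply (at_pos_edge H2 H2').
  - destruct (S_pair_right H) as [H1 H2], (S_pair_right H') as [H1' H2'].
    split; [exact (at_pos_fun H1 H1') | right]. split; [apply (right_at_image H') |].
    now apply (at_pos_edge H2 H2').
Qed.

Lemma S_left_half_image s s' : edge (S_pieces A B) LeftHalf s s' ->
  S_pair s' = (snd (S_pair s), snd (S_pair s)) /\ eII (fst (S_pair s)) (snd (S_pair s)).
Proof.
  intros [(i & j & v & v' & H & H' & K) | (i & j & v & v' & H & H' & K)]%S_pieces_edge;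
    remember LeftHalf as k eqn:Ek; destruct K as [| | k0 Hk]; try discriminate.
  destruct (S_pair_left H) as [H1 H2], (S_pair_left H') as [H1' H2'].
  rewrite left_column_even in H1. unfold left_column in H1'.
  destruct (Z.leb_spec (2 * k0 + 1) 0); [lia |]. split.
  - apply injective_projections; [exact (at_pos_fun H1' H2) | exact (at_pos_fun H2' H2)].
  - apply (at_pos_edge H1 H2). destruct (Z.leb_spec k0 0); lia.
Qed.

Lemma S_right_half_image s s' : edge (S_pieces A B) RightHalf s s' ->
  S_pair s = (snd (S_pair s'), snd (S_pair s')) /\ eI (snd (S_pair s')) (fst (S_pair s')).
Proof.
  intros [(i & j & v & v' & H & H' & K) | (i & j & v & v' & H & H' & K)]%S_pieces_edge;
    remember RightHalf as k eqn:Ek; destruct K as [| | k0 Hk]; try discriminate.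
  destruct (S_pair_right H) as [H1 H2], (S_pair_right H') as [H1' H2'].
  replace (- 2 * k0) with (2 * - k0) in H1' by lia. rewrite right_column_even in H1'.
  unfold right_column in H1.
  destruct (Z.leb_spec (- 2 * k0 - 1) 0); [| lia]. split.
  - apply injective_projections; [exact (at_pos_fun H1 H2') | exact (at_pos_fun H2 H2')].
  - apply (at_pos_edge H2' H1'). destruct (Z.leb_spec (- k0) 0); lia.
Qed.

Lemma next_ordinary_at_pos {c i j t a a'} : at_pos c i j t a -> next_ordinary (edge C c) O a a' ->
  exists t', at_pos c i j t' a' /\ (t' = t + 1 \/ t' = t + 2 /\ sgn c * (t + 1) < 0 /\ Z.Odd (t + 1)).
Proof.
  intros P [H | (w & W & H & H')].
  - exists (t + 1); split; auto. exact (at_pos_next P H).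
  - pose proof (at_pos_next P H) as Q. exists (t + 2). split.
    + replace (t + 2) with (t + 1 + 1) by lia. exact (at_pos_next Q H').
    + apply (at_pos_otimes Q) in W. auto.
Qed.

(** Conversely, consecutive ordinary positions are those of consecutive integer columns, and row [b]
    meets both of them. *)
Lemma S_edge1_left a a' b : ~ O a -> ~ O a' -> next_ordinary eII O a a' -> star eII a' b ->
  exists s s', S_pair s = (a, b) /\ S_pair s' = (a', b) /\ edge (S_pieces A B) (Full c1) s s'.
Proof.
  intros N N' H L. destruct (at_pos_any c2 a) as (i & j & t & P).
  destruct (next_ordinary_at_pos P H) as (t' & P' & D).
  destruct (at_pos_star_from P' L) as (q & Lq & Q).
  destruct (ordinary_left_column P N) as (p & Ep & Dp).
  destruct (ordinary_left_column P' N') as (p' & Ep' & Dp').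
  assert (p' = p + 1) as -> by (unfold Z.Odd in D; cbn [sgn] in D; lia).
  rewrite <- Ep in P. rewrite <- Ep' in P'.
  destruct (left_piece (p := p) P Q) as (s & Hs & Es); [lia | lia |].
  destruct (left_piece (p := p + 1) P' Q) as (s' & Hs' & Es'); [lia | lia |].
  exists s, s'; repeat split; auto. apply S_pieces_edge. left.
  do 4 eexists; repeat split; eauto. constructor.
Qed.

Lemma S_edge1_right a a' b : ~ O a -> ~ O a' -> star eI b a -> next_ordinary eI O a a' ->
  exists s s', S_pair s = (a, b) /\ S_pair s' = (a', b) /\ edge (S_pieces A B) (Full c1) s s'.
Proof.
  intros N N' L H. destruct (at_pos_any c1 b) as (i & j & q & Q).
  destruct (at_pos_star_from Q L) as (t & Lq & P).
  destruct (next_ordinary_at_pos P H) as (t' & P' & D).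
  destruct (ordinary_right_column P N) as (p & Ep & Dp).
  destruct (ordinary_right_column P' N') as (p' & Ep' & Dp').
  assert (p' = p + 1) as -> by (unfold Z.Odd in D; cbn [sgn] in D; lia).
  rewrite <- Ep in P. rewrite <- Ep' in P'.
  destruct (right_piece (p := p) P Q) as (s & Hs & Es); [lia | lia |].
  destruct (right_piece (p := p + 1) P' Q) as (s' & Hs' & Es'); [lia | lia |].
  exists s, s'; repeat split; auto. apply S_pieces_edge. right.
  do 4 eexists; repeat split; eauto. constructor.
Qed.

Lemma S_left_half_exists a o : O o -> eII a o ->
  exists s s', S_pair s = (a, o) /\ S_pair s' = (o, o) /\ edge (S_pieces A B) LeftHalf s s'.
Proof.
  intros Oo H. destruct (at_pos_any c2 a) as (i & j & t & P).
  pose proof (at_pos_next P H) as Q. apply (at_pos_otimes Q) in Oo as [L (k & E)].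
  cbn [sgn] in L. assert (t = 2 * k) as -> by lia.
  assert (E' : left_column (2 * k) = 2 * k) by (rewrite left_column_even; destruct (Z.leb_spec k 0); lia).
  rewrite <- E' in P. destruct (left_piece (p := k) P Q) as (s & Hs & Es); [lia | lia |].
  destruct (at_pos_range Q) as (Hi & Hj & _ & K); cbn [sgn] in K.
  destruct (@left_at_intro A B i j (2 * k + 1, 2 * k + 1)) as (s' & Hs'); auto.
  { apply left_Bsail_half; [lia |]. apply Zle_above; [exact Hj | intros _; apply K; lia]. }
  exists s, s'; repeat split; auto.
  - destruct (S_pair_left Hs') as [H1 H2]. unfold left_column in H1.
    destruct (Z.leb_spec (2 * k + 1) 0); [lia |].
    apply injective_projections; eapply at_pos_fun; eauto.
  - apply S_pieces_edge. left. do 4 eexists; repeat split; eauto. constructor; lia.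
Qed.

Lemma S_right_half_exists a o : O o -> eI o a ->
  exists s s', S_pair s = (o, o) /\ S_pair s' = (a, o) /\ edge (S_pieces A B) RightHalf s s'.
Proof.
  intros Oo H. destruct (at_pos_any c1 o) as (i & j & t & Q).
  pose proof (at_pos_next Q H) as P. apply (at_pos_otimes Q) in Oo as [L (k' & E)].
  (* The negative odd position [2 * k' + 1] is rewritten in the form [- 2 * k - 1] with [k >= 0]
     used for right half-edges. *)
  cbn [sgn] in L. set (k := - k' - 1). assert (t = - 2 * k - 1) as -> by lia.
  assert (E' : right_column (2 * - k) = - 2 * k - 1 + 1)
    by (rewrite right_column_even; destruct (Z.leb_spec (- k) 0); lia).
  rewrite <- E' in P. destruct (right_piece (p := - k) P Q) as (s & Hs & Es); [lia | lia |].
  destruct (at_pos_range Q) as (Hi & Hj & _ & K); cbn [sgn] in K.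
  destruct (@right_at_intro A B i j (- 2 * k - 1, - 2 * k - 1)) as (s' & Hs'); auto.
  { apply right_Bsail_half; [lia |]. apply Zle_below; auto. intros _.
    replace (j - (2 * k + 1)) with (j + (- 2 * k - 1)) by lia. apply K; lia. }
  exists s', s; repeat split; auto.
  - destruct (S_pair_right Hs') as [H1 H2]. unfold right_column in H1.
    destruct (Z.leb_spec (- 2 * k - 1) 0); [| lia].
    apply injective_projections; eapply at_pos_fun; eauto.
  - apply S_pieces_edge. right. replace (2 * - k) with (- 2 * k) in Hs by lia.
    do 4 eexists; repeat split; eauto. constructor; lia.
Qed.

Lemma S_edge2_left a b b' : ~ O a -> star eII a b -> eII b b' ->
  exists s s', S_pair s = (a, b) /\ S_pair s' = (a, b') /\ edge (S_pieces A B) (Full c2) s s'.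
Proof.
  intros N L H. destruct (at_pos_any c2 a) as (i & j & t & P).
  destruct (at_pos_star_from P L) as (q & Lq & Q). pose proof (at_pos_next Q H) as Q'.
  destruct (ordinary_left_column P N) as (p & <- & Dp).
  destruct (left_piece (p := p) P Q) as (s & Hs & Es); [lia | lia |].
  destruct (left_piece (p := p) P Q') as (s' & Hs' & Es'); [lia | lia |].
  exists s, s'; repeat split; auto. apply S_pieces_edge. left.
  do 4 eexists; repeat split; eauto. constructor.
Qed.

Lemma S_edge2_right a b b' : ~ O a -> star eI b' a -> eI b b' ->
  exists s s', S_pair s = (a, b) /\ S_pair s' = (a, b') /\ edge (S_pieces A B) (Full c2) s s'.
Proof.
  intros N L H. destruct (at_pos_any c1 b) as (i & j & q & Q).
  pose proof (at_pos_next Q H) as Q'. destruct (at_pos_star_from Q' L) as (t & Lq & P).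
  destruct (ordinary_right_column P N) as (p & <- & Dp).
  destruct (right_piece (p := p) P Q) as (s & Hs & Es); [lia | lia |].
  destruct (right_piece (p := p) P Q') as (s' & Hs' & Es'); [lia | lia |].
  exists s, s'; repeat split; auto. apply S_pieces_edge. right.
  do 4 eexists; repeat split; eauto. constructor.
Qed.

Definition S_al (v : S_graph A B) : C := fst (S_image (proj1_sig v)).
Definition S_be (v : S_graph A B) : C := snd (S_image (proj1_sig v)).

Lemma S_image_pieces {u v : S_graph A B} {k s s'} : S_pair s = (S_al u, S_be u) ->
  S_pair s' = (S_al v, S_be v) -> edge (S_pieces A B) k s s' ->
  edge (S_with_halves A B) k (proj1_sig u) (proj1_sig v).
Proof.
  intros E E' H. exists s, s'; repeat split; auto; apply S_image_inj;
    rewrite S_image_cls; [rewrite E | rewrite E']; apply surjective_pairing.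
Qed.

Lemma S_al_ordinary v : ~ O (S_al v).
Proof.
  destruct v as [w N]; unfold S_al; simpl. intros H. apply N, S_otimes_image.
  exists (fst (S_image w)); split; auto.
  rewrite (surjective_pairing (S_image w)) at 1; f_equal.
  destruct (cls_surj w) as (s & <-). rewrite S_image_cls in *.
  destruct (S_pieces_cases s) as [(o & ->) | [(i & j & p & Hs) | (i & j & p & Hs)]]; auto.
  - symmetry; now apply (left_at_image Hs).
  - symmetry; now apply (right_at_image Hs).
Qed.

(** Full 1-edges of left and right B-sails give the first two alternatives of [rep_e1]; two
    half-edges meeting at a deleted otimes-vertex give the third. *)
Theorem S_graph_represents :
  represents (edge (S_graph A B) c1) (edge (S_graph A B) c2) eI eII O S_al S_be.
Proof.
  split.
  - intros u v E E'. apply sig_eq, S_image_inj. now apply injective_projections.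
  - apply S_al_ordinary.
  - intros [w N]; unfold S_al, S_be; simpl. destruct (cls_surj w) as (s & <-).
    rewrite S_image_cls.
    destruct (S_pieces_cases s) as [(o & ->) | [(i & j & p & Hs) | (i & j & p & Hs)]].
    + left; apply rt_refl.
    + left; apply (left_at_image Hs).
    + right; apply (right_at_image Hs).
  - intros a b N H.
    assert (exists s, S_pair s = (a, b)) as (s & E)
      by (destruct H; auto using left_pair_exists, right_pair_exists).
    (* A deleted vertex has an otimes-vertex as first component, so no pair with ordinary first
       component is lost. *)
    assert (M : ~ S_otimes (cls (@S_glue A B) s)).
    { rewrite S_otimes_image, S_image_cls, E. intros (o & Oo & [= -> ->]). auto. }
    exists (exist (fun w => ~ S_otimes w) _ M). unfold S_al, S_be; simpl. now rewrite S_image_cls, E.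
  - intros u v; split.
    + intros [(s & s' & Eu & Ev & H) |
              (_ & w & Ow & (s & s1 & Eu & Ew & H) & (s2 & s' & Ew' & Ev & H'))];
        unfold S_al, S_be; rewrite Eu, Ev, !S_image_cls.
      * apply S_edge1_image in H. tauto.
      * apply S_left_half_image in H as [H1 H2]. apply S_right_half_image in H' as [H1' H2'].
        rewrite S_otimes_image in Ow. destruct Ow as (o & Oo & Eo).
        rewrite Ew, S_image_cls, H1 in Eo. injection Eo as Eo _.
        rewrite Ew in Ew'. apply (f_equal S_image) in Ew'. rewrite !S_image_cls, H1, H1' in Ew'.
        injection Ew' as Ew'. split; [exact Ew' |]. right; right.
        split; [subst o; exact Oo | split; assumption].
    + intros [Eb [[H L] | [[L H] | (Oo & H & H')]]].
      * left. destruct (S_edge1_left (S_al_ordinary u) (S_al_ordinary v) H L) as (s & s' & E & E' & K).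
        rewrite <- Eb in E. exact (S_image_pieces E E' K).
      * left. destruct (S_edge1_right (S_al_ordinary u) (S_al_ordinary v) L H) as (s & s' & E & E' & K).
        rewrite Eb in E'. exact (S_image_pieces E E' K).
      * right. split; auto. exists (cls _ (inl (S_be u))).
        split; [exists (S_be u); auto |].
        destruct (S_left_half_exists Oo H) as (s & s' & E & E' & K).
        rewrite <- Eb in H'.
        destruct (S_right_half_exists Oo H') as (s2 & s2' & E2 & E2' & K2).
        split; [exists s, s' | exists s2, s2']; repeat split; auto; apply S_image_inj;
          rewrite !S_image_cls.
        -- rewrite E; apply surjective_pairing.
        -- now rewrite E'.
        -- now rewrite E2.
        -- rewrite E2', Eb; apply surjective_pairing.
  - intros u v; split.
    + intros [(s & s' & Eu & Ev & H) | [D _]]; [| discriminate].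
      unfold S_al, S_be. rewrite Eu, Ev, !S_image_cls. now apply S_edge2_image.
    + intros [Ea [[L H] | [L H]]]; left.
      * destruct (S_edge2_left (S_al_ordinary u) L H) as (s & s' & E & E' & K).
        rewrite Ea in E'. exact (S_image_pieces E E' K).
      * destruct (S_edge2_right (S_al_ordinary v) L H) as (s & s' & E & E' & K).
        rewrite <- Ea in E. exact (S_image_pieces E E' K).
Qed.

End SGraphRepresents.

(** * The theorem *)

Lemma represents_isomorphism_base (V : Type) (e1 e2 : relation V) (C D : digraph) (f : C -> D)
    (O : C -> Prop) (O' : D -> Prop) al be :
  is_isomorphism C D f -> (forall a, O a <-> O' (f a)) ->
  represents e1 e2 (edge C c1) (edge C c2) O al be ->
  represents e1 e2 (edge D c1) (edge D c2) O' (fun v => f (al v)) (fun v => f (be v)).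
Proof.
  intros [(g & gf & fg) He] HO HR.
  assert (inj : forall a b, f a = f b -> a = b) by (intros a b E; rewrite <- (gf a), E; apply gf).
  assert (He' : forall c a b, edge D c a b <-> edge C c (g a) (g b))
    by (intros c a b; now rewrite He, !fg).
  assert (Hs : forall c a b, star (edge D c) (f a) (f b) <-> star (edge C c) a b).
  { intros c a b; split.
    - rewrite <- (gf a), <- (gf b), !fg. apply star_map. intros u v; apply He'.
    - apply star_map. intros u v; apply He. }
  assert (Hn : forall c a b, next_ordinary (edge D c) O' (f a) (f b) <-> next_ordinary (edge C c) O a b).
  { intros c a b; unfold next_ordinary; rewrite <- He; split; (intros [H | (w & W & H & H')]; [now left | right]).
    - exists (g w). rewrite HO, !He, fg; auto.
    - exists (f w). rewrite <- HO, <- !He; auto. }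
  split.
  - intros u v E E'. apply (rep_inj HR); auto.
  - intros v. rewrite <- HO. apply (rep_ordinary HR).
  - intros v. rewrite !Hs. apply (rep_dom HR).
  - intros a b N H. rewrite <- (fg a), <- (fg b), !Hs, <- HO in *.
    destruct (rep_surj HR N H) as (v & <- & <-). exists v; auto.
  - intros u v. rewrite (rep_e1 HR), !Hs, !Hn, <- HO, <- !He.
    split; intros [E H]; (split; [congruence | exact H]) || (split; [now apply inj | exact H]).
  - intros u v. rewrite (rep_e2 HR), !Hs, <- !He.
    split; intros [E H]; (split; [congruence | exact H]) || (split; [now apply inj | exact H]).
Qed.

Lemma represents_isomorphism (G H : digraph) (f : G -> H) (C : Type) (eI eII : relation C) O al be :
  is_isomorphism G H f ->
  represents (edge H c1) (edge H c2) eI eII O al be ->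
  represents (edge G c1) (edge G c2) eI eII O (fun v => al (f v)) (fun v => be (f v)).
Proof.
  intros [(g & gf & fg) He] HR. split.
  - intros u v E E'. rewrite <- (gf u), <- (gf v). f_equal. now apply (rep_inj HR).
  - intros v; apply (rep_ordinary HR).
  - intros v; apply (rep_dom HR).
  - intros a b N K. destruct (rep_surj HR N K) as (v & <- & <-). exists (g v). now rewrite fg.
  - intros u v. now rewrite He, (rep_e1 HR).
  - intros u v. now rewrite He, (rep_e2 HR).
Qed.

(** Both the pairs that occur and the edges between them are described in terms of [C] and [O]
    alone, so vertices with equal pairs can be matched. *)
Lemma represents_unique {G H : digraph} {C : Type} {eI eII : relation C} {O al be al' be'} :
  represents (edge G c1) (edge G c2) eI eII O al be ->
  represents (edge H c1) (edge H c2) eI eII O al' be' ->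
  isomorphic G H.
Proof.
  intros HG HH.
  assert (Ex : forall u : G, exists v : H, al' v = al u /\ be' v = be u).
  { intros u. apply (rep_surj HH); [apply (rep_ordinary HG) | apply (rep_dom HG)]. }
  set (f u := proj1_sig (constructive_indefinite_description _ (Ex u))).
  assert (Hf : forall u, al' (f u) = al u /\ be' (f u) = be u)
    by (intros u; apply (proj2_sig (constructive_indefinite_description _ (Ex u)))).
  exists f; split.
  - apply bijective_of_injective_surjective.
    + intros u v E. destruct (Hf u) as [E1 E2], (Hf v) as [E3 E4].
      rewrite E in E1, E2. apply (rep_inj HG); congruence.
    + intros v. destruct (rep_surj HG (rep_ordinary HH v) (rep_dom HH v)) as (u & E1 & E2).
      exists u. destruct (Hf u). apply (rep_inj HH); congruence.
  - intros c u v. destruct (Hf u) as [E1 E2], (Hf v) as [E3 E4]. destruct c.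
    + rewrite (rep_e1 HG), (rep_e1 HH), E1, E2, E3, E4. reflexivity.
    + rewrite (rep_e2 HG), (rep_e2 HH), E1, E2, E3, E4. reflexivity.
Qed.

Theorem theorem4 (G : digraph)
  (Gconn : weakly_connected G) (Gsimple : no_multiple_edges G) :
  (exists A B : index_set, isomorphic G (S_graph A B)) <->
  (exists M : central_marking G,
     axiom_B0 G /\ axiom_B1 M /\ axiom_B2 M /\ axiom_B3 M /\ axiom_B4 M /\
     axiom_B3' M /\ axiom_B4' M /\ axiom_BA M).
Proof.
  split.
  - intros (A & B & f & Hf).
    destruct (represented_axioms RA2_central_like
      (represents_isomorphism Hf S_graph_represents)) as (M & B0 & B1 & B2 & B3 & B4 & B3' & B4' & BA).
    exists M. repeat (split; [assumption |]). exists A, B. exact BA.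
  - intros (M & B0 & B1 & B2 & B3 & B4 & B3' & B4' & A & B & f & Hf & HO).
    (* The index sets provided by (BA) serve for the S-graph; both graphs are then represented over
       [RA2 A B]. *)
    exists A, B.
    pose proof (central_like_isomorphism _ Hf HO RA2_central_like) as HC.
    pose proof (marked_graph_represents Gsimple B0 B1 B2 B3 B4 B3' B4' HC) as HR.
    exact (represents_unique (represents_isomorphism_base _ Hf HO HR) S_graph_represents).
Qed.
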